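(* Let $T$ be any recursively enumerable extension of $\mathsf{PA}(\mathsf{K})$ such that $T\nvdash\Box\bot$. Then the following are equivalent: (1) $T$ has $\Delta_0(\Box)$-DP and $(\Sigma_1(\Box),\Sigma_1)$-DP; (2) $T$ has $\mathrm{B}$-EP; (3) $T$ has $\Sigma_1(\Box)$-EP; (4) $T$ has $\Sigma_1(\Box)$-DP.
   Context: $\mathcal{L}_A(\Box)$ is the language of arithmetic $\{0,S,+,\times,\le,=\}$ plus a unary modal operator $\Box$; derivations use modus ponens, generalization and necessitation (from $\varphi$ infer $\Box\varphi$). $\mathsf{PA}_\Box$ is Peano arithmetic plus first-order logical axioms for $\mathcal{L}_A(\Box)$-formulas (including universal instantiation for $\mathcal{L}_A$-terms) and induction for all $\mathcal{L}_A(\Box)$-formulas; $\mathsf{PA}(\mathsf{K})$ adds universal closures of all $\Box(\varphi\to\psi)\to(\Box\varphi\to\Box\psi)$. $\mathrm{B}$ is the class of formulas $\Box\varphi$; $\Delta_0(\Box)$ is the smallest class containing $\Delta_0$ arithmetic formulas and $\mathrm{B}$, closed under $\land,\lor,\forall x<t,\exists x<t$; $\Sigma_1(\Box)$ is the smallest class containing arithmetic $\Sigma_1$ formulas and $\mathrm{B}$, closed under $\land,\lor,\exists x,\forall x<t$ ($t$ an $\mathcal{L}_A$-term not containing $x$). $T$ has $\Gamma$-DP if for $\Gamma$ sentences $\varphi,\psi$, $T\vdash\varphi\lor\psi$ implies $T\vdash\varphi$ or $T\vdash\psi$; $(\Gamma,\Sigma_1)$-DP is the same with $\varphi\in\Gamma$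 and $\psi$ an arithmetic $\Sigma_1$ sentence; $T$ has $\Gamma$-EP if for every $\Gamma$ formula $\varphi(x)$ with no free variables other than $x$, $T\vdash\exists x\varphi(x)$ implies $T\vdash\varphi(\overline n)$ for some natural number $n$ ($\overline n$ the numeral). *)

(* Defs.v *)
From Stdlib Require Vector Fin Cantor.

Set Implicit Arguments.

(** * Syntax of L_A(Box)

    Variables are de Bruijn indices: [All phi] and [Ex phi] bind index 0 of
    [phi] and shift the other ones. *)

Inductive term : Type :=
| Var (n : nat)
| Zero
| Succ (t : term)
| Plus (t u : term)
| Mult (t u : term).

Inductive form : Type :=
| Bot
| Eq (t u : term)
| Le (t u : term)
| Imp (p q : form)
| And (p q : form)
| Or (p q : form)
| All (p : form)
| Ex (p : form)
| Box (p : form).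

Definition Neg (p : form) : form := Imp p Bot.
Definition Iff (p q : form) : form := And (Imp p q) (Imp q p).

(** [<] is not primitive in L_A. *)
Definition Lt (t u : term) : form := Le (Succ t) u.

Fixpoint numeral (n : nat) : term :=
  match n with
  | 0 => Zero
  | S m => Succ (numeral m)
  end.

(** ** Simultaneous capture-avoiding substitution *)

Fixpoint tsubst (s : nat -> term) (t : term) : term :=
  match t with
  | Var n => s n
  | Zero => Zero
  | Succ t => Succ (tsubst s t)
  | Plus t u => Plus (tsubst s t) (tsubst s u)
  | Mult t u => Mult (tsubst s t) (tsubst s u)
  end.

Definition scons (t : term) (s : nat -> term) (n : nat) : term :=
  match n with
  | 0 => t
  | S m => s m
  end.

Definition shift (n : nat) : term := Var (S n).

Definition up (s : nat -> term) : nat -> term :=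
  scons (Var 0) (fun n => tsubst shift (s n)).

Fixpoint subst (s : nat -> term) (p : form) : form :=
  match p with
  | Bot => Bot
  | Eq t u => Eq (tsubst s t) (tsubst s u)
  | Le t u => Le (tsubst s t) (tsubst s u)
  | Imp p q => Imp (subst s p) (subst s q)
  | And p q => And (subst s p) (subst s q)
  | Or p q => Or (subst s p) (subst s q)
  | All p => All (subst (up s) p)
  | Ex p => Ex (subst (up s) p)
  | Box p => Box (subst s p)
  end.

(** [p(t)] for [p = p(x)], where [x] is the variable of index 0. *)
Definition inst (t : term) (p : form) : form := subst (scons t Var) p.

Definition tlift (t : term) : term := tsubst shift t.
Definition lift (p : form) : form := subst shift p.

(** The lifted bound [tlift t] cannot contain the quantified variable. *)
Definition BAll (t : term) (p : form) : form := All (Imp (Lt (Var 0) (tlift t)) p).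
Definition BEx (t : term) (p : form) : form := Ex (And (Lt (Var 0) (tlift t)) p).

(** ** Free variables *)

(** All free variables have an index [< k]. *)
Fixpoint tbounded (k : nat) (t : term) : Prop :=
  match t with
  | Var n => n < k
  | Zero => True
  | Succ t => tbounded k t
  | Plus t u | Mult t u => tbounded k t /\ tbounded k u
  end.

Fixpoint bounded (k : nat) (p : form) : Prop :=
  match p with
  | Bot => True
  | Eq t u | Le t u => tbounded k t /\ tbounded k u
  | Imp p q | And p q | Or p q => bounded k p /\ bounded k q
  | All p | Ex p => bounded (S k) p
  | Box p => bounded k p
  end.

Definition sentence (p : form) : Prop := bounded 0 p.

Definition universal_closure (p q : form) : Prop :=
  exists n, q = Nat.iter n All p /\ sentence q.

(** * Derivations *)

Inductive logical_axiom : form -> Prop :=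
| ax_K p q : logical_axiom (Imp p (Imp q p))
| ax_S p q r :
    logical_axiom (Imp (Imp p (Imp q r)) (Imp (Imp p q) (Imp p r)))
| ax_dne p : logical_axiom (Imp (Neg (Neg p)) p)
| ax_and_intro p q : logical_axiom (Imp p (Imp q (And p q)))
| ax_and_left p q : logical_axiom (Imp (And p q) p)
| ax_and_right p q : logical_axiom (Imp (And p q) q)
| ax_or_left p q : logical_axiom (Imp p (Or p q))
| ax_or_right p q : logical_axiom (Imp q (Or p q))
| ax_or_elim p q r :
    logical_axiom (Imp (Imp p r) (Imp (Imp q r) (Imp (Or p q) r)))
| ax_all_elim p t : logical_axiom (Imp (All p) (inst t p))
| ax_all_imp p q : logical_axiom (Imp (All (Imp p q)) (Imp (All p) (All q)))
| ax_all_vacuous p : logical_axiom (Imp p (All (lift p)))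
| ax_ex_intro p t : logical_axiom (Imp (inst t p) (Ex p))
| ax_ex_elim p q :
    logical_axiom (Imp (All (Imp p (lift q))) (Imp (Ex p) q))
| ax_eq_refl t : logical_axiom (Eq t t)
| ax_eq_subst p t u :
    logical_axiom (Imp (Eq t u) (Imp (inst t p) (inst u p))).

(** A theory is given by its set of nonlogical axioms. *)
Definition theory : Type := form -> Prop.

Inductive proves (T : theory) : form -> Prop :=
| pr_axiom p : T p -> proves T p
| pr_logic p : logical_axiom p -> proves T p
| pr_mp p q : proves T (Imp p q) -> proves T p -> proves T q
| pr_gen p : proves T p -> proves T (All p)
| pr_nec p : proves T p -> proves T (Box p).

Definition extends (T U : theory) : Prop := forall p, proves U p -> proves T p.

(** * The theories PA_Box and PA(K) *)

Definition induction_formula (p : form) : form :=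
  Imp (And (inst Zero p)
           (All (Imp p (subst (scons (Succ (Var 0)) shift) p))))
      (All p).

Inductive PA_Box : theory :=
| PA_succ_zero : PA_Box (All (Neg (Eq (Succ (Var 0)) Zero)))
| PA_succ_inj :
    PA_Box (All (All (Imp (Eq (Succ (Var 1)) (Succ (Var 0))) (Eq (Var 1) (Var 0)))))
| PA_plus_zero : PA_Box (All (Eq (Plus (Var 0) Zero) (Var 0)))
| PA_plus_succ :
    PA_Box (All (All (Eq (Plus (Var 1) (Succ (Var 0))) (Succ (Plus (Var 1) (Var 0))))))
| PA_mult_zero : PA_Box (All (Eq (Mult (Var 0) Zero) Zero))
| PA_mult_succ :
    PA_Box (All (All (Eq (Mult (Var 1) (Succ (Var 0)))
                         (Plus (Mult (Var 1) (Var 0)) (Var 1)))))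
| PA_le :
    PA_Box (All (All (Iff (Le (Var 1) (Var 0))
                          (Ex (Eq (Plus (Var 0) (Var 2)) (Var 1))))))
| PA_induction p q : universal_closure (induction_formula p) q -> PA_Box q.

Inductive PA_K : theory :=
| PA_K_base p : PA_Box p -> PA_K p
| PA_K_K p q r :
    universal_closure (Imp (Box (Imp p q)) (Imp (Box p) (Box q))) r -> PA_K r.

(** * Classes of formulas *)

Inductive Delta0 : form -> Prop :=
| D0_bot : Delta0 Bot
| D0_eq t u : Delta0 (Eq t u)
| D0_le t u : Delta0 (Le t u)
| D0_imp p q : Delta0 p -> Delta0 q -> Delta0 (Imp p q)
| D0_and p q : Delta0 p -> Delta0 q -> Delta0 (And p q)
| D0_or p q : Delta0 p -> Delta0 q -> Delta0 (Or p q)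
| D0_ball t p : Delta0 p -> Delta0 (BAll t p)
| D0_bex t p : Delta0 p -> Delta0 (BEx t p).

(** A (possibly empty) block of existential quantifiers before a
    [Delta0] formula. *)
Inductive Sigma1 : form -> Prop :=
| S1_base p : Delta0 p -> Sigma1 p
| S1_ex p : Sigma1 p -> Sigma1 (Ex p).

Inductive ClassB : form -> Prop :=
| B_box p : ClassB (Box p).

Inductive Delta0_Box : form -> Prop :=
| D0B_base p : Delta0 p -> Delta0_Box p
| D0B_B p : ClassB p -> Delta0_Box p
| D0B_and p q : Delta0_Box p -> Delta0_Box q -> Delta0_Box (And p q)
| D0B_or p q : Delta0_Box p -> Delta0_Box q -> Delta0_Box (Or p q)
| D0B_ball t p : Delta0_Box p -> Delta0_Box (BAll t p)
| D0B_bex t p : Delta0_Box p -> Delta0_Box (BEx t p).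

Inductive Sigma1_Box : form -> Prop :=
| S1B_base p : Sigma1 p -> Sigma1_Box p
| S1B_B p : ClassB p -> Sigma1_Box p
| S1B_and p q : Sigma1_Box p -> Sigma1_Box q -> Sigma1_Box (And p q)
| S1B_or p q : Sigma1_Box p -> Sigma1_Box q -> Sigma1_Box (Or p q)
| S1B_ex p : Sigma1_Box p -> Sigma1_Box (Ex p)
| S1B_ball t p : Sigma1_Box p -> Sigma1_Box (BAll t p).

(** * Disjunction and existence properties *)

Definition has_DP2 (C D : form -> Prop) (T : theory) : Prop :=
  forall p q, C p -> sentence p -> D q -> sentence q ->
    proves T (Or p q) -> proves T p \/ proves T q.

Definition has_DP (C : form -> Prop) (T : theory) : Prop := has_DP2 C C T.

Definition has_EP (C : form -> Prop) (T : theory) : Prop :=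
  forall p, C p -> bounded 1 p ->
    proves T (Ex p) -> exists n, proves T (inst (numeral n) p).

(** * Partial recursive functions and recursive enumerability *)

(** Graphs of partial functions from [nat ^ k] to [nat]. *)
Definition pgraph (k : nat) : Type := Vector.t nat k -> nat -> Prop.

Fixpoint primrec_graph (k : nat) (g : pgraph k) (h : pgraph (S (S k)))
    (n : nat) (v : Vector.t nat k) (y : nat) : Prop :=
  match n with
  | 0 => g v y
  | S m => exists z, primrec_graph g h m v z
                     /\ h (Vector.cons _ m _ (Vector.cons _ z _ v)) y
  end.

Inductive partial_recursive : forall k, pgraph k -> Prop :=
| rec_zero : @partial_recursive 0 (fun _ y => y = 0)
| rec_succ : @partial_recursive 1 (fun v y => y = S (Vector.hd v))
| rec_proj k (i : Fin.t k) : @partial_recursive k (fun v y => y = Vector.nth v i)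
| rec_comp k m (g : pgraph m) (f : Fin.t m -> pgraph k) :
    partial_recursive g ->
    (forall i, partial_recursive (f i)) ->
    @partial_recursive k
      (fun v y => exists w : Vector.t nat m,
                    (forall i, f i v (Vector.nth w i)) /\ g w y)
| rec_primrec k (g : pgraph k) (h : pgraph (S (S k))) :
    partial_recursive g ->
    partial_recursive h ->
    @partial_recursive (S k)
      (fun v y => primrec_graph g h (Vector.hd v) (Vector.tl v) y)
| rec_min k (f : pgraph (S k)) :
    partial_recursive f ->
    @partial_recursive k
      (fun v y => f (Vector.cons _ y _ v) 0
                  /\ forall z, z < y -> exists u, f (Vector.cons _ z _ v) (S u)).

(** Recursively enumerable sets are the domains of unary partial recursive
    functions. *)
Definition re (A : nat -> Prop) : Prop :=
  exists f : pgraph 1, partial_recursive f /\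
    forall n, A n <-> exists y, f (Vector.cons _ n _ (Vector.nil _)) y.

(** ** Gödel numbering *)

Definition npair (a b : nat) : nat := Cantor.to_nat (a, b).

Fixpoint tcode (t : term) : nat :=
  match t with
  | Var n => npair 0 n
  | Zero => npair 1 0
  | Succ t => npair 2 (tcode t)
  | Plus t u => npair 3 (npair (tcode t) (tcode u))
  | Mult t u => npair 4 (npair (tcode t) (tcode u))
  end.

Fixpoint code (p : form) : nat :=
  match p with
  | Bot => npair 0 0
  | Eq t u => npair 1 (npair (tcode t) (tcode u))
  | Le t u => npair 2 (npair (tcode t) (tcode u))
  | Imp p q => npair 3 (npair (code p) (code q))
  | And p q => npair 4 (npair (code p) (code q))
  | Or p q => npair 5 (npair (code p) (code q))
  | All p => npair 6 (code p)
  | Ex p => npair 7 (code p)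
  | Box p => npair 8 (code p)
  end.

Definition re_theory (T : theory) : Prop :=
  re (fun n => exists p, T p /\ code p = n).

Lemma npair_inj a b c d : npair a b = npair c d -> a = c /\ b = d.
Proof.
  unfold npair; intros H; apply Cantor.to_nat_inj in H; injection H; auto.
Qed.

Lemma tcode_inj t u : tcode t = tcode u -> t = u.
Proof.
  revert u; induction t; intros []; simpl; intros H;
    apply npair_inj in H as [Ht H]; try discriminate Ht;
    try (apply npair_inj in H as [? ?]); f_equal; auto.
Qed.

Lemma code_inj p q : code p = code q -> p = q.
Proof.
  revert q; induction p; intros []; simpl; intros H;
    apply npair_inj in H as [Ht H]; try discriminate Ht;
    try (apply npair_inj in H as [? ?]); f_equal; auto using tcode_inj.
Qed.

(* Main.v *)
(** The schema [p -> Box p] holds in PA(K) for [Delta0] formulas [p], so boxes distribute over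
    everything in the definition of [Sigma1_Box] except disjunctions and existential quantifiers.
    Coding the missing choices, which for a bounded universal quantifier form a finite function,
    into one number [y], every [Sigma1_Box] formula [phi] implies [exists y, Box psi(y)] for some
    [psi], and conversely [T |- Box psi(m)] implies [T |- phi]: the choices coded by the numeral
    [m] are decided by [T], as [T] does not prove [Box Bot]. This reduces Sigma1(Box)-EP to B-EP.

    B-EP follows from the disjunction properties by a Rosser-type fixed point. If
    [T |- exists x, Box phi(x)], let A say that some [x] with [Box phi(x)], or some proof of B,
    occurs no later than all proofs of A, and let B say that a proof of A occurs before all proofs
    of B. Then [T |- A \/ B]; a comparison of actual proofs gives [T |- A] in either case, and
    the least proof of A bounds [x] by a numeral, which leaves a finite disjunction of boxed
    sentences.

    Derivability in [T] is truth in all models of [T], where [Box] is read as an arbitrary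
    predicate of formulas and environments that is compatible with substitution. *)

Require Import Defs.
From Stdlib Require Import Arith Lia List Ring Classical ClassicalEpsilon.
From Stdlib Require Import FunctionalExtensionality PropExtensionality.
From Stdlib Require Vector Fin Cantor.
Import ListNotations.

Set Implicit Arguments.

(** [T] has no reflection [Box psi -> psi], and this shapes both halves. In the reduction of the
    existence properties one direction holds in every model, the other only externally, for provable
    boxes at numerals: a false [Delta0] sentence is refutable, so a proof of its box would yield
    [Box Bot]. Choices made under the box are bounded by the coding number, so that at a numeral
    they are standard and the same in all models. In the fixed-point half A is Sigma1(Box) and B is
    arithmetical, which explains the asymmetry of the second disjunction property; the first one
    splits the finite disjunction of boxes. Provability enters only through true [Delta0] facts
    about actual proofs, so no derivability conditions are formalized: recursive enumerability gives
    a [Delta0] matrix correct in the standard numbers, and absoluteness carries its numeral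
    instances to all models. A and B refer to themselves and to each other through a parameter
    coding a pair of open formulas. Reasoning in models replaces Hilbert-style derivations, even
    under a box: a consequence valid in all models is a provable implication, to which necessitation
    and K apply. *)

(** * Substitution and free variables *)

Lemma tsubst_tsubst s r t :
  tsubst s (tsubst r t) = tsubst (fun n => tsubst s (r n)) t.
Proof. induction t; simpl; congruence. Qed.

Lemma tsubst_Var t : tsubst Var t = t.
Proof. induction t; simpl; congruence. Qed.

Lemma up_comp s r :
  (fun n => tsubst (up s) (up r n)) = up (fun n => tsubst s (r n)).
Proof.
  extensionality n; destruct n; simpl; [reflexivity|].
  rewrite !tsubst_tsubst; reflexivity.
Qed.

Lemma up_Var : up Var = Var.
Proof. extensionality n; destruct n; reflexivity. Qed.

Lemma subst_subst p : forall s r,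
  subst s (subst r p) = subst (fun n => tsubst s (r n)) p.
Proof.
  induction p; intros; simpl; rewrite ?tsubst_tsubst, ?IHp1, ?IHp2, ?IHp, ?up_comp; reflexivity.
Qed.

Lemma subst_Var p : subst Var p = p.
Proof.
  induction p; simpl; rewrite ?tsubst_Var, ?up_Var, ?IHp1, ?IHp2, ?IHp; reflexivity.
Qed.

Lemma tsubst_agree k t s r :
  tbounded k t -> (forall n, n < k -> s n = r n) -> tsubst s t = tsubst r t.
Proof.
  induction t; simpl; intros B E; f_equal; intuition.
Qed.

Lemma subst_agree p : forall k s r,
  bounded k p -> (forall n, n < k -> s n = r n) -> subst s p = subst r p.
Proof.
  assert (up_agree : forall k s r, (forall n, n < k -> s n = r n) ->
    forall n, n < S k -> up s n = up r n).
  { intros k s r E [|n] L; simpl; [reflexivity|]. rewrite E by lia; reflexivity. }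
  induction p; simpl; intros k s r B E; f_equal;
    try (eapply tsubst_agree; [|eassumption]; tauto);
    try (eapply IHp1; [|eassumption]; tauto);
    try (eapply IHp2; [|eassumption]; tauto);
    try (eapply IHp; [eassumption|]; first [exact E|apply up_agree, E]).
  reflexivity.
Qed.

Lemma tbounded_le k l t : k <= l -> tbounded k t -> tbounded l t.
Proof. induction t; simpl; intuition lia. Qed.

Lemma bounded_le p : forall k l, k <= l -> bounded k p -> bounded l p.
Proof.
  induction p; simpl; intros k l L B;
    intuition eauto using tbounded_le; eapply IHp; try eassumption; lia.
Qed.

Lemma tbounded_exists t : exists k, tbounded k t.
Proof.
  induction t as [n| |t [k IH]|t [k IH] u [l IH']|t [k IH] u [l IH']]; simpl.
  - exists (S n); lia.
  - exists 0; exact I.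
  - exists k; exact IH.
  - exists (k + l); split; eapply tbounded_le; [|eassumption| |eassumption]; lia.
  - exists (k + l); split; eapply tbounded_le; [|eassumption| |eassumption]; lia.
Qed.

Lemma bounded_exists p : exists k, bounded k p.
Proof.
  induction p as [|t u|t u|p [k IH] q [l IH']|p [k IH] q [l IH']|p [k IH] q [l IH']
    |p [k IH]|p [k IH]|p [k IH]]; simpl.
  1: exists 0; exact I.
  1, 2: destruct (tbounded_exists t) as [k IH], (tbounded_exists u) as [l IH'];
    exists (k + l); split; eapply tbounded_le; [|eassumption| |eassumption]; lia.
  1-3: exists (k + l); split; eapply bounded_le; [|eassumption| |eassumption]; lia.
  1, 2: exists k; eapply bounded_le; [|eassumption]; lia.
  exists k; exact IH.
Qed.

Lemma tbounded_tsubst k l s t :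
  tbounded k t -> (forall n, n < k -> tbounded l (s n)) -> tbounded l (tsubst s t).
Proof. induction t; simpl; intuition. Qed.

Lemma bounded_subst p : forall k l s,
  bounded k p -> (forall n, n < k -> tbounded l (s n)) -> bounded l (subst s p).
Proof.
  assert (tbounded_up : forall k l s, (forall n, n < k -> tbounded l (s n)) ->
    forall n, n < S k -> tbounded (S l) (up s n)).
  { intros k l s E [|n] L; simpl; [lia|].
    eapply tbounded_tsubst; [apply E; lia|]. simpl; lia. }
  induction p; simpl; intros; intuition eauto using tbounded_tsubst.
Qed.

Lemma tbounded_numeral k n : tbounded k (numeral n).
Proof. induction n; simpl; auto. Qed.

Lemma subst_up_inst s t p : inst t (subst (up s) p) = subst (scons t s) p.
Proof.
  unfold inst; rewrite subst_subst; f_equal; extensionality n.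
  destruct n; simpl; [reflexivity|]. rewrite tsubst_tsubst; apply tsubst_Var.
Qed.

(** * Derived rules of the Hilbert calculus *)

Section Derivations.

Variable T : theory.

Lemma proves_imp_refl p : proves T (Imp p p).
Proof.
  eapply pr_mp; [eapply pr_mp|];
    [apply pr_logic, (ax_S p (Imp p p) p)|apply pr_logic, ax_K|apply pr_logic, ax_K].
Qed.

Lemma proves_imp_const g p : proves T p -> proves T (Imp g p).
Proof. intros H; eapply pr_mp; [apply pr_logic, ax_K|exact H]. Qed.

Lemma proves_imp_mp g p q :
  proves T (Imp g (Imp p q)) -> proves T (Imp g p) -> proves T (Imp g q).
Proof.
  intros H H'; eapply pr_mp; [eapply pr_mp; [apply pr_logic, ax_S|exact H]|exact H'].
Qed.

Lemma proves_imp_trans p q r :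
  proves T (Imp p q) -> proves T (Imp q r) -> proves T (Imp p r).
Proof.
  intros H H'; eapply proves_imp_mp; [apply proves_imp_const, H'|exact H].
Qed.

Lemma proves_imp_ax g p q : logical_axiom (Imp p q) -> proves T (Imp g p) -> proves T (Imp g q).
Proof. intros A H; eapply proves_imp_trans; [exact H|apply pr_logic, A]. Qed.

Lemma proves_curry g p q : proves T (Imp (And g p) q) -> proves T (Imp g (Imp p q)).
Proof.
  intros H.
  assert (H1 : proves T (Imp g (Imp p (And g p)))) by apply pr_logic, ax_and_intro.
  eapply proves_imp_mp; [|exact H1].
  eapply proves_imp_const, pr_mp; [apply pr_logic, ax_S|].
  apply proves_imp_const, H.
Qed.

Lemma proves_uncurry g p q : proves T (Imp g (Imp p q)) -> proves T (Imp (And g p) q).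
Proof.
  intros H; eapply proves_imp_mp.
  - eapply proves_imp_trans; [apply pr_logic, ax_and_left|exact H].
  - apply pr_logic, ax_and_right.
Qed.

Lemma proves_imp_gen p q : proves T (Imp (lift q) p) -> proves T (Imp q (All p)).
Proof.
  intros H. eapply proves_imp_trans; [apply pr_logic, ax_all_vacuous|].
  eapply pr_mp; [apply pr_logic, ax_all_imp|]. apply pr_gen, H.
Qed.

Lemma proves_iter_all n p : proves T p -> proves T (Nat.iter n All p).
Proof. intros H; induction n; simpl; auto using pr_gen. Qed.

Lemma proves_iter_all_elim n : forall p s,
  proves T (subst s (Nat.iter n All p)) ->
  forall r, (forall i, r (n + i) = s i) -> proves T (subst r p).
Proof.
  induction n as [|n IH]; simpl; intros p s H r E.
  - replace r with s; [exact H|]. extensionality i; auto.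
  (* The outermost of the [S n] quantifiers binds index [n] of [p], hence the instance at [r n]. *)
  - eapply pr_mp in H; [|apply pr_logic, ax_all_elim with (t := r n)].
    rewrite subst_up_inst in H. eapply IH; [exact H|].
    intros [|i]; simpl; [f_equal; lia|]. rewrite <- E; f_equal; lia.
Qed.

Lemma bounded_iter_all n p : bounded n p -> sentence (Nat.iter n All p).
Proof.
  unfold sentence. replace n with (n + 0) at 1 by lia. generalize 0 as k.
  induction n as [|n IH]; simpl; intros k B; [exact B|].
  apply IH. replace (n + S k) with (S (n + k)) by lia; exact B.
Qed.

Lemma proves_of_closed n p s :
  sentence (Nat.iter n All p) -> proves T (Nat.iter n All p) -> proves T (subst s p).
Proof.
  intros B H.
  apply proves_iter_all_elim with (n := n) (s := fun i => s (n + i)); [|reflexivity].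
  rewrite (@subst_agree _ 0 _ Var B) by lia. rewrite subst_Var; exact H.
Qed.

(** Induction on the derivation would need the axioms of [T] to be closed under substitution.
    Instead the theorem is generalized to a sentence and instantiated again. *)
Lemma proves_subst p s : proves T p -> proves T (subst s p).
Proof.
  intros H. destruct (bounded_exists p) as [n B].
  eapply proves_of_closed; [apply bounded_iter_all, B|apply proves_iter_all, H].
Qed.

Lemma proves_universal_closure p s :
  (forall q, universal_closure p q -> proves T q) -> proves T (subst s p).
Proof.
  intros H. destruct (bounded_exists p) as [n B].
  eapply proves_of_closed; [apply bounded_iter_all, B|].
  apply H; exists n; auto using bounded_iter_all.
Qed.

Lemma proves_fresh_witness g p k :
  bounded k g -> bounded k (Ex p) ->
  proves T (Neg (And (And g (Ex p)) (inst (Var k) p))) ->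
  proves T (Neg (And g (Ex p))).
Proof.
  intros Bg Bp H.
  (* Renaming the fresh variable to index 0 and shifting the others acts as [lift] on [g] and [Ex p]
     and turns [inst (Var k) p] into [p], the shape required by [ax_ex_elim]. *)
  set (r := fun n => if n =? k then Var 0 else Var (S n)).
  apply (@proves_subst _ r) in H. simpl in H.
  assert (E : forall q, bounded k q -> subst r q = lift q).
  { intros q B; eapply subst_agree; [exact B|]. intros n L; unfold r.
    destruct (Nat.eqb_spec n k); [lia|reflexivity]. }
  rewrite (E g Bg) in H. change (Ex (subst (up r) p)) with (subst r (Ex p)) in H.
  rewrite (E (Ex p) Bp) in H.
  assert (E' : subst r (inst (Var k) p) = p).
  { unfold inst; rewrite subst_subst. transitivity (subst Var p); [|apply subst_Var].
    eapply subst_agree; [exact Bp|].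
    intros [|n] L; simpl; unfold r.
    - rewrite Nat.eqb_refl; reflexivity.
    - destruct (Nat.eqb_spec n k); [lia|reflexivity]. }
  rewrite E' in H.
  apply proves_curry in H.
  assert (H1 : proves T (Imp (And g (Ex p)) (Imp (Ex p) Bot))).
  { eapply proves_imp_ax; [apply ax_ex_elim|]. apply proves_imp_gen. exact H. }
  eapply proves_imp_mp; [exact H1|apply pr_logic, ax_and_right].
Qed.

End Derivations.

(** ** Structures *)

(** [Eq] will be identity and [Le] will be read through addition, as in [PA_le]. [box] receives the
    formula itself, since the truth of [Box p] is not determined by that of [p]. *)
Record structure : Type := Structure {
  dom :> Type;
  zero : dom;
  succ : dom -> dom;
  plus : dom -> dom -> dom;
  mult : dom -> dom -> dom;
  box : (nat -> dom) -> form -> Prop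
}.

Arguments zero {_}.
Arguments succ {_} _.
Arguments plus {_} _ _.
Arguments mult {_} _ _.
Arguments box {_} _ _.

Definition econs {D : Type} (x : D) (e : nat -> D) (n : nat) : D :=
  match n with
  | 0 => x
  | S m => e m
  end.

Infix ".:" := econs (at level 55, right associativity).

Fixpoint teval {M : structure} (e : nat -> M) (t : term) : M :=
  match t with
  | Var n => e n
  | Zero => zero
  | Succ t => succ (teval e t)
  | Plus t u => plus (teval e t) (teval e u)
  | Mult t u => mult (teval e t) (teval e u)
  end.

Fixpoint sat {M : structure} (e : nat -> M) (p : form) : Prop :=
  match p with
  | Bot => False
  | Eq t u => teval e t = teval e u
  | Le t u => exists z, plus z (teval e t) = teval e u
  | Imp p q => sat e p -> sat e q
  | And p q => sat e p /\ sat e q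
  | Or p q => sat e p \/ sat e q
  | All p => forall x, sat (x .: e) p
  | Ex p => exists x, sat (x .: e) p
  | Box p => box e p
  end.

Definition box_substitutive (M : structure) : Prop :=
  forall (e : nat -> M) s p, box e (subst s p) <-> box (fun n => teval e (s n)) p.

(** All theorems are required to hold, not just the axioms: with an arbitrary [box], truth of the
    axioms would not be preserved by necessitation. *)
Record model (T : theory) (M : structure) : Prop := Model {
  model_box_subst : box_substitutive M;
  model_sound : forall p, proves T p -> forall e : nat -> M, sat e p
}.

Lemma teval_tsubst (M : structure) (e : nat -> M) s t :
  teval e (tsubst s t) = teval (fun n => teval e (s n)) t.
Proof. induction t; simpl; congruence. Qed.

Lemma teval_up (M : structure) (e : nat -> M) s x :
  (fun n => teval (x .: e) (up s n)) = x .: (fun n => teval e (s n)).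
Proof.
  extensionality n; destruct n; simpl; [reflexivity|]. rewrite teval_tsubst; reflexivity.
Qed.

Lemma teval_scons (M : structure) (e : nat -> M) s t :
  (fun n => teval e (scons t s n)) = teval e t .: (fun n => teval e (s n)).
Proof. extensionality n; destruct n; reflexivity. Qed.

Lemma sat_subst (M : structure) (BS : box_substitutive M) p : forall (e : nat -> M) s,
  sat e (subst s p) <-> sat (fun n => teval e (s n)) p.
Proof.
  induction p as [|t u|t u|p IHp q IHq|p IHp q IHq|p IHp q IHq|p IHp|p IHp|p IHp];
    simpl; intros e s; rewrite ?teval_tsubst, ?IHp, ?IHq; try tauto.
  - split; intros H x; specialize (H x); rewrite IHp, teval_up in *; exact H.
  - split; intros [x H]; exists x; rewrite IHp, teval_up in *; exact H.
  - apply BS.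
Qed.

Lemma sat_inst (M : structure) (BS : box_substitutive M) (e : nat -> M) t p :
  sat e (inst t p) <-> sat (teval e t .: e) p.
Proof. unfold inst. rewrite (sat_subst BS), teval_scons. reflexivity. Qed.

Lemma sat_agree (M : structure) (BS : box_substitutive M) k p (e e' : nat -> M) :
  bounded k p -> (forall n, n < k -> e n = e' n) -> sat e p -> sat e' p.
Proof.
  intros B E H.
  (* A priori [box] may depend on the whole environment. This substitution fixes [p] and overwrites
     all values from [k] on, so substitutivity of [box] removes the dependence. *)
  set (s n := if n <? k then Var n else Zero).
  assert (Es : subst s p = p).
  { transitivity (subst Var p); [|apply subst_Var].
    eapply subst_agree; [exact B|]. intros n L; unfold s.
    destruct (Nat.ltb_spec n k); [reflexivity|lia]. }
  rewrite <- Es in H |- *. rewrite (sat_subst BS) in *.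
  replace (fun n => teval e' (s n)) with (fun n => teval e (s n)); [exact H|].
  extensionality n; unfold s. destruct (Nat.ltb_spec n k); simpl; auto.
Qed.

(** ** Completeness, with [Box p] treated as an atomic formula *)

Section Henkin.

Variable T : theory.
Variable p0 : form.
Hypothesis p0_unprovable : ~ proves T p0.

Definition consistent (g : form) : Prop := ~ proves T (Neg g).

(** The theory built so far is one formula [g]. It has finitely many free variables, so variables
    can serve as Henkin constants; any [k] that keeps the result consistent is allowed. *)
Definition henkin_step (p g g' : form) : Prop :=
  (~ consistent (And g p) /\ g' = g) \/
  (consistent (And g p) /\
   ((exists q k, p = Ex q /\ g' = And (And g p) (inst (Var k) q)) \/
    ((forall q, p <> Ex q) /\ g' = And g p)) /\ consistent g').

Lemma henkin_step_exists p g : consistent g -> exists g', consistent g' /\ henkin_step p g g'.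
Proof.
  intros C. destruct (classic (consistent (And g p))) as [C'|C'].
  2: { exists g; split; [exact C|left; auto]. }
  destruct (classic (exists q, p = Ex q)) as [[q ->]|N].
  - destruct (bounded_exists g) as [k Bg], (bounded_exists (Ex q)) as [l Bq].
    assert (C2 : consistent (And (And g (Ex q)) (inst (Var (k + l)) q))).
    { intros H. apply C'. eapply proves_fresh_witness; [| |exact H];
        (eapply bounded_le; [|eassumption]; lia). }
    eexists; split; [exact C2|]. right; split; [exact C'|]. split; [|exact C2].
    left; eauto.
  - exists (And g p); split; [exact C'|]. right; split; [exact C'|]. split; [|exact C'].
    right; split; [|reflexivity]. intros q ->; eauto.
Qed.

(** [code] is the enumeration of formulas: stage [code p] decides [p], and numbers that code nothing
    change nothing. *)
Lemma henkin_sequence_exists :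
  exists G : nat -> form, G 0 = Neg p0 /\ (forall n, consistent (G n)) /\
    (forall p, henkin_step p (G (code p)) (G (S (code p)))) /\
    (forall n, (forall p, code p <> n) -> G (S n) = G n).
Proof.
  assert (step : forall n (g : {g | consistent g}), exists g' : {g | consistent g},
    (forall p, code p = n -> henkin_step p (proj1_sig g) (proj1_sig g')) /\
    ((forall p, code p <> n) -> g' = g)).
  { intros n [g C]; simpl.
    destruct (classic (exists p, code p = n)) as [[p E]|N].
    - destruct (henkin_step_exists p C) as [g' [C' S']].
      exists (exist _ g' C'). split; [|intros N; destruct (N p E)]. intros q E'.
      assert (q = p) as -> by (apply code_inj; congruence). exact S'.
    - exists (exist _ g C). split; [|reflexivity]. intros p E; exfalso; eauto. }
  assert (C0 : consistent (Neg p0)).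
  { intros Q; apply p0_unprovable. eapply pr_mp; [apply pr_logic, ax_dne|exact Q]. }
  set (next n g := proj1_sig (constructive_indefinite_description _ (step n g))).
  set (G := fix G n := match n with 0 => exist _ (Neg p0) C0 | S m => next m (G m) end).
  exists (fun n => proj1_sig (G n)). split; [reflexivity|]. split; [|split].
  - intros n; apply proj2_sig.
  - intros p. simpl. unfold next.
    apply (proj2_sig (constructive_indefinite_description _ (step (code p) (G (code p))))).
    reflexivity.
  - intros n N. simpl. unfold next. f_equal.
    apply (proj2_sig (constructive_indefinite_description _ (step n (G n)))), N.
Qed.

Variable G : nat -> form.
Hypothesis G_0 : G 0 = Neg p0.
Hypothesis G_consistent : forall n, consistent (G n).
Hypothesis G_step : forall p, henkin_step p (G (code p)) (G (S (code p))).
Hypothesis G_stays : forall n, (forall p, code p <> n) -> G (S n) = G n.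

Definition holds (p : form) : Prop := exists n, proves T (Imp (G n) p).

Lemma G_succ n : proves T (Imp (G (S n)) (G n)).
Proof.
  destruct (classic (exists p, code p = n)) as [[p <-]|N].
  - destruct (G_step p) as [[_ ->]|[_ [[[q [k [_ ->]]]|[_ ->]] _]]].
    + apply proves_imp_refl.
    + eapply proves_imp_ax; [apply ax_and_left|].  apply pr_logic, ax_and_left.
    + apply pr_logic, ax_and_left.
  - rewrite G_stays; [apply proves_imp_refl|]. intros p E; eauto.
Qed.

Lemma G_le m n : m <= n -> proves T (Imp (G n) (G m)).
Proof.
  induction 1; [apply proves_imp_refl|]. eapply proves_imp_trans; [apply G_succ|exact IHle].
Qed.

Lemma holds_proves p : proves T p -> holds p.
Proof. intros P; exists 0; apply proves_imp_const, P. Qed.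

Lemma holds_mp p q : holds (Imp p q) -> holds p -> holds q.
Proof.
  intros [m P] [n Q]; exists (m + n).
  eapply proves_imp_mp; (eapply proves_imp_trans; [apply G_le|eassumption]); lia.
Qed.

Lemma holds_ax p q : logical_axiom (Imp p q) -> holds p -> holds q.
Proof. intros A; apply holds_mp, holds_proves, pr_logic, A. Qed.

Lemma holds_bot : ~ holds Bot.
Proof. intros [n P]; exact (G_consistent P). Qed.

Lemma holds_not_p0 : ~ holds p0.
Proof.
  intros P. apply holds_bot. eapply holds_mp; [|exact P].
  exists 0. rewrite G_0. apply proves_imp_refl.
Qed.

Lemma holds_or_neg p : holds p \/ holds (Neg p).
Proof.
  destruct (G_step p) as [[C _]|[C [[[q [k [_ E]]]|[_ E]] _]]].
  - right. exists (code p). apply proves_curry. unfold consistent in C. apply NNPP, C.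
  - left. exists (S (code p)); rewrite E. eapply proves_imp_ax; [apply ax_and_right|].
    apply pr_logic, ax_and_left.
  - left. exists (S (code p)); rewrite E. apply pr_logic, ax_and_right.
Qed.

Lemma holds_imp p q : holds (Imp p q) <-> (holds p -> holds q).
Proof.
  split; [apply holds_mp|]. intros I. destruct (holds_or_neg p) as [P|P].
  - eapply holds_ax; [apply ax_K|auto].
  - destruct P as [n P]. exists n. apply proves_curry.
    apply proves_uncurry in P. eapply proves_imp_ax; [apply ax_dne|].
    eapply proves_imp_ax; [apply ax_K|exact P].
Qed.

Lemma holds_and p q : holds (And p q) <-> holds p /\ holds q.
Proof.
  split.
  - intros P; split; (eapply holds_ax; [|exact P]); constructor.
  - intros [P Q]. eapply holds_mp; [|exact Q]. eapply holds_ax; [apply ax_and_intro|exact P].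
Qed.

Lemma holds_or p q : holds (Or p q) <-> holds p \/ holds q.
Proof.
  split.
  - intros P. destruct (holds_or_neg p) as [|Np]; [auto|].
    destruct (holds_or_neg q) as [|Nq]; [auto|].
    exfalso. apply holds_bot. eapply holds_mp; [|exact P].
    eapply holds_mp; [eapply holds_mp; [|exact Np]|exact Nq].
    apply holds_proves, pr_logic, ax_or_elim.
  - intros [P|P]; (eapply holds_ax; [|exact P]); constructor.
Qed.

Lemma holds_ex p : holds (Ex p) <-> exists t, holds (inst t p).
Proof.
  split.
  - intros P.
    destruct (G_step (Ex p)) as [[C _]|[C [[[q [k [E1 E]]]|[N E]] _]]].
    + exfalso. apply holds_bot. eapply holds_mp; [|exact P].
      exists (code (Ex p)). apply proves_curry. apply NNPP, C.
    + injection E1 as <-. exists (Var k), (S (code (Ex p))). rewrite E.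
      apply pr_logic, ax_and_right.
    + exfalso; exact (N p eq_refl).
  - intros [t P]. eapply holds_ax; [apply ax_ex_intro|exact P].
Qed.

Lemma holds_all p : holds (All p) <-> forall t, holds (inst t p).
Proof.
  split.
  - intros P t. eapply holds_ax; [apply ax_all_elim|exact P].
  - intros P. destruct (holds_or_neg (Ex (Neg p))) as [Q|Q].
    + apply holds_ex in Q as [t Q]. exfalso. apply holds_bot. eapply holds_mp; [exact Q|apply P].
    + revert Q. apply holds_mp, holds_proves. apply proves_imp_gen.
      eapply proves_imp_ax; [apply ax_dne|]. simpl.
      change (proves T (Imp (Imp (Ex (subst (up shift) (Neg p))) Bot) (Imp (Neg p) Bot))).
      apply proves_curry. eapply proves_imp_mp; [apply pr_logic, ax_and_left|].
      (* Lifting [Neg p] under the binder and instantiating at [Var 0] gives back [Neg p]. *)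
      eapply proves_imp_ax; [apply ax_ex_intro with (t := Var 0)|].
      rewrite subst_up_inst.
      replace (scons (Var 0) shift) with Var
        by (extensionality n; destruct n; reflexivity).
      rewrite subst_Var. apply pr_logic, ax_and_right.
Qed.

Definition equ (t u : term) : Prop := holds (Eq t u).

Lemma equ_refl t : equ t t.
Proof. apply holds_proves, pr_logic, ax_eq_refl. Qed.

Lemma equ_replace p t u : equ t u -> holds (inst t p) -> holds (inst u p).
Proof. intros E; apply holds_mp; revert E; apply holds_ax, ax_eq_subst. Qed.

(** Leibniz's law for an equation whose other side is lifted, so that the replacement affects one
    side only. Symmetry and transitivity are obtained in the same way. *)
Lemma equ_term f t u : equ t u -> equ (tsubst (scons t Var) f) (tsubst (scons u Var) f).
Proof.
  intros E. set (l := tlift (tsubst (scons t Var) f)).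
  assert (L : forall v, inst v (Eq l f) = Eq (tsubst (scons t Var) f) (tsubst (scons v Var) f)).
  { intros v; unfold inst, l, tlift; simpl. rewrite tsubst_tsubst. f_equal. apply tsubst_Var. }
  unfold equ. rewrite <- L. eapply equ_replace; [exact E|]. rewrite L. apply equ_refl.
Qed.

Lemma equ_sym t u : equ t u -> equ u t.
Proof.
  intros E. assert (L : forall v, inst v (Eq (Var 0) (tlift t)) = Eq v t).
  { intros v; unfold inst, tlift; simpl. rewrite tsubst_tsubst. f_equal. apply tsubst_Var. }
  unfold equ. rewrite <- L. eapply equ_replace; [exact E|]. rewrite L. apply equ_refl.
Qed.

Lemma equ_trans t u v : equ t u -> equ u v -> equ t v.
Proof.
  intros E E'. assert (L : forall w, inst w (Eq (tlift t) (Var 0)) = Eq t w).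
  { intros w; unfold inst, tlift; simpl. rewrite tsubst_tsubst. f_equal. apply tsubst_Var. }
  unfold equ. rewrite <- L. eapply equ_replace; [exact E'|]. rewrite L. exact E.
Qed.

Lemma equ_subst k : forall s r p,
  (forall n, n < k -> equ (s n) (r n)) -> (forall n, k <= n -> s n = r n) ->
  holds (subst s p) -> holds (subst r p).
Proof.
  induction k as [|k IH]; intros s r p E A P.
  - replace r with s; [exact P|]. extensionality n; apply A; lia.
  - set (m n := if n =? k then Var 0 else tlift (s n)).
    set (s' n := if n =? k then r k else s n).
    assert (L : forall t, inst t (subst m p) = subst (fun n => if n =? k then t else s n) p).
    { intros t; unfold inst; rewrite subst_subst; f_equal; extensionality n. unfold m.
      destruct (n =? k); [reflexivity|]. unfold tlift; rewrite tsubst_tsubst. apply tsubst_Var. }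
    apply IH with (s := s').
    + intros n Ln. unfold s'. destruct (Nat.eqb_spec n k); [lia|]. apply E; lia.
    + intros n Ln. unfold s'. destruct (Nat.eqb_spec n k) as [->|]; [reflexivity|]. apply A; lia.
    + unfold s'. rewrite <- L. eapply equ_replace; [apply E; lia|]. rewrite L.
      replace (fun n => if n =? k then s k else s n) with s; [exact P|].
      extensionality n. destruct (Nat.eqb_spec n k) as [->|]; reflexivity.
Qed.

Lemma equ_subst_all s r p : (forall n, equ (s n) (r n)) -> holds (subst s p) -> holds (subst r p).
Proof.
  intros E P. destruct (bounded_exists p) as [k B].
  set (s' n := if n <? k then s n else r n).
  apply equ_subst with (k := k) (s := s').
  - intros n Ln. unfold s'. destruct (Nat.ltb_spec n k); [apply E|lia].
  - intros n Ln. unfold s'. destruct (Nat.ltb_spec n k); [lia|reflexivity].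
  - rewrite (@subst_agree _ k s' s B); [exact P|].
    intros n Ln. unfold s'. destruct (Nat.ltb_spec n k); [reflexivity|lia].
Qed.

(** The quotient of the terms by [equ], with classes as predicates: [sat] reads [Eq] as identity, so
    provably equal terms have to become one element. *)
Definition tclass : Type := {c : term -> Prop | exists t, c = equ t}.

Definition cls (t : term) : tclass := exist _ (equ t) (ex_intro _ t eq_refl).

Definition repr (c : tclass) : term :=
  proj1_sig (constructive_indefinite_description _ (proj2_sig c)).

Lemma cls_eq t u : cls t = cls u <-> equ t u.
Proof.
  split.
  - intros E. apply (f_equal (@proj1_sig _ _)) in E. simpl in E. rewrite E. apply equ_refl.
  - intros E. unfold cls. assert (Ec : equ t = equ u).
    { extensionality v. apply propositional_extensionality.
      split; eauto using equ_trans, equ_sym. }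
    revert E; generalize (ex_intro (fun v => equ t = equ v) t eq_refl). rewrite Ec.
    intros X _. f_equal. apply proof_irrelevance.
Qed.

Lemma cls_repr c : cls (repr c) = c.
Proof.
  unfold repr. destruct (constructive_indefinite_description _ _) as [t E]; simpl.
  destruct c as [c X]; simpl in *. subst c. unfold cls. f_equal. apply proof_irrelevance.
Qed.

Lemma repr_cls t : equ (repr (cls t)) t.
Proof. apply cls_eq, cls_repr. Qed.

Definition henkin_structure : structure := {|
  dom := tclass;
  zero := cls Zero;
  succ x := cls (Succ (repr x));
  plus x y := cls (Plus (repr x) (repr y));
  mult x y := cls (Mult (repr x) (repr y));
  box e p := holds (subst (fun n => repr (e n)) (Box p))
|}.

Lemma equ_Succ t u : equ t u -> equ (Succ t) (Succ u).
Proof. exact (equ_term (Succ (Var 0)) (t := t) (u := u)). Qed.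

Lemma equ_binary (f : term -> term -> term) :
  (forall s t u, tsubst s (f t u) = f (tsubst s t) (tsubst s u)) ->
  forall t t' u u', equ t t' -> equ u u' -> equ (f t u) (f t' u').
Proof.
  intros F t t' u u' E E'. apply equ_trans with (u := f t' u).
  - generalize (@equ_term (f (Var 0) (tlift u)) t t' E). rewrite !F. unfold tlift.
    rewrite !tsubst_tsubst; simpl.
    change (fun n => Var n) with Var; rewrite tsubst_Var; auto.
  - generalize (@equ_term (f (tlift t') (Var 0)) u u' E'). rewrite !F. unfold tlift.
    rewrite !tsubst_tsubst; simpl.
    change (fun n => Var n) with Var; rewrite tsubst_Var; auto.
Qed.

Lemma henkin_teval (e : nat -> henkin_structure) t :
  teval e t = cls (tsubst (fun n => repr (e n)) t).
Proof.
  induction t as [n| |t IH|t IH u IH'|t IH u IH']; simpl.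
  - symmetry; apply cls_repr.
  - reflexivity.
  - rewrite IH. apply cls_eq, equ_Succ, repr_cls.
  - rewrite IH, IH'. apply cls_eq, (equ_binary Plus); auto using repr_cls.
  - rewrite IH, IH'. apply cls_eq, (equ_binary Mult); auto using repr_cls.
Qed.

Lemma holds_subst_econs t (e : nat -> henkin_structure) p :
  holds (subst (fun n => repr ((cls t .: e) n)) p) <->
  holds (inst t (subst (up (fun n => repr (e n))) p)).
Proof.
  rewrite subst_up_inst.
  split; apply equ_subst_all; intros [|n]; simpl; auto using equ_refl, repr_cls, equ_sym.
Qed.

Hypothesis T_le : extends T PA_K.

(** Needed because structures interpret [Le] through addition; [PA_le] makes the two readings
    agree. *)
Lemma holds_le t u : holds (Le t u) <-> exists v, holds (Eq (Plus v t) u).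
Proof.
  assert (P : proves T (Iff (Le t u) (Ex (Eq (Plus (Var 0) (tlift t)) (tlift u))))).
  { assert (P : proves T (All (All (Iff (Le (Var 1) (Var 0))
      (Ex (Eq (Plus (Var 0) (Var 2)) (Var 1))))))) by apply T_le, pr_axiom, PA_K_base, PA_le.
    apply (@proves_of_closed T 2 _ (scons u (scons t Var))) in P; [exact P|].
    cbv; intuition lia. }
  apply holds_proves, holds_and in P as [P Q]. rewrite holds_imp in P, Q.
  assert (E : forall v, inst v (Eq (Plus (Var 0) (tlift t)) (tlift u)) = Eq (Plus v t) u).
  { intros v; unfold inst, tlift; simpl. rewrite !tsubst_tsubst; simpl.
    change (fun n => Var n) with Var; rewrite !tsubst_Var; reflexivity. }
  split.
  - intros L. apply P, holds_ex in L as [v L]. exists v. rewrite E in L. exact L.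
  - intros [v L]. apply Q, holds_ex. exists v. rewrite E. exact L.
Qed.

Lemma henkin_sat p : forall e : nat -> henkin_structure,
  sat e p <-> holds (subst (fun n => repr (e n)) p).
Proof.
  induction p as [|t u|t u|p IHp q IHq|p IHp q IHq|p IHp q IHq|p IHp|p IHp|p IHp];
    intros e; simpl.
  - split; [tauto|apply holds_bot].
  - rewrite !henkin_teval. apply cls_eq.
  - rewrite holds_le, !henkin_teval. split.
    + intros [z E]. exists (repr z). apply cls_eq in E. eapply equ_trans; [|exact E].
      apply (equ_binary Plus); auto using equ_refl, equ_sym, repr_cls.
    + intros [v E]. exists (cls v). apply cls_eq. eapply equ_trans; [|exact E].
      apply (equ_binary Plus); auto using repr_cls.
  - rewrite holds_imp, IHp, IHq; reflexivity.
  - rewrite holds_and, IHp, IHq; reflexivity.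
  - rewrite holds_or, IHp, IHq; reflexivity.
  - rewrite holds_all. split.
    + intros A t. specialize (A (cls t)). rewrite IHp, holds_subst_econs in A. exact A.
    + intros A x. rewrite <- (cls_repr x), IHp, holds_subst_econs. apply A.
  - rewrite holds_ex. split.
    + intros [x A]. exists (repr x). rewrite <- (cls_repr x), IHp, holds_subst_econs in A. exact A.
    + intros [t A]. exists (cls t). rewrite IHp, holds_subst_econs. exact A.
  - reflexivity.
Qed.

Lemma henkin_box_substitutive : box_substitutive henkin_structure.
Proof.
  intros e s p; simpl. rewrite !subst_subst.
  split; intros P; (eapply (@equ_subst_all _ _ (Box p)); [|exact P]); intros n; simpl;
    rewrite henkin_teval; auto using repr_cls, equ_sym.
Qed.

Lemma henkin_model : model T henkin_structure.
Proof.
  split; [exact henkin_box_substitutive|].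
  intros p P e. rewrite henkin_sat. apply holds_proves, proves_subst, P.
Qed.

Lemma henkin_not_p0 : exists e : nat -> henkin_structure, ~ sat e p0.
Proof.
  exists (fun n => cls (Var n)). rewrite henkin_sat. intros P. apply holds_not_p0.
  rewrite <- (subst_Var p0). revert P. apply equ_subst_all. auto using repr_cls.
Qed.

End Henkin.

Theorem completeness T p :
  extends T PA_K -> (forall M, model T M -> forall e : nat -> M, sat e p) -> proves T p.
Proof.
  intros X A. apply NNPP; intros N.
  destruct (henkin_sequence_exists N) as [G [G0 [C [S1 S2]]]].
  assert (exists e : nat -> henkin_structure T G, ~ sat e p) as [e Ne]
    by (eapply henkin_not_p0; eassumption).
  apply Ne, A. eapply henkin_model; eassumption.
Qed.

(** * Peano arithmetic inside a structure *)

(** Separated from [model] so that the arithmetic serves both the models of [T] and the standard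
    numbers. Induction covers formulas with [Box]. *)
Record PA_structure (M : structure) : Prop := {
  pa_box_subst : box_substitutive M;
  pa_succ_zero : forall x : M, succ x <> zero;
  pa_succ_inj : forall x y : M, succ x = succ y -> x = y;
  pa_plus_zero : forall x : M, plus x zero = x;
  pa_plus_succ : forall x y : M, plus x (succ y) = succ (plus x y);
  pa_mult_zero : forall x : M, mult x zero = zero;
  pa_mult_succ : forall x y : M, mult x (succ y) = plus (mult x y) x;
  pa_induction : forall p (e : nat -> M), sat (zero .: e) p ->
    (forall x, sat (x .: e) p -> sat (succ x .: e) p) -> forall x, sat (x .: e) p
}.

Lemma model_PA T M : extends T PA_K -> model T M -> PA_structure M.
Proof.
  intros X [BS S].
  assert (A : forall p, PA_Box p -> forall e : nat -> M, sat e p)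
    by (intros p A; apply S, X, pr_axiom, PA_K_base, A).
  split; try exact BS.
  1: intros x; exact (A _ PA_succ_zero (fun _ => x) x).
  1: intros x y; exact (A _ PA_succ_inj (fun _ => x) x y).
  1: intros x; exact (A _ PA_plus_zero (fun _ => x) x).
  1: intros x y; exact (A _ PA_plus_succ (fun _ => x) x y).
  1: intros x; exact (A _ PA_mult_zero (fun _ => x) x).
  1: intros x y; exact (A _ PA_mult_succ (fun _ => x) x y).
  intros p e P0 PS.
  assert (I : sat e (subst Var (induction_formula p))).
  { apply S, proves_universal_closure. intros q U.
    apply X, pr_axiom, PA_K_base. econstructor; exact U. }
  rewrite subst_Var in I. apply I; split.
  - apply (sat_inst BS). exact P0.
  - intros x Px. apply (sat_subst BS). rewrite teval_scons. apply PS, Px.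
Qed.

Definition lt {M : structure} (x y : M) : Prop := exists z, plus z (succ x) = y.

Definition num {M : structure} (n : nat) : M := Nat.iter n succ zero.

Lemma sat_BAll (M : structure) (e : nat -> M) t p :
  sat e (BAll t p) <-> forall x, lt x (teval e t) -> sat (x .: e) p.
Proof. unfold BAll, tlift; simpl. setoid_rewrite teval_tsubst. reflexivity. Qed.

Lemma sat_BEx (M : structure) (e : nat -> M) t p :
  sat e (BEx t p) <-> exists x, lt x (teval e t) /\ sat (x .: e) p.
Proof. unfold BEx, tlift; simpl. setoid_rewrite teval_tsubst. reflexivity. Qed.

Lemma teval_numeral (M : structure) (e : nat -> M) n : teval e (numeral n) = num n.
Proof. induction n; simpl; congruence. Qed.

(** Injective and a term of the language; Cantor's pairing would need halving. The price is that not
    every number is a pair. *)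
Definition Pair (t u : term) : term := Plus (Mult (Plus t u) (Plus t u)) t.

(** Gödel's coding of finite sets: [z] belongs to the set coded by [c], [d] when [1 + (z+1)d]
    divides [c]. A quotient is at most [c], so the bound only serves to make the formula
    [Delta0]. *)
Definition Member (c d z : term) : form :=
  BEx (Succ c) (Eq (Mult (Var 0) (Succ (Mult (Succ (tlift z)) (tlift d)))) (tlift c)).

(** A choice function read off from a coded set of pairs. Minimality of [y] makes it single-valued;
    the bound [y <= c] makes its values standard when [c] is. *)
Definition Selects (c d x y : term) : form :=
  And (Lt y (Succ c)) (And (Member c d (Pair x y))
    (BAll y (Neg (Member (tlift c) (tlift d) (Pair (tlift x) (Var 0)))))).

Section Arithmetic.

Variable M : structure.
Hypothesis PA : PA_structure M.

Declare Scope pa_scope.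
Local Open Scope pa_scope.
Local Notation "0" := (@zero M) : pa_scope.
Local Notation "x + y" := (@plus M x y) : pa_scope.
Local Notation "x * y" := (@mult M x y) : pa_scope.
Local Notation "x < y" := (@lt M x y) : pa_scope.

Let e0 : nat -> M := fun _ => zero.

Lemma pa_zero_plus : forall x : M, 0 + x = x.
Proof.
  apply (pa_induction PA (Eq (Plus Zero (Var 0)) (Var 0)) e0); simpl.
  - apply (pa_plus_zero PA).
  - intros x E. rewrite (pa_plus_succ PA), E; reflexivity.
Qed.

Lemma pa_succ_plus (x : M) : forall y, succ x + y = succ (x + y).
Proof.
  apply (pa_induction PA (Eq (Plus (Succ (Var 1)) (Var 0)) (Succ (Plus (Var 1) (Var 0))))
    (x .: e0));
    simpl.
  - rewrite !(pa_plus_zero PA); reflexivity.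
  - intros y E. rewrite !(pa_plus_succ PA), E; reflexivity.
Qed.

Lemma pa_plus_comm (x : M) : forall y, x + y = y + x.
Proof.
  apply (pa_induction PA (Eq (Plus (Var 1) (Var 0)) (Plus (Var 0) (Var 1))) (x .: e0)); simpl.
  - rewrite (pa_plus_zero PA), pa_zero_plus; reflexivity.
  - intros y E. rewrite (pa_plus_succ PA), pa_succ_plus, E; reflexivity.
Qed.

Lemma pa_plus_assoc (x y : M) : forall z, x + (y + z) = (x + y) + z.
Proof.
  apply (pa_induction PA (Eq (Plus (Var 1) (Plus (Var 2) (Var 0)))
    (Plus (Plus (Var 1) (Var 2)) (Var 0))) (x .: y .: e0)); simpl.
  - rewrite !(pa_plus_zero PA); reflexivity.
  - intros z E. rewrite !(pa_plus_succ PA), E; reflexivity.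
Qed.

Lemma pa_zero_mult : forall x : M, 0 * x = 0.
Proof.
  apply (pa_induction PA (Eq (Mult Zero (Var 0)) Zero) e0); simpl.
  - apply (pa_mult_zero PA).
  - intros x E. rewrite (pa_mult_succ PA), E. apply (pa_plus_zero PA).
Qed.

Lemma pa_succ_mult (x : M) : forall y, succ x * y = x * y + y.
Proof.
  apply (pa_induction PA (Eq (Mult (Succ (Var 1)) (Var 0))
    (Plus (Mult (Var 1) (Var 0)) (Var 0))) (x .: e0)); simpl.
  - rewrite !(pa_mult_zero PA), (pa_plus_zero PA); reflexivity.
  - intros y E. rewrite !(pa_mult_succ PA), E, !(pa_plus_succ PA). f_equal.
    rewrite <- !pa_plus_assoc. f_equal. apply pa_plus_comm.
Qed.

Lemma pa_mult_comm (x : M) : forall y, x * y = y * x.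
Proof.
  apply (pa_induction PA (Eq (Mult (Var 1) (Var 0)) (Mult (Var 0) (Var 1))) (x .: e0)); simpl.
  - rewrite (pa_mult_zero PA), pa_zero_mult; reflexivity.
  - intros y E. rewrite (pa_mult_succ PA), pa_succ_mult, E; reflexivity.
Qed.

Lemma pa_distr_l (x y : M) : forall z, (x + y) * z = x * z + y * z.
Proof.
  apply (pa_induction PA (Eq (Mult (Plus (Var 1) (Var 2)) (Var 0))
    (Plus (Mult (Var 1) (Var 0)) (Mult (Var 2) (Var 0)))) (x .: y .: e0)); simpl.
  - rewrite !(pa_mult_zero PA), (pa_plus_zero PA); reflexivity.
  - intros z E. rewrite !(pa_mult_succ PA), E. rewrite <- !pa_plus_assoc. f_equal.
    rewrite !pa_plus_assoc. f_equal. apply pa_plus_comm.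
Qed.

Lemma pa_mult_assoc (x y : M) : forall z, x * (y * z) = (x * y) * z.
Proof.
  apply (pa_induction PA (Eq (Mult (Var 1) (Mult (Var 2) (Var 0)))
    (Mult (Mult (Var 1) (Var 2)) (Var 0))) (x .: y .: e0)); simpl.
  - rewrite !(pa_mult_zero PA); reflexivity.
  - intros z E. rewrite !(pa_mult_succ PA), <- E.
    rewrite pa_mult_comm, pa_distr_l. f_equal; apply pa_mult_comm.
Qed.

Lemma pa_one_mult (x : M) : succ 0 * x = x.
Proof. rewrite pa_succ_mult, pa_zero_mult, pa_zero_plus; reflexivity. Qed.

Lemma pa_semi_ring : semi_ring_theory 0 (succ 0) (@plus M) (@mult M) (@eq M).
Proof.
  split; auto using pa_zero_plus, pa_plus_comm, pa_plus_assoc, pa_one_mult, pa_zero_mult,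
    pa_mult_comm, pa_mult_assoc, pa_distr_l.
Qed.

Lemma pa_succ_def (x : M) : succ x = x + succ 0.
Proof. rewrite (pa_plus_succ PA), (pa_plus_zero PA); reflexivity. Qed.

Add Ring pa_ring : pa_semi_ring.

(* [ring] only knows [succ 0]. *)
Ltac pa_ring :=
  repeat match goal with
  | |- context [succ ?x] => lazymatch x with 0 => fail | _ => rewrite (pa_succ_def x) end
  end; ring.

Lemma pa_cases : forall x : M, x = 0 \/ exists y, x = succ y.
Proof.
  apply (pa_induction PA (Or (Eq (Var 0) Zero) (Ex (Eq (Var 1) (Succ (Var 0))))) e0); simpl;
    eauto.
Qed.

Lemma pa_plus_cancel (x y : M) : forall z, z + x = z + y -> x = y.
Proof.
  apply (pa_induction PA (Imp (Eq (Plus (Var 0) (Var 1)) (Plus (Var 0) (Var 2)))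
    (Eq (Var 1) (Var 2))) (x .: y .: e0)); simpl.
  - rewrite !pa_zero_plus; auto.
  - intros z IH E. rewrite !pa_succ_plus in E. apply (pa_succ_inj PA) in E; auto.
Qed.

Lemma pa_plus_eq_0 (x y : M) : x + y = 0 -> x = 0 /\ y = 0.
Proof.
  intros E. destruct (pa_cases y) as [->|[z ->]].
  - rewrite (pa_plus_zero PA) in E; auto.
  - rewrite (pa_plus_succ PA) in E. destruct (pa_succ_zero PA _ E).
Qed.

Lemma pa_lt_zero (x : M) : ~ x < 0.
Proof. intros [z E]. rewrite (pa_plus_succ PA) in E. exact (pa_succ_zero PA _ E). Qed.

Lemma pa_lt_succ (x y : M) : x < succ y <-> exists z, z + x = y.
Proof.
  unfold lt. setoid_rewrite (pa_plus_succ PA).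
  split; intros [z E]; exists z; [exact (pa_succ_inj PA _ _ E)|congruence].
Qed.

Lemma pa_lt_succ_cases (x y : M) : x < succ y <-> x < y \/ x = y.
Proof.
  rewrite pa_lt_succ. split.
  - intros [z <-]. destruct (pa_cases z) as [->|[w ->]].
    + right. symmetry; apply pa_zero_plus.
    + left. exists w. pa_ring.
  - intros [[z <-]| ->]; [exists (succ z); pa_ring|exists 0; apply pa_zero_plus].
Qed.

Lemma pa_lt_irrefl (x : M) : ~ x < x.
Proof.
  intros [z E]. apply (pa_succ_zero PA z). apply (@pa_plus_cancel _ _ x).
  rewrite (pa_plus_zero PA), <- E at 1. rewrite E. transitivity (z + succ x); [pa_ring|exact E].
Qed.

Lemma pa_lt_trans (x y z : M) : x < y -> y < z -> x < z.
Proof. intros [u <-] [v <-]. exists (v + succ u). pa_ring. Qed.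

Lemma pa_lt_succ_diag (x : M) : x < succ x.
Proof. exists 0. apply pa_zero_plus. Qed.

Lemma pa_zero_lt_succ (x : M) : 0 < succ x.
Proof. exists x. pa_ring. Qed.

Lemma pa_lt_plus_l (x y z : M) : x < y -> x < z + y.
Proof. intros [u <-]. exists (z + u). pa_ring. Qed.

Lemma pa_lt_plus_r (x y z : M) : x < y -> x < y + z.
Proof. intros [u <-]. exists (z + u). pa_ring. Qed.

Lemma pa_lt_total (x : M) : forall y, x < y \/ x = y \/ y < x.
Proof.
  apply (pa_induction PA (Or (Lt (Var 1) (Var 0)) (Or (Eq (Var 1) (Var 0)) (Lt (Var 0) (Var 1))))
    (x .: e0)); simpl.
  - destruct (pa_cases x) as [->|[z ->]]; [auto|]. right; right. apply pa_zero_lt_succ.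
  - change (forall y, x < y \/ x = y \/ y < x -> x < succ y \/ x = succ y \/ succ y < x).
    intros y [L|[->|[z <-]]].
    + left. apply pa_lt_succ_cases; auto.
    + left. apply pa_lt_succ_diag.
    + destruct (pa_cases z) as [->|[w ->]].
      * right; left. apply pa_zero_plus.
      * right; right. exists w. pa_ring.
Qed.

Lemma pa_lt_succ_or (x y : M) : x < succ y \/ y < x.
Proof. rewrite pa_lt_succ_cases. destruct (pa_lt_total x y) as [|[|]]; auto. Qed.

Lemma pa_lt_le_trans {x y z : M} : x < y -> y < succ z -> x < z.
Proof. rewrite pa_lt_succ_cases. intros L [L'| ->]; eauto using pa_lt_trans. Qed.

Lemma pa_mult_eq_0 (x y : M) : x * succ y = 0 -> x = 0.
Proof. rewrite (pa_mult_succ PA). intros E. apply pa_plus_eq_0 in E; tauto. Qed.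

Lemma pa_least p (e : nat -> M) x : sat (x .: e) p ->
  exists y, sat (y .: e) p /\ forall z, z < y -> ~ sat (z .: e) p.
Proof.
  intros P. apply NNPP; intros N.
  (* Strong induction in the form of ordinary induction on: nothing below [u] satisfies [p]. The
     substitution skips the variable [u]. *)
  set (q := BAll (Var 0) (Neg (subst (scons (Var 0) (fun n => Var (S (S n)))) p))).
  assert (E : forall u, sat (u .: e) q <-> forall z, z < u -> ~ sat (z .: e) p).
  { intros u. unfold q, Neg; rewrite sat_BAll. simpl.
    setoid_rewrite (sat_subst (pa_box_subst PA)). setoid_rewrite teval_scons. reflexivity. }
  assert (A : forall u, sat (u .: e) q).
  { apply (pa_induction PA).
    - rewrite E. intros z L. destruct (pa_lt_zero L).
    - intros u IH. rewrite E in *. intros z L.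
      apply pa_lt_succ_cases in L as [L| ->]; [exact (IH z L)|]. eauto. }
  specialize (A (succ x)). rewrite E in A. exact (A x (pa_lt_succ_diag x) P).
Qed.

Lemma num_plus m n : @num M (m + n) = num m + num n.
Proof.
  induction m as [|m IH]; simpl; [rewrite pa_zero_plus; reflexivity|].
  rewrite pa_succ_plus. unfold num in *; simpl. congruence.
Qed.

Lemma num_mult m n : @num M (m * n) = num m * num n.
Proof.
  induction m as [|m IH]; simpl; [rewrite pa_zero_mult; reflexivity|].
  rewrite num_plus, IH, pa_succ_mult. apply pa_plus_comm.
Qed.

Lemma lt_num (x : M) n : x < num n <-> exists k, (k < n)%nat /\ x = num k.
Proof.
  induction n as [|n IH].
  - split; [intros L; destruct (pa_lt_zero L)|intros [k [L _]]; lia].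
  - change (num (S n)) with (succ (@num M n)). rewrite pa_lt_succ_cases, IH. split.
    + intros [[k [L ->]]| ->]; eauto with arith.
    + intros [k [L ->]]. destruct (Nat.eq_dec k n) as [->|]; [auto|].
      left; exists k; split; [lia|auto].
Qed.

Lemma num_inj m n : @num M m = num n -> m = n.
Proof.
  revert n; induction m as [|m IH]; intros [|n] E; auto.
  - symmetry in E. destruct (pa_succ_zero PA _ E).
  - destruct (pa_succ_zero PA _ E).
  - f_equal. apply IH. apply (pa_succ_inj PA), E.
Qed.

(** * Coding definable finite sets and choice functions *)

Definition divides (x y : M) : Prop := exists q, q * x = y.

Definition modulus (d z : M) : M := succ (succ z * d).

Lemma pa_divides_diff (m a b c : M) : a * m = b * m + c -> divides m c.
Proof.
  intros E. destruct (pa_lt_total a b) as [[r <-]|[->|[r <-]]].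
  - exists 0. destruct (pa_plus_eq_0 (succ r * m) c) as [_ ->].
    + apply pa_plus_cancel with (z := a * m). transitivity ((r + succ a) * m + c); [pa_ring|].
      rewrite <- E. ring.
    + ring.
  - exists 0. symmetry. transitivity 0; [|ring].
    apply pa_plus_cancel with (z := b * m). rewrite <- E. ring.
  - exists (succ r). apply pa_plus_cancel with (z := b * m). rewrite <- E. pa_ring.
Qed.

(* Distinct moduli are coprime: a linear combination of them is [z - n], a divisor of [d]. *)
Lemma pa_modulus_coprime d N z n c :
  (forall x, x < N -> divides (succ x) d) -> z < N -> n < N -> z <> n ->
  divides (modulus d z) (c * modulus d n) -> divides (modulus d z) c.
Proof.
  intros D Lz Ln Ne [q Q].
  destruct (pa_lt_total z n) as [[v V]|[E|[v V]]]; [|tauto|].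
  - destruct (D v) as [w W].
    { eapply pa_lt_trans; [|exact Ln]. exists z. rewrite <- V. pa_ring. }
    apply pa_divides_diff with (b := c * (succ n * (w * succ z)))
      (a := q * (succ z * (w * succ z)) + c).
    transitivity (q * modulus d z * (succ z * (w * succ z)) + c * modulus d z); [ring|].
    rewrite Q. unfold modulus. rewrite <- V, <- W. pa_ring.
  - destruct (D v) as [w W].
    { eapply pa_lt_trans; [|exact Lz]. exists n. rewrite <- V. pa_ring. }
    apply pa_divides_diff with (a := c * (succ n * (w * succ z)) + c)
      (b := q * (succ z * (w * succ z))).
    transitivity (q * modulus d z * (succ z * (w * succ z)) + c); [|ring].
    rewrite Q. unfold modulus. rewrite <- V, <- W. pa_ring.
Qed.

(** Induction on [N] gives a nonzero common multiple of [1, ..., N] without defining the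
    factorial. *)
Lemma pa_common_multiple : forall N : M,
  exists d, d <> 0 /\ forall x, x < N -> divides (succ x) d.
Proof.
  assert (A : forall N, sat (N .: e0) (Ex (And (Neg (Eq (Var 0) Zero))
    (BAll (Var 1) (Ex (Eq (Mult (Var 0) (Succ (Var 1))) (Var 2))))))).
  { apply (pa_induction PA).
    - exists (succ 0). split; [apply (pa_succ_zero PA)|].
      rewrite sat_BAll. intros x L. destruct (pa_lt_zero L).
    - intros N [d [Dn D]]. rewrite sat_BAll in D. exists (d * succ N). split.
      + intros E. apply Dn. exact (pa_mult_eq_0 _ _ E).
      + rewrite sat_BAll. intros x L. apply pa_lt_succ_cases in L as [L| ->].
        * destruct (D x L) as [q Q]. exists (q * succ N). simpl in *. rewrite <- Q. ring.
        * exists d. reflexivity. }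
  intros N. destruct (A N) as [d [Dn D]]. exists d. split; [exact Dn|].
  rewrite sat_BAll in D. exact D.
Qed.

(** By induction on [n <= N], [c] is built as the product of the moduli of those [z < n] that
    satisfy [p]; coprimality prevents other moduli below [N] from dividing it. [p] may contain
    [Box]. *)
Lemma pa_code_set p (e : nat -> M) N : exists c d, c <> 0 /\ d <> 0 /\
  forall z, z < N -> (divides (modulus d z) c <-> sat (z .: e) p).
Proof.
  destruct (pa_common_multiple N) as [d [Dn D]].
  set (member := Ex (Eq (Mult (Var 0) (Succ (Mult (Succ (Var 1)) (Var 5)))) (Var 2))).
  set (p' := subst (scons (Var 0) (fun n => Var (5 + n)%nat)) p).
  assert (P : forall z c n : M, sat (z .: c .: n .: N .: d .: e) p' <-> sat (z .: e) p).
  { intros z c n. unfold p'. rewrite (sat_subst (pa_box_subst PA)), teval_scons. reflexivity. }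
  assert (A : forall n, sat (n .: N .: d .: e) (Imp (Lt (Var 0) (Succ (Var 1)))
    (Ex (And (Neg (Eq (Var 0) Zero))
      (BAll (Var 2) (Iff member (And (Lt (Var 0) (Var 2)) p'))))))).
  { apply (pa_induction PA).
    (* The empty product is 1, and no modulus divides it because [d] is nonzero. *)
    - intros _. exists (succ 0). split; [apply (pa_succ_zero PA)|].
      rewrite sat_BAll. intros z _. split.
      + intros [q Q]. exfalso. simpl in Q. destruct (pa_cases q) as [->|[r ->]].
        * rewrite pa_zero_mult in Q. exact (pa_succ_zero PA _ (eq_sym Q)).
        * apply Dn. apply (pa_plus_eq_0 d (r + z * d + r * (succ z * d))).
          apply (pa_succ_inj PA). rewrite <- Q. pa_ring.
      + intros [L _]. destruct (pa_lt_zero L).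
    - intros n IH Ln. destruct IH as [c [Cn C]].
      { change (n < succ N). change (succ n < succ N) in Ln.
        eapply pa_lt_trans; [|exact Ln]. apply pa_lt_succ_diag. }
      rewrite sat_BAll in C.
      assert (Ln' : n < N)
      by exact (proj1 (pa_lt_succ (succ n) N) Ln).
      destruct (classic (sat (n .: e) p)) as [Pn|Pn].
      + exists (c * modulus d n). split.
        { intros E. apply Cn. exact (pa_mult_eq_0 _ _ E). }
        rewrite sat_BAll. intros z Lz. specialize (C z Lz). destruct C as [C1 C2]. split.
        * intros Z. split.
          -- destruct (classic (z = n)) as [->|Ne]; [apply pa_lt_succ_diag|].
             apply pa_lt_succ_cases; left. apply C1.
             exact (@pa_modulus_coprime d N z n c D Lz Ln' Ne Z).
          -- rewrite P. destruct (classic (z = n)) as [->|Ne]; [exact Pn|].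
             rewrite <- (P z c n). apply C1. exact (@pa_modulus_coprime d N z n c D Lz Ln' Ne Z).
        * intros [L Q]. rewrite P in Q. change (z < succ n) in L.
          apply pa_lt_succ_cases in L as [L| ->].
          -- destruct C2 as [q E]; [split; [exact L|rewrite P; exact Q]|].
             exists (q * modulus d n). simpl in *. rewrite <- E. ring.
          -- exists c. reflexivity.
      + exists c. split; [exact Cn|]. rewrite sat_BAll. intros z Lz. specialize (C z Lz).
        destruct C as [C1 C2]. split.
        * intros Z. destruct (C1 Z) as [L Q]. split.
          -- apply pa_lt_succ_cases; left; exact L.
          -- rewrite P in *; exact Q.
        * intros [L Q]. rewrite P in Q. apply C2. rewrite P. split; [|exact Q].
          change (z < succ n) in L. change (z < n).
          apply pa_lt_succ_cases in L as [L| ->]; [exact L|contradiction]. }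
  destruct (A N (pa_lt_succ_diag N)) as [c [Cn C]].
  exists c, d. split; [exact Cn|split; [exact Dn|]].
  intros z L. rewrite sat_BAll in C. specialize (C z L). destruct C as [C1 C2].
  rewrite <- (P z c N). split; [intros Z; apply C1, Z|intros Z; apply C2; split; [exact L|exact Z]].
Qed.

Definition pair (x y : M) : M := (x + y) * (x + y) + x.

(** With [s = x + y], the value [s*s + x] lies below [(s+1)*(s+1)], so the sum of the components
    dominates the order of pairs. *)
Lemma pa_pair_lt (x y x' y' : M) : x + y < x' + y' -> pair x y < pair x' y'.
Proof.
  intros [z Z]. unfold pair. rewrite <- Z.
  exists (y + (x + y) + (z + z) * (x + y) + z * z + z + z + x'). pa_ring.
Qed.

Lemma pa_pair_inj (x y x' y' : M) : pair x y = pair x' y' -> x = x' /\ y = y'.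
Proof.
  intros E. destruct (pa_lt_total (x + y) (x' + y')) as [L|[Es|L]].
  - apply pa_pair_lt in L. rewrite E in L. destruct (pa_lt_irrefl L).
  - unfold pair in E. rewrite Es in E. apply pa_plus_cancel in E as <-.
    split; [reflexivity|]. exact (pa_plus_cancel _ _ _ Es).
  - apply pa_pair_lt in L. rewrite E in L. destruct (pa_lt_irrefl L).
Qed.

Lemma pa_le_pair_l (x y : M) : x < succ (pair x y).
Proof. apply pa_lt_succ. exists ((x + y) * (x + y)). reflexivity. Qed.

Lemma pa_le_pair_r (x y : M) : y < succ (pair x y).
Proof.
  apply pa_lt_succ. unfold pair. destruct (pa_cases y) as [->|[z ->]].
  - exists ((x + 0) * (x + 0) + x). ring.
  - exists ((x + succ z) * (x + z) + x + x). pa_ring.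
Qed.

Lemma pa_pair_le (x y y' : M) : y < succ y' -> pair x y < succ (pair x y').
Proof.
  intros L. apply pa_lt_succ_cases in L as [L| ->]; apply pa_lt_succ_cases; [left|auto].
  apply pa_pair_lt. destruct L as [z <-]. exists z. pa_ring.
Qed.

Lemma pa_divides_le (m c : M) : c <> 0 -> divides m c -> exists w, w + m = c.
Proof.
  intros N [q <-]. destruct (pa_cases q) as [->|[r ->]].
  - destruct N. ring.
  - exists (r * m). pa_ring.
Qed.

Definition selects (c d x y : M) : Prop :=
  y < succ c /\ divides (modulus d (pair x y)) c /\
  forall z, z < y -> ~ divides (modulus d (pair x z)) c.

Lemma pa_selects_unique (c d x y y' : M) : selects c d x y -> selects c d x y' -> y = y'.
Proof.
  intros [_ [D L]] [_ [D' L']]. destruct (pa_lt_total y y') as [A|[A|A]]; [|exact A|].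
  - destruct (L' y A D).
  - destruct (L y' A D').
Qed.

Lemma sat_Member (e : nat -> M) c d z :
  sat e (Member c d z) <-> divides (modulus (teval e d) (teval e z)) (teval e c).
Proof.
  unfold Member. rewrite sat_BEx. unfold tlift; simpl. setoid_rewrite teval_tsubst. simpl.
  split.
  - intros [q [_ E]]. exists q. exact E.
  - intros [q E]. exists q. split; [|exact E].
    apply pa_lt_succ. unfold modulus in E. rewrite <- E.
    eexists (q * (succ (teval e z) * teval e d)). pa_ring.
Qed.

Lemma sat_Selects (e : nat -> M) c d x y :
  sat e (Selects c d x y) <-> selects (teval e c) (teval e d) (teval e x) (teval e y).
Proof.
  unfold Selects, selects. cbn [sat]. rewrite sat_Member, sat_BAll.
  unfold Neg; cbn [sat]. setoid_rewrite sat_Member. simpl. unfold tlift.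
  setoid_rewrite teval_tsubst. reflexivity.
Qed.

(** Collection by induction on [u], available for boxed [p] too. Bounding the pairs instead of the
    values prepares for coding the set of pairs below [N]. *)
Lemma pa_collect_pairs p (e : nat -> M) : forall u,
  (forall x, x < u -> exists y, sat (y .: x .: e) p) ->
  exists N, forall x, x < u -> exists y, pair x y < N /\ sat (y .: x .: e) p.
Proof.
  set (p1 := subst (scons (Var 0%nat) (scons (Var 1%nat) (fun n => Var (3 + n)%nat))) p).
  set (p2 := subst (scons (Var 0%nat) (scons (Var 1%nat) (fun n => Var (4 + n)%nat))) p).
  assert (P1 : forall y x u : M, sat (y .: x .: u .: e) p1 <-> sat (y .: x .: e) p).
  { intros y x u. unfold p1. rewrite (sat_subst (pa_box_subst PA)), !teval_scons. reflexivity. }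
  assert (P2 : forall y x N u : M, sat (y .: x .: N .: u .: e) p2 <-> sat (y .: x .: e) p).
  { intros y x N u. unfold p2. rewrite (sat_subst (pa_box_subst PA)), !teval_scons. reflexivity. }
  assert (A : forall u, sat (u .: e) (Imp (BAll (Var 0) (Ex p1))
    (Ex (BAll (Var 1) (Ex (And (Lt (Pair (Var 1) (Var 0)) (Var 2)) p2)))))).
  { apply (pa_induction PA).
    - intros _. exists 0. rewrite sat_BAll. intros x L. destruct (pa_lt_zero L).
    - intros u IH H. rewrite sat_BAll in H. destruct IH as [N HN].
      { rewrite sat_BAll. intros x L. destruct (H x) as [y Y].
        - apply pa_lt_succ_cases; left; exact L.
        - exists y. rewrite P1 in *. exact Y. }
      destruct (H u (pa_lt_succ_diag u)) as [y Y]. rewrite P1 in Y.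
      exists (N + succ (pair u y)). rewrite sat_BAll in *. intros x L.
      apply pa_lt_succ_cases in L as [L| ->].
      + destruct (HN x L) as [z [Lz Z]]. rewrite P2 in Z. exists z. split; [|rewrite P2; exact Z].
        apply pa_lt_plus_r. exact Lz.
      + exists y. split; [|rewrite P2; exact Y]. apply pa_lt_plus_l, pa_lt_succ_diag. }
  intros u H. destruct (A u) as [N HN].
  - rewrite sat_BAll. intros x L. destruct (H x L) as [y Y]. exists y. rewrite P1. exact Y.
  - exists N. rewrite sat_BAll in HN. intros x L. destruct (HN x L) as [y [Ly Y]].
    rewrite P2 in Y. exists y. split; [exact Ly|exact Y].
Qed.

Lemma pa_code_choice p (e : nat -> M) u :
  (forall x, x < u -> exists y, sat (y .: x .: e) p) ->
  exists c d, forall x, x < u -> exists y, selects c d x y /\ sat (y .: x .: e) p.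
Proof.
  intros H. destruct (pa_collect_pairs p e H) as [N HN].
  set (p' := subst (scons (Var 0%nat) (scons (Var 1%nat) (fun n => Var (3 + n)%nat))) p).
  assert (P : forall y x z : M, sat (y .: x .: z .: e) p' <-> sat (y .: x .: e) p).
  { intros y x z. unfold p'. rewrite (sat_subst (pa_box_subst PA)), !teval_scons. reflexivity. }
  destruct (pa_code_set (Ex (Ex (And (Eq (Var 2) (Pair (Var 1) (Var 0))) p'))) e N)
    as [c [d [Cn [Dn C]]]].
  exists c, d. intros x L. destruct (HN x L) as [y0 [L0 Y0]].
  assert (D0 : divides (modulus d (pair x y0)) c).
  { apply (C _ L0). exists x, y0. split; [reflexivity|rewrite P; exact Y0]. }
  destruct (pa_least (Member (Var 1) (Var 2) (Pair (Var 3) (Var 0)))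
    (c .: d .: x .: e0) y0) as [y [Y Least]].
  { rewrite sat_Member. exact D0. }
  rewrite sat_Member in Y. change (divides (modulus d (pair x y)) c) in Y.
  assert (Least' : forall z, z < y -> ~ divides (modulus d (pair x z)) c).
  { intros z Lz. specialize (Least z Lz). rewrite sat_Member in Least. exact Least. }
  (* The code is meaningful only below [N]; the least [y] is at most [y0], so its pair stays in that
     range. *)
  assert (Ly : pair x y < N).
  { destruct (pa_lt_succ_or y y0) as [Ly|Ly]; [|destruct (Least' _ Ly D0)].
    apply pa_pair_le with (x := x) in Ly. apply pa_lt_succ_cases in Ly as [Ly| ->].
    - exact (pa_lt_trans Ly L0).
    - exact L0. }
  exists y. split.
  - split; [|split; [exact Y|exact Least']].
    (* The bound on [y] comes from [y <= pair x y <= modulus <= c]; the last two inequalities use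
       that [d] and [c] are nonzero. *)
    destruct (pa_divides_le Cn Y) as [w W]. apply pa_lt_succ.
    generalize (pa_le_pair_r x y). rewrite pa_lt_succ. intros [v V].
    destruct (pa_cases d) as [->|[d' ->]]; [tauto|].
    rewrite <- W. exists (w + succ (succ v) + succ (pair x y) * d').
    unfold modulus. rewrite <- V. pa_ring.
  - apply (C _ Ly) in Y as [x' [y' [E Y']]].
    change (pair x y = pair x' y') in E. apply pa_pair_inj in E as [<- <-].
    rewrite P in Y'. exact Y'.
Qed.

End Arithmetic.

(* Only arithmetical formulas are evaluated in [standard], so its [box] is irrelevant. *)
Definition standard : structure := {|
  dom := nat; zero := 0; succ := S; plus := Nat.add; mult := Nat.mul; box _ _ := False
|}.

Lemma standard_PA : PA_structure standard.
Proof.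
  split; simpl; try lia.
  - intros e s p; simpl; tauto.
  - intros p e P0 PS x. induction x; auto.
Qed.

Lemma standard_lt (x y : standard) : lt x y <-> x < y.
Proof.
  unfold lt; simpl. split; [intros [z <-]; lia|intros L; exists (y - S x); lia].
Qed.

(** * Absoluteness of bounded formulas *)

Section Absoluteness.

Variable M : structure.
Hypothesis PA : PA_structure M.

Lemma teval_num (e : nat -> standard) t :
  teval (fun n => @num M (e n)) t = num (teval e t).
Proof.
  induction t as [n| |t IH|t IH u IH'|t IH u IH']; simpl; rewrite ?IH, ?IH';
    [reflexivity..|symmetry; apply (num_plus PA)|symmetry; apply (num_mult PA)].
Qed.

Lemma num_econs (e : nat -> standard) x :
  @num M x .: (fun n => num (e n)) = (fun n => num ((x .: e) n)).
Proof. extensionality n; destruct n; reflexivity. Qed.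

(** Below a numeral a model has only numerals, so bounded quantifiers with numerical parameters
    range over the same objects in [M] and in the standard numbers. *)
Lemma Delta0_absolute p : Delta0 p ->
  forall e : nat -> standard, sat (fun n => @num M (e n)) p <-> sat e p.
Proof.
  induction 1 as [|t u|t u|p q _ IHp _ IHq|p q _ IHp _ IHq|p q _ IHp _ IHq|t p _ IH|t p _ IH];
    intros e.
  - reflexivity.
  - simpl. rewrite !teval_num. split; [apply (num_inj PA)|congruence].
  - simpl. rewrite !teval_num. rewrite <- (pa_lt_succ PA).
    change (succ (@num M (teval e u))) with (@num M (S (teval e u))). rewrite (lt_num PA). split.
    + intros [k [L E]]. apply (num_inj PA) in E as <-. exists (teval e u - teval e t). lia.
    + intros [z E]. simpl in *. exists (@teval standard e t). split; [lia|reflexivity].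
  - simpl. rewrite IHp, IHq; reflexivity.
  - simpl. rewrite IHp, IHq; reflexivity.
  - simpl. rewrite IHp, IHq; reflexivity.
  - rewrite !sat_BAll, teval_num. setoid_rewrite (lt_num PA). setoid_rewrite standard_lt. split.
    + intros A k L. apply IH. rewrite <- num_econs. apply A; eauto.
    + intros A x [k [L ->]]. rewrite num_econs. apply IH, A, L.
  - rewrite !sat_BEx, teval_num. setoid_rewrite (lt_num PA). setoid_rewrite standard_lt. split.
    + intros [x [[k [L ->]] A]]. exists k. split; [exact L|].
      apply IH. rewrite <- num_econs. exact A.
    + intros [k [L A]]. exists (num k). split; [eauto|]. rewrite num_econs. apply IH, A.
Qed.

End Absoluteness.

(** * Reasoning under the box *)

Definition numsubst (v : nat -> nat) (p : form) : form := subst (fun n => numeral (v n)) p.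

Section Boxes.

Variable T : theory.
Hypothesis T_ext : extends T PA_K.

(** Consequence at each environment, hence provability of the implication; this, unlike mere
    preservation of provability, can be moved under a box. *)
Definition entails (p q : form) : Prop :=
  forall M, model T M -> forall e : nat -> M, sat e p -> sat e q.

Lemma proves_entails p q : entails p q -> proves T p -> proves T q.
Proof.
  intros E P. apply (completeness _ T_ext). intros M HM e. apply (E M HM), (model_sound HM), P.
Qed.

Lemma sat_numsubst M (HM : model T M) (e : nat -> M) v p :
  sat e (numsubst v p) <-> sat (fun n => @num M (v n)) p.
Proof.
  unfold numsubst. rewrite (sat_subst (model_box_subst HM)).
  replace (fun n => teval e (numeral (v n))) with (fun n => @num M (v n)); [reflexivity|].
  extensionality n. symmetry; apply teval_numeral.
Qed.

Lemma proves_numsubst v p :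
  (forall M, model T M -> sat (fun n => @num M (v n)) p) -> proves T (numsubst v p).
Proof.
  intros A. apply (completeness _ T_ext). intros M HM e. apply sat_numsubst; auto.
Qed.

Lemma proves_numsubst_ex a v p :
  proves T (numsubst (a .: v) p) -> proves T (numsubst v (Ex p)).
Proof.
  intros P. apply proves_numsubst. intros M HM. exists (num a). rewrite num_econs.
  apply (sat_numsubst HM (fun _ => zero)), (model_sound HM), P.
Qed.

Lemma proves_Delta0 v p : Delta0 p ->
  sat (M := standard) v p -> proves T (numsubst v p).
Proof.
  intros D S. apply proves_numsubst. intros M HM.
  exact (proj2 (Delta0_absolute (model_PA T_ext HM) D v) S).
Qed.

Lemma box_mp M (HM : model T M) (e : nat -> M) p q :
  box e (Imp p q) -> box e p -> box e q.
Proof.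
  assert (A : sat e (subst Var (Imp (Box (Imp p q)) (Imp (Box p) (Box q))))).
  { apply (model_sound HM), proves_universal_closure. intros r U.
    apply T_ext, pr_axiom. econstructor; exact U. }
  rewrite subst_Var in A. exact A.
Qed.

Lemma box_nec M (HM : model T M) (e : nat -> M) p : proves T p -> box e p.
Proof. intros P. exact (model_sound HM (pr_nec P) e). Qed.

(** The device that allows reasoning under a box to take place in another, arbitrary model [M']:
    completeness turns it into a theorem, then necessitation and K apply. *)
Lemma box_entails M (HM : model T M) {e : nat -> M} {p q} :
  entails p q -> box e p -> box e q.
Proof.
  intros E. apply (box_mp HM), (box_nec HM), (completeness _ T_ext).
  intros M' HM' e'. exact (E M' HM' e').
Qed.

Lemma box_and M (HM : model T M) {e : nat -> M} {p q} : box e p -> box e q -> box e (And p q).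
Proof.
  intros P. apply (box_mp HM). revert P. apply (box_mp HM), (box_nec HM), pr_logic, ax_and_intro.
Qed.

Lemma proves_box_entails p q : entails p q -> proves T (Box p) -> proves T (Box q).
Proof. intros E. apply proves_entails. intros M HM e. exact (box_entails HM E). Qed.

Lemma box_subst M (HM : model T M) (e : nat -> M) s p :
  box e (subst s p) <-> box (fun n => teval e (s n)) p.
Proof. apply (model_box_subst HM). Qed.

Lemma box_lift M (HM : model T M) (e : nat -> M) x p : box (x .: e) (lift p) <-> box e p.
Proof. unfold lift. rewrite (box_subst HM). reflexivity. Qed.

(** By substitutivity [box] sees a term only through its value, so the equation can be exchanged for
    an instance of reflexivity. *)
Lemma box_Eq M (HM : model T M) (e : nat -> M) t u :
  teval e t = teval e u -> box e (Eq t u).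
Proof.
  intros E.
  assert (A : forall u, box e (Eq t u) <-> box (teval e t .: teval e u .: e) (Eq (Var 0) (Var 1))).
  { intros v. change (Eq t v) with (subst (scons t (scons v Var)) (Eq (Var 0) (Var 1))).
    rewrite (box_subst HM), !teval_scons. reflexivity. }
  rewrite A, <- E, <- A. apply (box_nec HM), pr_logic, ax_eq_refl.
Qed.

Lemma box_Ex M (HM : model T M) (e : nat -> M) x p : box (x .: e) p -> box e (Ex p).
Proof.
  intros B. apply (box_lift HM) with (x := x). revert B. apply (box_entails HM).
  intros M' HM' e' S. unfold lift. rewrite (sat_subst (model_box_subst HM')).
  exists (e' 0). replace (e' 0 .: _) with e'; [exact S|].
  extensionality n; destruct n; reflexivity.
Qed.

Lemma box_Lt M (HM : model T M) (e : nat -> M) t u :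
  lt (teval e t) (teval e u) -> box e (Lt t u).
Proof.
  intros [z Z]. apply (box_lift HM) with (x := z).
  apply (@box_entails _ HM _ (Eq (Plus (Var 0) (Succ (tlift t))) (tlift u))).
  - intros M' HM' e' E. exists (e' 0). exact E.
  - apply (box_Eq HM). unfold tlift; simpl. rewrite !teval_tsubst. exact Z.
Qed.

(** A Barcan principle for bounded quantifiers. It holds by induction on the bound, for a formula
    with [Box] on both sides of an implication. *)
Lemma box_BAll M (HM : model T M) (e : nat -> M) t p :
  (forall x, lt x (teval e t) -> box (x .: e) p) -> box e (BAll t p).
Proof.
  pose proof (model_PA T_ext HM) as PA.
  set (p' := subst (scons (Var 0) (fun n => Var (S (S n)))) p).
  assert (P : forall x u : M, box (x .: u .: e) p' <-> box (x .: e) p).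
  { intros x u. unfold p'. rewrite (box_subst HM), teval_scons. reflexivity. }
  assert (A : forall u, sat (u .: e) (Imp (BAll (Var 0) (Box p')) (Box (BAll (Var 0) p')))).
  { apply (pa_induction PA).
    - intros _.
      assert (B : box (@zero M .: e) (Eq (Var 0) Zero)) by (apply (box_Eq HM); reflexivity).
      revert B. apply (box_entails HM). intros M' HM' e' E. rewrite sat_BAll. intros x L.
      simpl in *. rewrite E in L. destruct (pa_lt_zero (model_PA T_ext HM') L).
    (* The environment carries both [u] and [succ u]: reasoning under the box cannot see values, so
       their relation is supplied as the boxed equation [B3]. *)
    - intros u IH A. rewrite sat_BAll in A.
      assert (B1 : box (succ u .: u .: e)
        (subst (scons (Var 1) (fun n => Var (S (S n)))) (BAll (Var 0) p'))).
      { rewrite (box_subst HM), teval_scons. apply IH. rewrite sat_BAll.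
        intros x L. unfold sat. rewrite P, <- P with (u := succ u). apply A.
        apply (pa_lt_succ_cases PA); left; exact L. }
      assert (B2 : box (succ u .: u .: e) (subst (scons (Var 1) (fun n => Var (S (S n)))) p)).
      { rewrite (box_subst HM), teval_scons, <- P with (u := succ u). apply A.
        apply (pa_lt_succ_diag PA). }
      assert (B3 : box (succ u .: u .: e) (Eq (Var 0) (Succ (Var 1))))
        by (apply (box_Eq HM); reflexivity).
      assert (B4 : box (succ u .: u .: e)
        (subst (scons (Var 0) (fun n => Var (S (S n)))) (BAll (Var 0) p'))).
      2: { rewrite (box_subst HM), teval_scons in B4. exact B4. }
      generalize (box_and HM (box_and HM B1 B2) B3). apply (box_entails HM).
      intros M' HM' e' [[S1 S2] S3]. simpl in S3.
      rewrite (sat_subst (model_box_subst HM')), teval_scons, ?sat_BAll in *.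
      intros x L. unfold p' in *. rewrite (sat_subst (model_box_subst HM')), teval_scons.
      cbn [teval econs] in L. rewrite S3 in L.
      apply (pa_lt_succ_cases (model_PA T_ext HM')) in L as [L| ->]; [|exact S2].
      specialize (S1 x L). rewrite (sat_subst (model_box_subst HM')), teval_scons in S1.
      exact S1. }
  intros H.
  assert (B : box e (subst (scons t Var) (BAll (Var 0) p'))).
  { rewrite (box_subst HM), teval_scons. apply A. rewrite sat_BAll.
    intros x L. unfold sat. rewrite P. exact (H x L). }
  revert B. apply (box_entails HM). intros M' HM' e'.
  rewrite (sat_subst (model_box_subst HM')), teval_scons, !sat_BAll.
  intros S x L. specialize (S x L). unfold p' in S.
  rewrite (sat_subst (model_box_subst HM')), teval_scons in S. exact S.
Qed.

(** The negative half is carried along because [Delta0] is closed under implication. *)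
Lemma Delta0_box p : Delta0 p -> forall M (HM : model T M) (e : nat -> M),
  (sat e p -> box e p) /\ (~ sat e p -> box e (Neg p)).
Proof.
  induction 1 as [|t u|t u|p q _ IHp _ IHq|p q _ IHp _ IHq|p q _ IHp _ IHq|t p _ IH|t p _ IH];
    intros M HM e; pose proof (model_PA T_ext HM) as PA;
    try specialize (IHp M HM e) as [IHp IHp']; try specialize (IHq M HM e) as [IHq IHq'].
  - split; [intros []|intros _]. apply (box_nec HM), proves_imp_refl.
  - split; [apply (box_Eq HM)|]. intros N. simpl in N.
    assert (L : lt (teval e t) (teval e u) \/ lt (teval e u) (teval e t))
      by (destruct (pa_lt_total PA (teval e t) (teval e u)) as [|[|]]; tauto).
    destruct L as [L|L]; apply (box_Lt HM) in L; revert L; apply (box_entails HM);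
      intros M' HM' e' L E; simpl in E.
    + change (lt (teval e' t) (teval e' u)) in L. rewrite E in L.
      exact (pa_lt_irrefl (model_PA T_ext HM') L).
    + change (lt (teval e' u) (teval e' t)) in L. rewrite E in L.
      exact (pa_lt_irrefl (model_PA T_ext HM') L).
  - assert (E : forall M', model T M' -> forall e' : nat -> M',
      sat e' (Le t u) <-> lt (teval e' t) (teval e' (Succ u))).
    { intros M' HM' e'. symmetry; apply (pa_lt_succ (model_PA T_ext HM')). }
    split.
    + rewrite (E M HM e). intros L. apply (box_Lt HM) in L. revert L.
      apply (box_entails HM). intros M' HM' e' L. apply (E M' HM' e'). exact L.
    + rewrite (E M HM e). intros N.
      assert (L : lt (teval e u) (teval e t)).
      { destruct (pa_lt_succ_or PA (teval e t) (teval e u)) as [L|L]; [destruct (N L)|exact L]. }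
      apply (box_Lt HM) in L. revert L. apply (box_entails HM). intros M' HM' e' L S.
      rewrite (E M' HM' e') in S. change (lt (teval e' u) (teval e' t)) in L.
      exact (pa_lt_irrefl (model_PA T_ext HM')
        (pa_lt_le_trans (model_PA T_ext HM') L S)).
  - split.
    + intros S. destruct (classic (sat e p)) as [Sp|Sp].
      * generalize (IHq (S Sp)). apply (box_entails HM). intros M' HM' e' Sq _. exact Sq.
      * generalize (IHp' Sp). apply (box_entails HM). intros M' HM' e' Np Sp'. destruct (Np Sp').
    + intros N. simpl in N. assert (Sp : sat e p) by tauto. assert (Sq : ~ sat e q) by tauto.
      generalize (box_and HM (IHp Sp) (IHq' Sq)). apply (box_entails HM).
      intros M' HM' e' [A B] C. exact (B (C A)).
  - split.
    + intros [Sp Sq]. exact (box_and HM (IHp Sp) (IHq Sq)).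
    + intros N. simpl in N. assert (S : ~ sat e p \/ ~ sat e q) by tauto.
      destruct S as [S|S]; [generalize (IHp' S)|generalize (IHq' S)]; apply (box_entails HM);
        intros M' HM' e' A [B C]; [exact (A B)|exact (A C)].
  - split.
    + intros [S|S]; [generalize (IHp S)|generalize (IHq S)]; apply (box_entails HM);
        intros M' HM' e' A; [left|right]; exact A.
    + intros N. simpl in N. assert (Sp : ~ sat e p) by tauto. assert (Sq : ~ sat e q) by tauto.
      generalize (box_and HM (IHp' Sp) (IHq' Sq)). apply (box_entails HM).
      intros M' HM' e' [A B] [C|C]; [exact (A C)|exact (B C)].
  - split.
    + rewrite sat_BAll. intros S. apply (box_BAll HM). intros x L.
      apply (IH M HM (x .: e)), S, L.
    + rewrite sat_BAll. intros N. apply not_all_ex_not in N as [x N].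
      apply imply_to_and in N as [L N].
      assert (B : box e (BEx t (Neg p))).
      { apply (box_Ex HM) with (x := x). apply (box_and HM).
        - apply (box_Lt HM). unfold tlift. rewrite teval_tsubst. exact L.
        - apply (IH M HM (x .: e)), N. }
      revert B. apply (box_entails HM). intros M' HM' e'. rewrite sat_BEx.
      intros [y [Ly Ny]] S. rewrite sat_BAll in S. exact (Ny (S y Ly)).
  - split.
    + rewrite sat_BEx. intros [x [L S]]. apply (box_Ex HM) with (x := x). apply (box_and HM).
      * apply (box_Lt HM). unfold tlift. rewrite teval_tsubst. exact L.
      * apply (IH M HM (x .: e)), S.
    + rewrite sat_BEx. intros N.
      assert (B : box e (BAll t (Neg p))).
      { apply (box_BAll HM). intros x L. apply (IH M HM (x .: e)). intros S.
        apply N. exists x. split; [exact L|exact S]. }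
      revert B. apply (box_entails HM). intros M' HM' e'. rewrite sat_BAll.
      intros A S. rewrite sat_BEx in S. destruct S as [y [Ly Sy]]. exact (A y Ly Sy).
Qed.

End Boxes.

Section Realizability.

Variable T : theory.
Hypothesis T_ext : extends T PA_K.
Hypothesis T_nbox : ~ proves T (Box Bot).

(* Only the instances at numerals can be reversed: [Box psi -> psi] is not available in [T]. *)
Definition realized_by (psi phi : form) : Prop :=
  (forall M, model T M -> forall e : nat -> M, sat e phi -> exists y, box (y .: e) psi) /\
  (forall m v, proves T (Box (numsubst (m .: v) psi)) -> proves T (numsubst v phi)).

Definition realizable (phi : form) : Prop := exists psi, realized_by psi phi.

Lemma econs_eta2 (D : Type) (e : nat -> D) : e 0 .: e 1 .: (fun n => e (2 + n)) = e.
Proof. extensionality n; destruct n as [|[|n]]; reflexivity. Qed.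

Lemma numsubst_lift m v p : numsubst (m .: v) (lift p) = numsubst v p.
Proof. unfold numsubst, lift. rewrite subst_subst. reflexivity. Qed.

Lemma proves_box_numsubst_entails v w p q :
  (forall M, model T M -> sat (fun n => @num M (v n)) p -> sat (fun n => @num M (w n)) q) ->
  proves T (Box (numsubst v p)) -> proves T (Box (numsubst w q)).
Proof.
  intros E. apply (proves_box_entails T_ext). intros M HM e.
  rewrite !(sat_numsubst HM). exact (E M HM).
Qed.

(** This is where the unprovability of [Box Bot] enters: no box of a sentence refuted by [T] is
    provable. *)
Lemma not_proves_box_numsubst v p :
  (forall M, model T M -> ~ sat (fun n => @num M (v n)) p) -> ~ proves T (Box (numsubst v p)).
Proof.
  intros E P. apply T_nbox. revert P. apply (proves_box_numsubst_entails v v p Bot). exact E.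
Qed.

(** Two witnesses become one through [Pair]. As pairing is not onto, a numeral [m] may code no pair;
    then the instance is refutable and its box unprovable. *)
Lemma collapse_witnesses psi : exists psi',
  (forall M, model T M -> forall (e : nat -> M) x y, box (y .: x .: e) psi ->
    exists z, box (z .: e) psi') /\
  (forall m v, proves T (Box (numsubst (m .: v) psi')) ->
    exists a b, proves T (Box (numsubst (b .: a .: v) psi))).
Proof.
  set (psi1 := subst (scons (Var 0) (scons (Var 1) (fun n => Var (3 + n)))) psi).
  assert (P : forall M, model T M -> forall (e : nat -> M) x y z,
    sat (y .: x .: z .: e) psi1 <-> sat (y .: x .: e) psi).
  { intros M HM e x y z. unfold psi1.
    rewrite (sat_subst (model_box_subst HM)), !teval_scons. reflexivity. }
  (* Bounding the components by the code makes them standard when the code is a numeral. *)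
  exists (BEx (Succ (Var 0)) (BEx (Succ (Var 1)) (And (Eq (Var 2) (Pair (Var 1) (Var 0))) psi1))).
  split.
  - intros M HM e x y B. exists (pair _ x y).
    apply (@box_entails T T_ext M HM _ _
      (subst (scons (Pair (Var 1) (Var 0)) (fun n => Var (2 + n)))
        (BEx (Succ (Var 0)) (BEx (Succ (Var 1))
          (And (Eq (Var 2) (Pair (Var 1) (Var 0))) psi1))))) in B.
    + rewrite (box_subst HM), teval_scons in B. exact B.
    + intros M' HM' e' S. pose proof (model_PA T_ext HM') as PA.
      rewrite (sat_subst (model_box_subst HM')), teval_scons, sat_BEx.
      exists (e' 1). split; [apply (pa_le_pair_l PA)|]. rewrite sat_BEx.
      exists (e' 0). split; [apply (pa_le_pair_r PA)|]. split; [reflexivity|].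
      rewrite (P M' HM').
      change (sat (e' 0 .: e' 1 .: (fun n => e' (2 + n))) psi). rewrite econs_eta2. exact S.
  - intros m v B.
    destruct (classic (exists a b, pair standard a b = m)) as [[a [b E]]|N].
    + exists a, b. revert B. apply proves_box_numsubst_entails. intros M HM S.
      pose proof (model_PA T_ext HM) as PA.
      rewrite <- !num_econs in *. rewrite sat_BEx in S. destruct S as [x [Lx S]].
      rewrite sat_BEx in S. destruct S as [y [Ly [S Q]]]. rewrite (P M HM) in Q.
      change (num m = pair M x y) in S. subst m.
      assert (E : @num M (pair standard a b) = pair M (num a) (num b)).
      { symmetry. exact (teval_num PA (a .: b .: v) (Pair (Var 0) (Var 1))). }
      rewrite E in S. apply (pa_pair_inj PA) in S as [<- <-]. exact Q.
    + exfalso. revert B. apply not_proves_box_numsubst. intros M HM S.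
      pose proof (model_PA T_ext HM) as PA.
      rewrite <- !num_econs in S. rewrite sat_BEx in S. destruct S as [x [Lx S]].
      rewrite sat_BEx in S. destruct S as [y [Ly [S Q]]].
      change (num m = pair M x y) in S. change (lt x (num (Datatypes.S m))) in Lx.
      change (lt y (num (Datatypes.S m))) in Ly.
      apply (lt_num PA) in Lx as [a [_ ->]], Ly as [b [_ ->]].
      apply N. exists a, b. apply (num_inj PA). rewrite S.
      symmetry. exact (teval_num PA (a .: b .: v) (Pair (Var 0) (Var 1))).
Qed.

Lemma realizable_of_two phi psi :
  (forall M, model T M -> forall e : nat -> M, sat e phi -> exists x y, box (y .: x .: e) psi) ->
  (forall a b v, proves T (Box (numsubst (b .: a .: v) psi)) -> proves T (numsubst v phi)) ->
  realizable phi.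
Proof.
  intros R1 R2. destruct (collapse_witnesses psi) as [psi' [C1 C2]].
  exists psi'. split.
  - intros M HM e S. destruct (R1 M HM e S) as [x [y B]]. exact (C1 M HM e x y B).
  - intros m v B. destruct (C2 m v B) as [a [b B']]. exact (R2 a b v B').
Qed.

(** The witness is a dummy. A true numerical instance is provable outright, and a false one is
    refutable, so its box is not provable. *)
Lemma realizable_Delta0 p : Delta0 p -> realizable p.
Proof.
  intros D. exists (lift p). split.
  - intros M HM e S. exists zero. rewrite (box_lift HM). apply (Delta0_box T_ext D HM e), S.
  - intros m v. rewrite numsubst_lift. intros B.
    destruct (classic (@sat standard v p)) as [S|S]; [exact (proves_Delta0 T_ext _ D S)|].
    exfalso. revert B. apply not_proves_box_numsubst. intros M HM.
    rewrite (Delta0_absolute (model_PA T_ext HM) D). exact S.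
Qed.

Lemma realizable_Box p : realizable (Box p).
Proof.
  exists (lift p). split.
  - intros M HM e S. exists zero. rewrite (box_lift HM). exact S.
  - intros m v. rewrite numsubst_lift. exact (fun B => B).
Qed.

(** The first witness is the value of the quantified variable, the second realizes the matrix
    there. *)
Lemma realizable_Ex p : realizable p -> realizable (Ex p).
Proof.
  intros [psi [R1 R2]]. apply realizable_of_two with (psi := psi).
  - intros M HM e [x S]. exists x. exact (R1 M HM _ S).
  - intros a b v B. exact (proves_numsubst_ex T_ext _ _ _ (R2 b (a .: v) B)).
Qed.

Let skip1 (psi : form) : form := subst (scons (Var 0) (fun n => Var (2 + n))) psi.

Lemma box_skip1 M (HM : model T M) (e : nat -> M) x y psi :
  box (y .: x .: e) (skip1 psi) <-> box (y .: e) psi.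
Proof. unfold skip1. rewrite (box_subst HM), teval_scons. reflexivity. Qed.

Lemma sat_skip1 M (HM : model T M) (e : nat -> M) x y psi :
  sat (y .: x .: e) (skip1 psi) <-> sat (y .: e) psi.
Proof.
  unfold skip1. rewrite (sat_subst (model_box_subst HM)), teval_scons. reflexivity.
Qed.

Lemma realizable_And p q : realizable p -> realizable q -> realizable (And p q).
Proof.
  intros [psi [R1 R2]] [chi [Q1 Q2]].
  apply realizable_of_two with (psi := And (lift psi) (skip1 chi)).
  - intros M HM e [Sp Sq]. destruct (R1 M HM e Sp) as [x Bx], (Q1 M HM e Sq) as [y By].
    exists x, y.
    apply (box_and T_ext HM); [rewrite (box_lift HM)|rewrite (box_skip1 HM)]; assumption.
  - intros a b v B.
    assert (P : proves T (numsubst v p)).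
    { apply R2 with (m := a). revert B. apply proves_box_numsubst_entails.
      intros M HM [S _]. rewrite <- !num_econs in *. unfold lift in S.
      rewrite (sat_subst (model_box_subst HM)) in S. exact S. }
    assert (Q : proves T (numsubst v q)).
    { apply Q2 with (m := b). revert B. apply proves_box_numsubst_entails.
      intros M HM [_ S]. rewrite <- !num_econs in *. rewrite (sat_skip1 HM) in S. exact S. }
    eapply pr_mp; [eapply pr_mp; [apply pr_logic, ax_and_intro|exact P]|exact Q].
Qed.

(* The first witness selects the disjunct. *)
Lemma realizable_Or p q : realizable p -> realizable q -> realizable (Or p q).
Proof.
  intros [psi [R1 R2]] [chi [Q1 Q2]].
  apply realizable_of_two with (psi := And (Imp (Eq (Var 1) Zero) (skip1 psi))
    (Imp (Neg (Eq (Var 1) Zero)) (skip1 chi))).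
  - intros M HM e [S|S].
    + destruct (R1 M HM e S) as [y B]. exists zero, y.
      assert (E : box (y .: zero .: e) (Eq (Var 1) Zero)) by (apply (box_Eq HM); reflexivity).
      rewrite <- (box_skip1 HM) with (x := zero) in B. generalize (box_and T_ext HM B E).
      apply (box_entails T_ext HM). intros M' HM' e' [A A']. simpl in *. tauto.
    + destruct (Q1 M HM e S) as [y B]. exists (succ zero), y.
      assert (E : box (y .: succ zero .: e) (Eq (Var 1) (Succ Zero)))
        by (apply (box_Eq HM); reflexivity).
      rewrite <- (box_skip1 HM) with (x := succ zero) in B. generalize (box_and T_ext HM B E).
      apply (box_entails T_ext HM). intros M' HM' e' [A A']. simpl in *. rewrite A'.
      split; [|tauto]. intros F. destruct (pa_succ_zero (model_PA T_ext HM') _ F).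
  - intros [|a] b v B.
    + eapply pr_mp; [apply pr_logic, ax_or_left|]. apply R2 with (m := b). revert B.
      apply proves_box_numsubst_entails. intros M HM [S _].
      rewrite <- !num_econs in *. rewrite <- (sat_skip1 HM) with (x := num 0).
      apply S. reflexivity.
    + eapply pr_mp; [apply pr_logic, ax_or_right|]. apply Q2 with (m := b). revert B.
      apply proves_box_numsubst_entails. intros M HM [_ S].
      rewrite <- !num_econs in *. rewrite <- (sat_skip1 HM) with (x := num (Datatypes.S a)).
      apply S. intros F. destruct (pa_succ_zero (model_PA T_ext HM) _ F).
Qed.

Lemma Delta0_Selects c d x y : Delta0 (Selects c d x y).
Proof. repeat constructor. Qed.

(* The two witnesses code a choice function, see [pa_code_choice]. *)
Lemma realizable_BAll t p : realizable p -> realizable (BAll t p).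
Proof.
  intros [psi [R1 R2]].
  set (psi1 := subst (scons (Var 0) (scons (Var 1) (fun n => Var (4 + n)))) psi).
  assert (PB : forall M, model T M -> forall (e : nat -> M) y x d c,
    box (y .: x .: d .: c .: e) psi1 <-> box (y .: x .: e) psi).
  { intros M HM e y x d c. unfold psi1. rewrite (box_subst HM), !teval_scons. reflexivity. }
  assert (PS : forall M, model T M -> forall (e : nat -> M) y x d c,
    sat (y .: x .: d .: c .: e) psi1 <-> sat (y .: x .: e) psi).
  { intros M HM e y x d c. unfold psi1.
    rewrite (sat_subst (model_box_subst HM)), !teval_scons. reflexivity. }
  apply realizable_of_two with (psi := BAll (tsubst (fun n => Var (2 + n)) t)
    (Ex (And (Selects (Var 3) (Var 2) (Var 1) (Var 0)) psi1))).
  - intros M HM e S. pose proof (model_PA T_ext HM) as PA. rewrite sat_BAll in S.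
    (* Choice is applied in [M] to the formula [Box psi], which relies on induction for boxed
       formulas; [c] and [d] may be nonstandard here. *)
    destruct (@pa_code_choice M PA (Box psi) e (teval e t)) as [c [d C]].
    { intros x L. exact (R1 M HM _ (S x L)). }
    exists c, d. apply (box_BAll T_ext HM). intros x L. rewrite teval_tsubst in L.
    destruct (C x L) as [y [Sel B]]. apply (box_Ex T_ext HM) with (x := y).
    apply (box_and T_ext HM).
    + apply (Delta0_box T_ext (Delta0_Selects _ _ _ _) HM). rewrite (sat_Selects PA). exact Sel.
    + rewrite (PB M HM). exact B.
  - intros c d v B.
    assert (P : forall k, k < @teval standard v t -> proves T (numsubst (k .: v) p)).
    { intros k L.
      (* The value selected at [k] is at most [c], hence a numeral, and by absoluteness it is the
         value selected in the standard numbers. *)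
      assert (W : forall M, model T M -> sat (fun n => @num M ((d .: c .: v) n))
          (BAll (tsubst (fun n => Var (2 + n)) t)
            (Ex (And (Selects (Var 3) (Var 2) (Var 1) (Var 0)) psi1))) ->
        exists j, selects standard c d k j /\ sat (fun n => @num M ((j .: k .: v) n)) psi).
      { intros M HM S. pose proof (model_PA T_ext HM) as PA.
        rewrite sat_BAll, teval_tsubst in S. destruct (S (num k)) as [y [Sel Q]].
        { simpl. rewrite (teval_num PA), (lt_num PA). eauto. }
        rewrite <- !num_econs, (PS M HM) in Q.
        assert (Ly : lt y (num (Datatypes.S c))).
        { rewrite (sat_Selects PA) in Sel. exact (proj1 Sel). }
        apply (lt_num PA) in Ly as [j [_ ->]]. exists j. split.
        - rewrite !num_econs, (Delta0_absolute PA (Delta0_Selects _ _ _ _)),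
            (sat_Selects standard_PA) in Sel. exact Sel.
        - rewrite <- !num_econs. exact Q. }
      (* Decided in the standard numbers, so that one [j] serves all models, which [R2] requires. *)
      destruct (classic (exists j, selects standard c d k j)) as [[j J]|N].
      - apply R2 with (m := j). revert B. apply proves_box_numsubst_entails. intros M HM S.
        destruct (W M HM S) as [j' [J' Q]].
        rewrite (pa_selects_unique standard_PA J J'). exact Q.
      - exfalso. revert B. apply not_proves_box_numsubst. intros M HM S.
        destruct (W M HM S) as [j [J _]]. eauto. }
    apply (proves_numsubst T_ext). intros M HM. pose proof (model_PA T_ext HM) as PA.
    rewrite sat_BAll. intros x L. rewrite (teval_num PA), (lt_num PA) in L.
    destruct L as [k [L ->]]. rewrite num_econs.
    apply (sat_numsubst HM (fun _ => zero)), (model_sound HM), P, L.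
Qed.

Lemma realizable_Sigma1_Box p : Sigma1_Box p -> realizable p.
Proof.
  induction 1 as [p S|p [q]| | | |].
  - induction S; auto using realizable_Delta0, realizable_Ex.
  - apply realizable_Box.
  - auto using realizable_And.
  - auto using realizable_Or.
  - auto using realizable_Ex.
  - auto using realizable_BAll.
Qed.

Lemma bounded_keep_first k p : bounded (S k) p -> 
  bounded 1 (subst (scons (Var 0) (fun _ => Zero)) p).
Proof.
  intros B. eapply bounded_subst; [exact B|]. intros [|n] _; simpl; auto.
Qed.

Theorem EP_ClassB_Sigma1_Box : has_EP ClassB T -> has_EP Sigma1_Box T.
Proof.
  intros EP p Sp Bp P.
  destruct (realizable_Sigma1_Box Sp) as [psi [R1 R2]].
  (* The value of the quantified variable must be recovered as a numeral, so it is coded together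
     with the realizer of [p]. *)
  destruct (collapse_witnesses psi) as [psi' [C1 C2]].
  (* Setting the other variables of [psi'] to 0 leaves at most one free, as the existence property
     demands. *)
  set (chi := subst (scons (Var 0) (fun _ => Zero)) psi').
  destruct (EP (Box chi)) as [m Q].
  - constructor.
  - destruct (bounded_exists psi') as [k B]. apply (@bounded_keep_first k).
    eapply bounded_le; [|exact B]; lia.
  - apply (completeness _ T_ext). intros M HM e.
    destruct (model_sound HM P (fun _ => zero)) as [x Sx].
    destruct (R1 M HM _ Sx) as [y B]. destruct (C1 M HM _ _ _ B) as [z Z].
    exists z. unfold chi. simpl. rewrite (box_subst HM), teval_scons. exact Z.
  - destruct (C2 m (fun _ => 0)) as [a [b B]].
    + replace (numsubst (m .: (fun _ => 0)) psi') with (inst (numeral m) chi); [exact Q|].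
      unfold chi, inst, numsubst. rewrite subst_subst. f_equal.
      extensionality n; destruct n; reflexivity.
    + exists a. apply R2 in B.
      replace (inst (numeral a) p) with (numsubst (a .: fun _ => 0) p); [exact B|].
      eapply subst_agree; [exact Bp|]. intros [|n] L; [reflexivity|lia].
Qed.

End Realizability.

(** * Delta0 and Sigma1 definability over the natural numbers *)

Local Notation env := (nat -> nat).

Definition term_function (f : env -> nat) : Prop :=
  exists t, forall e, f e = @teval standard e t.

(** Definability is a property of predicates on environments, so that definable notions can be
    composed without writing formulas with indices. *)
Definition delta0 (P : env -> Prop) : Prop :=
  exists p, Delta0 p /\ forall e, P e <-> @sat standard e p.

Lemma term_function_var i : term_function (fun e => e i).
Proof. exists (Var i); reflexivity. Qed.

Lemma term_function_const k : term_function (fun _ => k).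
Proof.
  exists (numeral k). intros e. rewrite teval_numeral. induction k; simpl; congruence.
Qed.

Lemma term_function_succ f : term_function f -> term_function (fun e => S (f e)).
Proof. intros [t Ht]. exists (Succ t). intros e. rewrite Ht; reflexivity. Qed.

Lemma term_function_plus f g :
  term_function f -> term_function g -> term_function (fun e => f e + g e).
Proof. intros [t Ht] [u Hu]. exists (Plus t u). intros e. rewrite Ht, Hu; reflexivity. Qed.

Lemma term_function_mult f g :
  term_function f -> term_function g -> term_function (fun e => f e * g e).
Proof. intros [t Ht] [u Hu]. exists (Mult t u). intros e. rewrite Ht, Hu; reflexivity. Qed.

Lemma term_function_rename f (r : nat -> nat) :
  term_function f -> term_function (fun e => f (fun n => e (r n))).
Proof.
  intros [t Ht]. exists (tsubst (fun n => Var (r n)) t). intros e.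
  rewrite Ht, teval_tsubst; reflexivity.
Qed.

Lemma delta0_iff P Q : (forall e, Q e <-> P e) -> delta0 P -> delta0 Q.
Proof. intros E [p [Dp Hp]]. exists p. split; [exact Dp|]. intros e. rewrite E; auto. Qed.

Lemma Delta0_subst p : Delta0 p -> forall s, Delta0 (subst s p).
Proof.
  assert (L : forall s t, tsubst (up s) (tlift t) = tlift (tsubst s t)).
  { intros s t. unfold tlift. rewrite !tsubst_tsubst. reflexivity. }
  induction 1; intros s; simpl; try (constructor; auto).
  - change (Delta0 (All (Imp (Lt (Var 0) (tsubst (up s) (tlift t))) (subst (up s) p)))).
    rewrite L. apply D0_ball. auto.
  - change (Delta0 (Ex (And (Lt (Var 0) (tsubst (up s) (tlift t))) (subst (up s) p)))).
    rewrite L. apply D0_bex. auto.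
Qed.

Lemma delta0_rename P (r : nat -> nat) : delta0 P -> delta0 (fun e => P (fun n => e (r n))).
Proof.
  intros [p [Dp Hp]]. exists (subst (fun n => Var (r n)) p).
  split; [apply Delta0_subst, Dp|]. intros e.
  rewrite (sat_subst (pa_box_subst standard_PA)). apply Hp.
Qed.

Lemma delta0_eq f g : term_function f -> term_function g -> delta0 (fun e => f e = g e).
Proof.
  intros [t Ht] [u Hu]. exists (Eq t u). split; [constructor|].
  intros e. rewrite Ht, Hu. reflexivity.
Qed.

Lemma delta0_lt f g : term_function f -> term_function g -> delta0 (fun e => f e < g e).
Proof.
  intros [t Ht] [u Hu]. exists (Lt t u). split; [constructor|].
  intros e. rewrite Ht, Hu. symmetry. apply standard_lt.
Qed.

Lemma delta0_and P Q : delta0 P -> delta0 Q -> delta0 (fun e => P e /\ Q e).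
Proof.
  intros [p [Dp Hp]] [q [Dq Hq]]. exists (And p q). split; [constructor; auto|].
  intros e. rewrite Hp, Hq. reflexivity.
Qed.

Lemma delta0_or P Q : delta0 P -> delta0 Q -> delta0 (fun e => P e \/ Q e).
Proof.
  intros [p [Dp Hp]] [q [Dq Hq]]. exists (Or p q). split; [constructor; auto|].
  intros e. rewrite Hp, Hq. reflexivity.
Qed.

Lemma delta0_not P : delta0 P -> delta0 (fun e => ~ P e).
Proof.
  intros [p [Dp Hp]]. exists (Neg p). split; [repeat constructor; auto|].
  intros e. rewrite Hp. reflexivity.
Qed.

Lemma delta0_ball t (P : nat -> env -> Prop) : term_function t ->
  delta0 (fun e => P (e 0) (fun n => e (S n))) -> delta0 (fun e => forall x, x < t e -> P x e).
Proof.
  intros [u Hu] [p [Dp Hp]]. exists (BAll u p). split; [constructor; auto|].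
  intros e. rewrite sat_BAll, Hu. setoid_rewrite standard_lt.
  split; intros A x L; apply (Hp (x .: e)), A, L.
Qed.

Lemma delta0_bex t (P : nat -> env -> Prop) : term_function t ->
  delta0 (fun e => P (e 0) (fun n => e (S n))) -> delta0 (fun e => exists x, x < t e /\ P x e).
Proof.
  intros [u Hu] [p [Dp Hp]]. exists (BEx u p). split; [constructor; auto|].
  intros e. rewrite sat_BEx, Hu. setoid_rewrite standard_lt.
  split; intros [x [L A]]; exists x; (split; [exact L|]); apply (Hp (x .: e)), A.
Qed.

(* The bound on the witnesses may be increased freely, which makes the closure properties
   immediate. *)
Definition sigma1 (P : env -> Prop) : Prop :=
  exists Q : nat -> env -> Prop,
    delta0 (fun e => Q (e 0) (fun n => e (S n))) /\
    (forall y z e, y <= z -> Q y e -> Q z e) /\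
    forall e, P e <-> exists y, Q y e.

Lemma sigma1_iff P Q : (forall e, Q e <-> P e) -> sigma1 P -> sigma1 Q.
Proof.
  intros E [W [D [Mn H]]]. exists W. split; [exact D|split; [exact Mn|]].
  intros e. rewrite E; auto.
Qed.

Lemma sigma1_D0 P : delta0 P -> sigma1 P.
Proof.
  intros D. exists (fun _ => P). split; [exact (delta0_rename S D)|]. split; [auto|].
  intros e. split; [intros H; exists 0; exact H|intros [_ H]; exact H].
Qed.

Lemma sigma1_and P Q : sigma1 P -> sigma1 Q -> sigma1 (fun e => P e /\ Q e).
Proof.
  intros [W [D [Mn H]]] [W' [D' [Mn' H']]]. exists (fun y e => W y e /\ W' y e).
  split; [exact (delta0_and D D')|]. split; [intros y z e L []; eauto|].
  intros e. rewrite H, H'. split.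
  - intros [[y A] [z B]]. exists (y + z).
    split; [eapply Mn; [|exact A]|eapply Mn'; [|exact B]]; lia.
  - intros [y []]; eauto.
Qed.

Lemma sigma1_or P Q : sigma1 P -> sigma1 Q -> sigma1 (fun e => P e \/ Q e).
Proof.
  intros [W [D [Mn H]]] [W' [D' [Mn' H']]]. exists (fun y e => W y e \/ W' y e).
  split; [exact (delta0_or D D')|]. split; [intros y z e L []; eauto|].
  intros e. rewrite H, H'. split.
  - intros [[y A]|[y A]]; eauto.
  - intros [y []]; eauto.
Qed.

Lemma delta0_swap (W : nat -> env -> Prop) :
  delta0 (fun e => W (e 0) (fun n => e (S n))) ->
  delta0 (fun e => W (e 1) (e 0 .: (fun n => e (S (S n))))).
Proof.
  intros D. eapply delta0_iff; [|exact (delta0_rename (1 .: 0 .: (fun n => S (S n))) D)].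
  intros e. simpl.
  replace (fun n => e ((0 .: (fun m => S (S m))) n)) with (e 0 .: (fun n => e (S (S n)))).
  - reflexivity.
  - extensionality n; destruct n; reflexivity.
Qed.

Lemma sigma1_ex (P : nat -> env -> Prop) :
  sigma1 (fun e => P (e 0) (fun n => e (S n))) -> sigma1 (fun e => exists x, P x e).
Proof.
  intros [W [D [Mn H]]].
  (* A single [y] bounds both the quantified [x] and the witness for [P]; monotonicity of [W]
     permits the increase. *)
  exists (fun y e => exists x, x < S y /\ W y (x .: e)). split; [|split].
  - apply delta0_bex with (t := fun e => S (e 0))
      (P := fun x e => W (e 0) (x .: (fun n => e (S n)))).
    + apply term_function_succ, term_function_var.
    + apply delta0_swap, D.
  - intros y z e L [x [Lx A]]. exists x. split; [lia|]. eapply Mn; [exact L|exact A].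
  - intros e. split.
    + intros [x A]. apply (H (x .: e)) in A as [y A]. exists (x + y), x. split; [lia|].
      eapply Mn; [|exact A]. lia.
    + intros [y [x [_ A]]]. exists x. apply (H (x .: e)). eauto.
Qed.

Lemma sigma1_ball t (P : nat -> env -> Prop) : term_function t ->
  sigma1 (fun e => P (e 0) (fun n => e (S n))) -> sigma1 (fun e => forall x, x < t e -> P x e).
Proof.
  intros Ht [W [D [Mn H]]].
  exists (fun y e => forall x, x < t e -> W y (x .: e)). split; [|split].
  - apply delta0_ball with (t := fun e => t (fun n => e (S n)))
      (P := fun x e => W (e 0) (x .: (fun n => e (S n)))).
    + apply term_function_rename, Ht.
    + apply delta0_swap, D.
  - intros y z e L A x Lx. eapply Mn; [exact L|auto].
  - intros e. generalize (t e) as k. intros k. split.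
    + intros A. assert (B : forall x, x < k -> exists y, W y (x .: e)).
      { intros x L. apply (H (x .: e)). exact (A x L). }
      clear A. induction k as [|k IH].
      * exists 0. lia.
      * destruct IH as [y Y]; [intros x L; apply B; lia|].
        destruct (B k (Nat.lt_succ_diag_r k)) as [z Z]. exists (y + z). intros x L.
        destruct (Nat.eq_dec x k) as [->|].
        -- eapply Mn; [|exact Z]. lia.
        -- eapply Mn; [|apply Y; lia]. lia.
    + intros [y Y] x L. apply (H (x .: e)). eauto.
Qed.

Lemma sigma1_rename P (r : nat -> nat) : sigma1 P -> sigma1 (fun e => P (fun n => e (r n))).
Proof.
  intros [W [D [Mn H]]]. exists (fun y e => W y (fun n => e (r n))).
  split; [|split].
  - eapply delta0_iff; [|exact (delta0_rename (0 .: (fun n => S (r n))) D)]. reflexivity.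
  - eauto.
  - intros e. apply H.
Qed.

Definition sigma1_function (f : env -> nat) : Prop := sigma1 (fun e => e 0 = f (fun n => e (S n))).

(** ** Recursively enumerable relations on numbers *)

Definition sigma1_set (A : nat -> Prop) : Prop := sigma1 (fun e => A (e 0)).
Definition sigma1_rel (R : nat -> nat -> Prop) : Prop := sigma1 (fun e => R (e 0) (e 1)).
Definition sigma1_rel3 (R : nat -> nat -> nat -> Prop) : Prop :=
  sigma1 (fun e => R (e 0) (e 1) (e 2)).

Lemma sigma1_term_function f : term_function f -> sigma1_function f.
Proof.
  intros F. apply sigma1_D0, delta0_eq; [apply term_function_var|exact (term_function_rename S F)].
Qed.

Lemma sigma1_function_rename f (r : nat -> nat) :
  sigma1_function f -> sigma1_function (fun e => f (fun n => e (r n))).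
Proof. exact (sigma1_rename (0 .: (fun n => S (r n)))). Qed.

Lemma sigma1_app A f : sigma1_set A -> sigma1_function f -> sigma1 (fun e => A (f e)).
Proof.
  intros HA Hf. apply sigma1_iff with (P := fun e => exists x, x = f e /\ A x).
  - intros e; split; [eauto|intros [x [-> H]]; exact H].
  - apply sigma1_ex, sigma1_and; [exact Hf|exact HA].
Qed.

Lemma sigma1_app2 R f g :
  sigma1_rel R -> sigma1_function f -> sigma1_function g -> sigma1 (fun e => R (f e) (g e)).
Proof.
  intros HR Hf Hg. apply sigma1_iff with (P := fun e => exists x y, y = f e /\ x = g e /\ R y x).
  - intros e; split; [eauto|intros [x [y [-> [-> H]]]]; exact H].
  - apply sigma1_ex, sigma1_ex. apply sigma1_and; [|apply sigma1_and; [|exact HR]].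
    + exact (sigma1_rename (0 .: (fun n => S (S n))) Hf).
    + exact (sigma1_rename S Hg).
Qed.

Lemma sigma1_app3 R f g h :
  sigma1_rel3 R -> sigma1_function f -> sigma1_function g -> sigma1_function h ->
  sigma1 (fun e => R (f e) (g e) (h e)).
Proof.
  intros HR Hf Hg Hh.
  apply sigma1_iff with (P := fun e => exists z x y, y = f e /\ x = g e /\ z = h e /\ R y x z).
  - intros e; split; [eauto 7|intros [z [x [y [-> [-> [-> H]]]]]]; exact H].
  - apply sigma1_ex, sigma1_ex, sigma1_ex.
    apply sigma1_and; [|apply sigma1_and; [|apply sigma1_and; [|exact HR]]].
    + exact (sigma1_rename (0 .: (fun n => S (S (S n)))) Hf).
    + exact (sigma1_rename (1 .: (fun n => S (S (S n)))) Hg).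
    + exact (sigma1_rename (2 .: (fun n => S (S (S n)))) Hh).
Qed.

Lemma sigma1_eq f g : sigma1_function f -> sigma1_function g -> sigma1 (fun e => f e = g e).
Proof.
  apply (@sigma1_app2 (fun x y => x = y)). apply sigma1_D0, delta0_eq; apply term_function_var.
Qed.

Lemma sigma1_lt f g : sigma1_function f -> sigma1_function g -> sigma1 (fun e => f e < g e).
Proof.
  apply (@sigma1_app2 (fun x y => x < y)). apply sigma1_D0, delta0_lt; apply term_function_var.
Qed.

Lemma sigma1_graph2 (F : nat -> nat -> nat) f g :
  sigma1_rel3 (fun z x y => z = F x y) -> sigma1_function f -> sigma1_function g ->
  sigma1_function (fun e => F (f e) (g e)).
Proof.
  intros HF Hf Hg. unfold sigma1_function.
  apply (sigma1_app3 (f := fun e => e 0) HF).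
  - apply sigma1_term_function, term_function_var.
  - exact (sigma1_function_rename S Hf).
  - exact (sigma1_function_rename S Hg).
Qed.

Lemma npair_spec a b : npair a b * 2 = b * 2 + (b + a) * S (b + a).
Proof. apply Cantor.to_nat_spec. Qed.

Lemma sigma1_npair f g :
  sigma1_function f -> sigma1_function g -> sigma1_function (fun e => npair (f e) (g e)).
Proof.
  apply sigma1_graph2. unfold sigma1_rel3.
  (* Doubling turns the definition of Cantor's pairing into a polynomial equation. *)
  apply sigma1_iff with
    (P := fun e => e 0 * 2 = e 2 * 2 + (e 2 + e 1) * S (e 2 + e 1)).
  - intros e. rewrite <- npair_spec. lia.
  - apply sigma1_D0, delta0_eq;
      repeat first [apply term_function_var|apply term_function_const|apply term_function_succ
        |apply term_function_plus|apply term_function_mult].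
Qed.

Lemma sigma1_var i : sigma1_function (fun e => e i).
Proof. apply sigma1_term_function, term_function_var. Qed.

Lemma sigma1_const k : sigma1_function (fun _ => k).
Proof. apply sigma1_term_function, term_function_const. Qed.

Lemma sigma1_succ f : sigma1_function f -> sigma1_function (fun e => S (f e)).
Proof.
  intros F. unfold sigma1_function. apply (@sigma1_app2 (fun x y => x = S y) (fun e => e 0)).
  - apply sigma1_D0, delta0_eq; [|apply term_function_succ]; apply term_function_var.
  - apply sigma1_var.
  - exact (sigma1_function_rename S F).
Qed.

Lemma sigma1_unpair f :
  sigma1_function f -> sigma1_function (fun e => fst (Cantor.of_nat (f e))) /\
                   sigma1_function (fun e => snd (Cantor.of_nat (f e))).
Proof.
  intros F. split; unfold sigma1_function.
  - apply sigma1_iff with (P := fun e => exists b, f (fun n => e (S n)) = npair (e 0) b).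
    + intros e. split.
      * intros ->. eexists. unfold npair. rewrite <- surjective_pairing, Cantor.cancel_to_of.
        reflexivity.
      * intros [b ->]. unfold npair. rewrite Cantor.cancel_of_to. reflexivity.
    + apply sigma1_ex, sigma1_eq; [exact (sigma1_function_rename (fun n => S (S n)) F)|].
      apply sigma1_npair; apply sigma1_var.
  - apply sigma1_iff with (P := fun e => exists a, f (fun n => e (S n)) = npair a (e 0)).
    + intros e. split.
      * intros ->. eexists. unfold npair. rewrite <- surjective_pairing, Cantor.cancel_to_of.
        reflexivity.
      * intros [b ->]. unfold npair. rewrite Cantor.cancel_of_to. reflexivity.
    + apply sigma1_ex, sigma1_eq; [exact (sigma1_function_rename (fun n => S (S n)) F)|].
      apply sigma1_npair; apply sigma1_var.
Qed.

Ltac sigma1_tac := cbv beta; lazymatch goal with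
  | |- sigma1_set _ => unfold sigma1_set; sigma1_tac
  | |- sigma1_rel _ => unfold sigma1_rel; sigma1_tac
  | |- sigma1_rel3 _ => unfold sigma1_rel3; sigma1_tac
  | |- sigma1 (fun e => _ /\ _) => apply sigma1_and; sigma1_tac
  | |- sigma1 (fun e => _ \/ _) => apply sigma1_or; sigma1_tac
  | |- sigma1 (fun e => exists x, _) => apply sigma1_ex; sigma1_tac
  | |- sigma1 (fun e => _ = _) => apply sigma1_eq; sigma1_tac
  | |- sigma1 (fun e => _ < _) => apply sigma1_lt; sigma1_tac
  | |- sigma1_function (fun e => e _) => apply sigma1_var
  | |- sigma1_function (fun e => npair _ _) => apply sigma1_npair; sigma1_tac
  | |- sigma1_function (fun _ => ?k) => apply (sigma1_const k)
  | |- sigma1_function (fun e => S _) => apply sigma1_succ; sigma1_tac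
  | |- sigma1_function (fun e => fst (Cantor.of_nat _)) => apply sigma1_unpair; sigma1_tac
  | |- sigma1_function (fun e => snd (Cantor.of_nat _)) => apply sigma1_unpair; sigma1_tac
  | H : sigma1_set ?A |- sigma1 (fun e => ?A _) => apply (sigma1_app H); sigma1_tac
  | H : sigma1_rel ?A |- sigma1 (fun e => ?A _ _) => apply (sigma1_app2 H); sigma1_tac
  | H : sigma1_rel3 ?A |- sigma1 (fun e => ?A _ _ _) => apply (sigma1_app3 H); sigma1_tac
  | |- _ => idtac
  end.

(** ** Inductive definitions *)

(** One shape for all inductive notions below: terms, formulas, graphs of substitution and
    recursion, derivations. Rules with a single premise use it twice. *)
Inductive closure (B : nat -> Prop) (R : nat -> nat -> nat -> Prop) : nat -> Prop :=
| closure_base x : B x -> closure B R x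
| closure_step y z x : closure B R y -> closure B R z -> R y z x -> closure B R x.

(** [N] truncates the coded set, since moduli beyond the range of the coding may divide [c]
    accidentally. *)
Definition member (c d N w : nat) : Prop :=
  w < N /\ divides standard (modulus standard d w) c.

Lemma delta0_member f g h k :
  term_function f -> term_function g -> term_function h -> term_function k ->
  delta0 (fun e => member (f e) (g e) (h e) (k e)).
Proof.
  intros [c Hc] [d Hd] HN [w Hw].
  apply delta0_and; [apply delta0_lt; [exists w; exact Hw|exact HN]|].
  exists (Member c d w). split; [repeat constructor|].
  intros e. rewrite (sat_Member standard_PA), Hc, Hd, Hw. reflexivity.
Qed.

(** A list is defined by a disjunction of equations, to which the set coding in the standard
    structure applies. *)
Lemma member_finite (L : list nat) : exists c d N, forall w, member c d N w <-> In w L.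
Proof.
  set (p := fold_right (fun a p => Or (Eq (Var 0) (numeral a)) p) Bot L).
  assert (P : forall w, @sat standard (w .: fun _ => 0) p <-> In w L).
  { intros w. unfold p. clear p. induction L as [|a L IH]; [reflexivity|].
    cbn [fold_right sat In]. rewrite IH, teval_numeral.
    assert (E : forall a, @num standard a = a) by (intros b; induction b; simpl; congruence).
    rewrite E. simpl. intuition. }
  set (N := S (list_max L)).
  destruct (@pa_code_set standard standard_PA p (fun _ => 0) N) as [c [d [_ [_ C]]]].
  exists c, d, N. intros w. unfold member. split.
  - intros [Lw H]. apply P, C; [apply standard_lt, Lw|exact H].
  - intros I. assert (Lw : w < N).
    { unfold N. assert (A : Forall (fun k => k <= list_max L) L) by (apply list_max_le; lia).
      rewrite Forall_forall in A. specialize (A w I). lia. }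
    split; [exact Lw|]. apply C; [apply standard_lt, Lw|apply P, I].
Qed.

(** A derivation is a finite set instead of a sequence. Each element is paired with a rank above
    those of its premises, which excludes circular justifications. *)
Definition justified (B : nat -> Prop) (R : nat -> nat -> nat -> Prop) (D : nat -> Prop)
    (w : nat) : Prop :=
  exists r x, w = npair r x /\
    (B x \/ exists y z r1 r2, r1 < r /\ r2 < r /\ D (npair r1 y) /\ D (npair r2 z) /\ R y z x).

Lemma closure_of_justified B R D :
  (forall w, D w -> justified B R D w) -> forall r x, D (npair r x) -> closure B R x.
Proof.
  intros J r. induction r as [r IH] using (well_founded_induction lt_wf).
  intros x H. destruct (J _ H) as [r' [x' [E C]]]. apply npair_inj in E as [<- <-].
  destruct C as [C|[y [z [r1 [r2 [L1 [L2 [H1 [H2 C]]]]]]]]].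
  - apply closure_base, C.
  - eapply closure_step; [exact (IH r1 L1 y H1)|exact (IH r2 L2 z H2)|exact C].
Qed.

Lemma justified_of_closure B R x : closure B R x ->
  exists L r, In (npair r x) L /\ forall w, In w L -> justified B R (fun v => In v L) w.
Proof.
  assert (mono : forall (L L' : list nat) w, (forall v, In v L -> In v L') ->
    justified B R (fun v => In v L) w -> justified B R (fun v => In v L') w).
  { intros L L' w I [r [u [E [C|[y [z [r1 [r2 C]]]]]]]]; exists r, u; (split; [exact E|]);
      [left; exact C|right; exists y, z, r1, r2; intuition]. }
  induction 1 as [x Bx|y z x _ [L1 [r1 [I1 J1]]] _ [L2 [r2 [I2 J2]]] Rx].
  - exists [npair 0 x], 0. split; [left; reflexivity|].
    intros w [<-|[]]. exists 0, x. auto.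
  - exists (npair (S (r1 + r2)) x :: L1 ++ L2), (S (r1 + r2)). split; [left; reflexivity|].
    intros w [<-|I].
    + exists (S (r1 + r2)), x. split; [reflexivity|]. right. exists y, z, r1, r2.
      simpl. rewrite !in_app_iff. repeat split; auto; lia.
    + apply in_app_iff in I as [I|I]; [apply (mono L1); [|auto]|apply (mono L2); [|auto]];
        intros v Iv; simpl; rewrite in_app_iff; auto.
Qed.

(** Written with a negated [member] because [sigma1] is not closed under implication; membership is
    [delta0], so its negation is harmless, and the quantifier over [w] is bounded by [N]. *)
Lemma closure_iff B R x : closure B R x <->
  exists c d N r, member c d N (npair r x) /\
    forall w, w < N -> ~ member c d N w \/ justified B R (member c d N) w.
Proof.
  split.
  - intros H. destruct (justified_of_closure H) as [L [r [I J]]].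
    destruct (member_finite L) as [c [d [N C]]]. exists c, d, N, r.
    rewrite C. split; [exact I|]. intros w _.
    replace (member c d N) with (fun v => In v L)
      by (extensionality v; apply propositional_extensionality; symmetry; apply C).
    destruct (classic (In w L)); [right; apply J|left]; assumption.
  - intros [c [d [N [r [I J]]]]]. revert I.
    apply (closure_of_justified (D := member c d N)).
    intros w Hw. destruct (J w (proj1 Hw)); [contradiction|assumption].
Qed.

Lemma sigma1_member : forall f g h k, sigma1_function f -> sigma1_function g -> sigma1_function h ->
  sigma1_function k -> sigma1 (fun e => member (f e) (g e) (h e) (k e)).
Proof.
  intros f g h k Hf Hg Hh Hk.
  apply sigma1_iff with (P := fun e => exists x, x = k e /\ 
    exists y, y = h e /\ exists z, z = g e /\ exists u, u = f e /\ member u z y x).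
  - intros e. split; [eauto 9|]. intros [? [-> [? [-> [? [-> [? [-> H]]]]]]]]. exact H.
  - apply sigma1_ex, sigma1_and; [exact Hk|].
    apply sigma1_ex, sigma1_and; [exact (sigma1_function_rename S Hh)|].
    apply sigma1_ex, sigma1_and; [exact (sigma1_function_rename (fun n => S (S n)) Hg)|].
    apply sigma1_ex, sigma1_and; [exact (sigma1_function_rename (fun n => S (S (S n))) Hf)|].
    apply sigma1_D0, delta0_member; apply term_function_var.
Qed.

Theorem sigma1_closure B R : sigma1_set B -> sigma1_rel3 R -> sigma1_set (closure B R).
Proof.
  intros HB HR. eapply sigma1_iff; [intros e; apply closure_iff|].
  do 4 apply sigma1_ex. apply sigma1_and.
  - apply sigma1_member; sigma1_tac.
  - apply sigma1_ball with (t := fun e => e 1); [apply term_function_var|]. apply sigma1_or.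
    + apply sigma1_D0, delta0_not, delta0_member; apply term_function_var.
    + unfold justified. sigma1_tac; apply sigma1_member; sigma1_tac.
Qed.

(** ** Partial recursive functions *)

(** Every number decodes to a vector of any given length, so quantifiers over vectors become
    quantifiers over numbers with no test for being a code. *)
Fixpoint vdecode (k c : nat) : Vector.t nat k :=
  match k with
  | 0 => Vector.nil nat
  | S k => Vector.cons nat (fst (Cantor.of_nat c)) k (vdecode k (snd (Cantor.of_nat c)))
  end.

Lemma vdecode_npair k a c : vdecode (S k) (npair a c) = Vector.cons nat a k (vdecode k c).
Proof. unfold npair. cbn [vdecode]. rewrite Cantor.cancel_of_to. reflexivity. Qed.

Lemma vdecode_surjective k (v : Vector.t nat k) : exists c, vdecode k c = v.
Proof.
  induction v as [|a k v [c <-]]; [exists 0; reflexivity|].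
  exists (npair a c). apply vdecode_npair.
Qed.

Lemma sigma1_nth k (i : Fin.t k) : forall f, sigma1_function f ->
  sigma1_function (fun e => Vector.nth (vdecode k (f e)) i).
Proof.
  induction i as [k|k i IH]; intros f F; simpl.
  - apply sigma1_unpair, F.
  - apply IH, sigma1_unpair, F.
Qed.

Lemma sigma1_true : sigma1 (fun _ => True).
Proof. apply sigma1_iff with (P := fun _ => 0 = 0); [tauto|]. sigma1_tac. Qed.

Lemma sigma1_forall_fin m (P : Fin.t m -> env -> Prop) :
  (forall i, sigma1 (P i)) -> sigma1 (fun e => forall i, P i e).
Proof.
  induction m as [|m IH]; intros H.
  - apply sigma1_iff with (P := fun _ => True); [|apply sigma1_true].
    intros e; split; [auto|]. intros _ i. apply (Fin.case0 (fun i => P i e)).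
  - apply sigma1_iff with (P := fun e => P Fin.F1 e /\ forall i, P (Fin.FS i) e).
    + intros e; split; [auto|]. intros [H1 H2] i. apply (Fin.caseS' i (fun i => P i e)); auto.
    + apply sigma1_and; [apply H|]. apply (IH (fun i => P (Fin.FS i))). auto.
Qed.

(** The graph is an inductively generated set of triples of recursion argument, parameters and
    value; a step extends the argument by one. *)
Lemma sigma1_primrec k (g : pgraph k) (h : pgraph (S (S k))) :
  sigma1_rel (fun c y => g (vdecode k c) y) ->
  sigma1_rel (fun c y => h (vdecode (S (S k)) c) y) ->
  sigma1_rel3 (fun n c y => primrec_graph g h n (vdecode k c) y).
Proof.
  intros G H.
  set (B w := exists c y, w = npair 0 (npair c y) /\ g (vdecode k c) y).
  set (R u (_ : nat) w := exists m c z y, u = npair m (npair c z) /\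
    w = npair (S m) (npair c y) /\ h (vdecode (S (S k)) (npair m (npair z c))) y).
  assert (E : forall n c y, primrec_graph g h n (vdecode k c) y <->
    closure B R (npair n (npair c y))).
  { intros n c y. split.
    - revert y. induction n as [|n IH]; simpl; intros y.
      + intros P. apply closure_base. exists c, y. auto.
      + intros [z [Z P]]. apply IH in Z. eapply closure_step; [exact Z|exact Z|].
        exists n, c, z, y. rewrite !vdecode_npair. auto.
    - intros C. remember (npair n (npair c y)) as w eqn:W. revert n c y W.
      induction C as [w [c' [y' [-> P]]]|u u' w _ IH _ _ [m [c' [z [y' [-> [-> P]]]]]]];
        intros n c y W; apply npair_inj in W as [<- W]; apply npair_inj in W as [<- <-].
      + exact P.
      + simpl. exists z. split; [apply IH; reflexivity|]. rewrite !vdecode_npair in P. exact P. }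
  assert (SB : sigma1_set B).
  { unfold B. sigma1_tac. apply (sigma1_app2 G); sigma1_tac. }
  assert (SR : sigma1_rel3 R).
  { unfold R. sigma1_tac. apply (sigma1_app2 H); sigma1_tac. }
  pose proof (sigma1_closure SB SR) as C.
  eapply sigma1_iff; [intros e; apply E|]. sigma1_tac.
Qed.

Theorem sigma1_partial_recursive k (f : pgraph k) :
  partial_recursive f -> sigma1_rel (fun c y => f (vdecode k c) y).
Proof.
  induction 1 as [| |k i|k m g f _ IHg _ IHf|k g h _ IHg _ IHh|k f _ IH].
  - sigma1_tac.
  - simpl. sigma1_tac.
  - sigma1_tac. apply sigma1_nth; sigma1_tac.
  - apply sigma1_iff with (P := fun e => exists d,
      (forall i, f i (vdecode k (e 0)) (Vector.nth (vdecode m d) i)) /\ g (vdecode m d) (e 1)).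
    + intros e. split.
      * intros [w W]. destruct (vdecode_surjective w) as [d <-]. eauto.
      * intros [d W]. eauto.
    + sigma1_tac; [|apply (sigma1_app2 IHg); sigma1_tac].
      apply (@sigma1_forall_fin m
        (fun i e => f i (vdecode k (e 1)) (Vector.nth (vdecode m (e 0)) i))).
      intros i. apply (sigma1_app2 (IHf i)); [sigma1_tac|]. apply sigma1_nth; sigma1_tac.
  - pose proof (sigma1_primrec g h IHg IHh) as P. unfold sigma1_rel. simpl.
    apply (@sigma1_app3 _ (fun e => fst (Cantor.of_nat (e 0)))
      (fun e => snd (Cantor.of_nat (e 0))) (fun e => e 1) P); sigma1_tac.
  - apply sigma1_iff with (P := fun e => f (vdecode (S k) (npair (e 1) (e 0))) 0 /\
      forall z, z < e 1 -> exists u, f (vdecode (S k) (npair z (e 0))) (S u)).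
    + intros e. setoid_rewrite vdecode_npair. reflexivity.
    + apply sigma1_and; [apply (sigma1_app2 IH); sigma1_tac|].
      apply sigma1_ball with (t := fun e => e 1); [apply term_function_var|].
      sigma1_tac. apply (sigma1_app2 IH); sigma1_tac.
Qed.

Lemma sigma1_re A : re A -> sigma1_set A.
Proof.
  intros [f [F E]]. eapply sigma1_iff; [intros e; apply E|].
  pose proof (sigma1_partial_recursive F) as P.
  apply sigma1_iff with (P := fun e => exists y, f (vdecode 1 (npair (e 0) 0)) y).
  - intros e. setoid_rewrite vdecode_npair. reflexivity.
  - sigma1_tac. apply (sigma1_app2 P); sigma1_tac.
Qed.

(** ** Arithmetized syntax *)

Definition is_term (w : nat) : Prop := exists t, w = tcode t.
Definition is_form (w : nat) : Prop := exists p, w = code p.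

Lemma sigma1_is_term : sigma1_set is_term.
Proof.
  set (B w := (exists n, w = npair 0 n) \/ w = npair 1 0).
  set (R a b w := w = npair 2 a \/ w = npair 3 (npair a b) \/ w = npair 4 (npair a b)).
  apply sigma1_iff with (P := fun e => closure B R (e 0)).
  - intros e. generalize (e 0). intros w. split.
    + intros [t ->]. induction t; simpl.
      * apply closure_base. left; eauto.
      * apply closure_base. right; reflexivity.
      * eapply closure_step; [exact IHt|exact IHt|]. left; reflexivity.
      * eapply closure_step; [exact IHt1|exact IHt2|]. right; left; reflexivity.
      * eapply closure_step; [exact IHt1|exact IHt2|]. right; right; reflexivity.
    + induction 1 as [w [[n ->]| ->]|a b w _ [t ->] _ [u ->] [->|[->| ->]]].
      * exists (Var n); reflexivity.
      * exists Zero; reflexivity.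
      * exists (Succ t); reflexivity.
      * exists (Plus t u); reflexivity.
      * exists (Mult t u); reflexivity.
  - apply sigma1_closure; unfold B, R; sigma1_tac.
Qed.

Lemma sigma1_is_form : sigma1_set is_form.
Proof.
  pose proof sigma1_is_term as T.
  set (B w := w = npair 0 0 \/ exists t u, is_term t /\ is_term u /\
    (w = npair 1 (npair t u) \/ w = npair 2 (npair t u))).
  set (R a b w := w = npair 3 (npair a b) \/ w = npair 4 (npair a b) \/ w = npair 5 (npair a b)
    \/ w = npair 6 a \/ w = npair 7 a \/ w = npair 8 a).
  apply sigma1_iff with (P := fun e => closure B R (e 0)).
  - intros e. generalize (e 0). intros w. split.
    + intros [p ->]. induction p; simpl;
        try (apply closure_base; right; do 2 eexists;
          split; [eexists; reflexivity|split; [eexists; reflexivity|tauto]]);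
        try (eapply closure_step; [exact IHp1|exact IHp2|unfold R; tauto]);
        try (eapply closure_step; [exact IHp|exact IHp|unfold R; tauto]).
      apply closure_base. left; reflexivity.
    + induction 1 as [w [->|[? [? [[t ->] [[u ->] [->| ->]]]]]]
        |a b w _ [p ->] _ [q ->] [->|[->|[->|[->|[->| ->]]]]]].
      * exists Bot; reflexivity.
      * exists (Eq t u); reflexivity.
      * exists (Le t u); reflexivity.
      * exists (Imp p q); reflexivity.
      * exists (And p q); reflexivity.
      * exists (Or p q); reflexivity.
      * exists (All p); reflexivity.
      * exists (Ex p); reflexivity.
      * exists (Box p); reflexivity.
  - apply sigma1_closure; unfold B, R; sigma1_tac.
Qed.

(* [X] is a class of substitutions [sigma x] closed under [up]. *)
Section Substitution.

Variable X : Type.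
Variable cX : X -> nat.
Variable sigma : X -> nat -> term.
Variable U : X -> X.
Hypothesis cX_inj : forall x y, cX x = cX y -> x = y.
Hypothesis sigma_U : forall x, sigma (U x) = up (sigma x).
Hypothesis sigma1_domain : sigma1_set (fun d => exists x, d = cX x).
Hypothesis sigma1_U : sigma1_rel (fun d d' => exists x, d = cX x /\ d' = cX (U x)).
Hypothesis sigma1_sigma :
  sigma1_rel3 (fun d n m => exists x, d = cX x /\ m = tcode (sigma x n)).

Definition is_tsubst (d a b : nat) : Prop :=
  exists x t, d = cX x /\ a = tcode t /\ b = tcode (tsubst (sigma x) t).

Definition is_subst (d a b : nat) : Prop :=
  exists x p, d = cX x /\ a = code p /\ b = code (subst (sigma x) p).

Lemma sigma1_is_tsubst : sigma1_rel3 is_tsubst.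
Proof.
  set (V d n m := exists x, d = cX x /\ m = tcode (sigma x n)).
  change (sigma1_rel3 V) in sigma1_sigma.
  set (I d := exists x, d = cX x). change (sigma1_set I) in sigma1_domain.
  set (B w := exists d, (exists n m, V d n m /\ w = npair d (npair (npair 0 n) m)) \/
    (I d /\ w = npair d (npair (npair 1 0) (npair 1 0)))).
  set (R y z w := exists d a a' b b', y = npair d (npair a a') /\ z = npair d (npair b b') /\
    (w = npair d (npair (npair 2 a) (npair 2 a')) \/
     w = npair d (npair (npair 3 (npair a b)) (npair 3 (npair a' b'))) \/
     w = npair d (npair (npair 4 (npair a b)) (npair 4 (npair a' b'))))).
  assert (C : sigma1_set (closure B R)) by (apply sigma1_closure; unfold B, R; sigma1_tac).
  apply sigma1_iff with (P := fun e => closure B R (npair (e 0) (npair (e 1) (e 2)))).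
  2: sigma1_tac.
  intros e. generalize (e 0) (e 1) (e 2). intros d a b. split.
  - intros [x [t [-> [-> ->]]]]. induction t; simpl.
    + apply closure_base. exists (cX x). left. exists n. eexists. split; [|reflexivity].
      exists x; auto.
    + apply closure_base. exists (cX x). right. split; [exists x|]; reflexivity.
    + eapply closure_step; [exact IHt|exact IHt|]. do 5 eexists. eauto 6.
    + eapply closure_step; [exact IHt1|exact IHt2|]. do 5 eexists. eauto 6.
    + eapply closure_step; [exact IHt1|exact IHt2|]. do 5 eexists. eauto 6.
  - intros H. remember (npair d (npair a b)) as w eqn:W. revert d a b W.
    induction H as [w [d' [[n [m [[x [-> ->]] ->]]]|[[x ->] ->]]]
      |y z w _ IH1 _ IH2 [d' [a1 [a1' [b1 [b1' [-> [-> H]]]]]]]]; intros d a b W.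
    + apply npair_inj in W as [<- W]. apply npair_inj in W as [<- <-].
      exists x, (Var n). auto.
    + apply npair_inj in W as [<- W]. apply npair_inj in W as [<- <-].
      exists x, Zero. auto.
    + destruct (IH1 _ _ _ eq_refl) as [x [t [-> [-> ->]]]].
      destruct (IH2 _ _ _ eq_refl) as [x' [u [E [-> ->]]]]. apply cX_inj in E as <-.
      destruct H as [->|[->| ->]]; apply npair_inj in W as [<- W]; apply npair_inj in W as [<- <-].
      * exists x, (Succ t). auto.
      * exists x, (Plus t u). auto.
      * exists x, (Mult t u). auto.
Qed.

Lemma sigma1_is_subst : sigma1_rel3 is_subst.
Proof.
  pose proof sigma1_is_tsubst as T.
  set (N d d' := exists x, d = cX x /\ d' = cX (U x)). change (sigma1_rel N) in sigma1_U.
  set (I d := exists x, d = cX x). change (sigma1_set I) in sigma1_domain.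
  set (B w := exists d, (I d /\ w = npair d (npair (npair 0 0) (npair 0 0))) \/
    exists a a' b b', is_tsubst d a a' /\ is_tsubst d b b' /\
      (w = npair d (npair (npair 1 (npair a b)) (npair 1 (npair a' b'))) \/
       w = npair d (npair (npair 2 (npair a b)) (npair 2 (npair a' b'))))).
  set (R y z w := exists d a a' b b',
    (y = npair d (npair a a') /\ z = npair d (npair b b') /\
      (w = npair d (npair (npair 3 (npair a b)) (npair 3 (npair a' b'))) \/
       w = npair d (npair (npair 4 (npair a b)) (npair 4 (npair a' b'))) \/
       w = npair d (npair (npair 5 (npair a b)) (npair 5 (npair a' b'))) \/
       w = npair d (npair (npair 8 a) (npair 8 a')))) \/
    (* Under a binder the premise is about the substitution [up (sigma x)], which has its own index
       in the class. *)
    (exists d', N d d' /\ y = npair d' (npair a a') /\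
      (w = npair d (npair (npair 6 a) (npair 6 a')) \/
       w = npair d (npair (npair 7 a) (npair 7 a'))))).
  assert (C : sigma1_set (closure B R)) by (apply sigma1_closure; unfold B, R; sigma1_tac).
  apply sigma1_iff with (P := fun e => closure B R (npair (e 0) (npair (e 1) (e 2)))).
  2: sigma1_tac.
  intros e. generalize (e 0) (e 1) (e 2). intros d a b. split.
  - intros [x [p [-> [-> ->]]]]. revert x. induction p; intros x; simpl.
    1: apply closure_base; exists (cX x); left; split; [exists x|]; reflexivity.
    1, 2: apply closure_base; exists (cX x); right; do 4 eexists;
      split; [exists x, t; auto|split; [exists x, u; auto|auto]].
    1-3: eapply closure_step; [apply IHp1|apply IHp2|]; do 5 eexists; left; eauto 8.
    1, 2: eapply closure_step; [apply (IHp (U x))|apply (IHp (U x))|];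
      exists (cX x); do 2 eexists; exists 0, 0; right; exists (cX (U x));
      (split; [exists x; auto|split; [reflexivity|rewrite sigma_U; auto]]).
    eapply closure_step; [apply IHp|apply IHp|]; do 5 eexists; left; eauto 8.
  - intros H. remember (npair d (npair a b)) as w eqn:W. revert d a b W.
    induction H as [w [d' [[[x ->] ->]
        |[a1 [a1' [b1 [b1' [[x [t [-> [-> ->]]]] [[x' [u [E [-> ->]]]] H]]]]]]]]
      |y z w _ IH1 _ IH2 [d' [a1 [a1' [b1 [b1' [[-> [-> H]]|[d2 [[x [-> ->]] [-> H]]]]]]]]]];
      intros d a b W.
    + apply npair_inj in W as [<- W]. apply npair_inj in W as [<- <-]. exists x, Bot. auto.
    + apply cX_inj in E as <-.
      destruct H as [->| ->]; apply npair_inj in W as [<- W]; apply npair_inj in W as [<- <-].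
      * exists x, (Eq t u). auto.
      * exists x, (Le t u). auto.
    + destruct (IH1 _ _ _ eq_refl) as [x [p [-> [-> ->]]]].
      destruct (IH2 _ _ _ eq_refl) as [x' [q [E [-> ->]]]]. apply cX_inj in E as <-.
      destruct H as [->|[->|[->| ->]]];
        apply npair_inj in W as [<- W]; apply npair_inj in W as [<- <-].
      * exists x, (Imp p q). auto.
      * exists x, (And p q). auto.
      * exists x, (Or p q). auto.
      * exists x, (Box p). auto.
    + destruct (IH1 _ _ _ eq_refl) as [x' [p [E [-> ->]]]]. apply cX_inj in E as <-.
      destruct H as [->| ->]; apply npair_inj in W as [<- W]; apply npair_inj in W as [<- <-].
      * exists x, (All p). split; [reflexivity|]. simpl. rewrite sigma_U. auto.
      * exists x, (Ex p). split; [reflexivity|]. simpl. rewrite sigma_U. auto.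
Qed.

End Substitution.

(** [shift] pushed under [k] binders: the smallest class containing [shift] and closed under
    [up]. *)
Definition shift_at (k n : nat) : term := if n <? k then Var n else Var (S n).

Lemma shift_at_0 : shift_at 0 = shift.
Proof. reflexivity. Qed.

Lemma shift_at_S k : shift_at (S k) = up (shift_at k).
Proof.
  extensionality n. destruct n as [|n]; [reflexivity|]. unfold shift_at; simpl.
  change (S n <? S k) with (n <? k). destruct (n <? k); reflexivity.
Qed.

Lemma sigma1_shift_at :
  sigma1_rel3 (fun d n m => exists x : nat, d = x /\ m = tcode (shift_at x n)).
Proof.
  apply sigma1_iff with (P := fun e => (e 1 < e 0 /\ e 2 = npair 0 (e 1)) \/
    (e 0 < S (e 1) /\ e 2 = npair 0 (S (e 1)))).
  - intros e. unfold shift_at. split.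
    + intros [x [<- ->]]. destruct (Nat.ltb_spec (e 1) (e 0)); [left|right]; auto with arith.
    + intros H. exists (e 0). split; [reflexivity|].
      destruct (Nat.ltb_spec (e 1) (e 0)); destruct H as [[L ->]|[L ->]]; auto; lia.
  - sigma1_tac.
Qed.

Lemma sigma1_shift_domain : sigma1_set (fun d => exists x : nat, d = x).
Proof. sigma1_tac. Qed.

Lemma sigma1_shift_next : sigma1_rel (fun d d' => exists x : nat, d = x /\ d' = S x).
Proof. sigma1_tac. Qed.

Lemma sigma1_lift : sigma1_rel (fun a b => exists p, a = code p /\ b = code (lift p)).
Proof.
  pose proof (@sigma1_is_subst nat (fun x => x) shift_at S (fun _ _ E => E) shift_at_S
    sigma1_shift_domain sigma1_shift_next sigma1_shift_at) as H.
  eapply sigma1_iff; [|apply (@sigma1_app3 _ (fun _ => 0) (fun e => e 0) (fun e => e 1) H);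
    sigma1_tac].
  intros e. unfold lift. rewrite <- shift_at_0. split.
  - intros [p [E1 E2]]. exists 0, p. auto.
  - intros [x [p [<- [E1 E2]]]]. exists p. auto.
Qed.

Lemma sigma1_tlift : sigma1_rel (fun a b => exists t, a = tcode t /\ b = tcode (tlift t)).
Proof.
  pose proof (@sigma1_is_tsubst nat (fun x => x) shift_at (fun _ _ E => E)
    sigma1_shift_domain sigma1_shift_at) as H.
  eapply sigma1_iff; [|apply (@sigma1_app3 _ (fun _ => 0) (fun e => e 0) (fun e => e 1) H);
    sigma1_tac].
  intros e. unfold tlift. rewrite <- shift_at_0. split.
  - intros [p [E1 E2]]. exists 0, p. auto.
  - intros [x [p [<- [E1 E2]]]]. exists p. auto.
Qed.

(** The instantiation [scons t Var] pushed under [fst x] binders; [snd x] is the term already lifted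
    past them. *)
Definition inst_at (x : nat * term) (n : nat) : term :=
  if n <? fst x then Var n else if n =? fst x then snd x else Var (n - 1).

Definition inst_code (x : nat * term) : nat := npair (fst x) (tcode (snd x)).

Definition inst_up (x : nat * term) : nat * term := (S (fst x), tlift (snd x)).

Lemma inst_code_inj x y : inst_code x = inst_code y -> x = y.
Proof.
  destruct x, y. intros E. apply npair_inj in E as [E1 E2]. simpl in *.
  apply tcode_inj in E2. congruence.
Qed.

Lemma inst_at_0 t : inst_at (0, t) = scons t Var.
Proof.
  extensionality n. destruct n as [|n]; [reflexivity|]. unfold inst_at; simpl.
  rewrite Nat.sub_0_r. reflexivity.
Qed.

Lemma inst_at_up x : inst_at (inst_up x) = up (inst_at x).
Proof.
  extensionality n. destruct x as [k t], n as [|n]; [reflexivity|]. unfold inst_at; simpl.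
  change (S n <? S k) with (n <? k). destruct (Nat.ltb_spec n k); [reflexivity|].
  destruct (Nat.eqb_spec n k); [reflexivity|]. simpl. unfold shift. f_equal. lia.
Qed.

Lemma sigma1_inst :
  sigma1_rel3 (fun a b c => exists t p, a = tcode t /\ b = code p /\ c = code (inst t p)).
Proof.
  pose proof sigma1_is_term as T. pose proof sigma1_tlift as L.
  set (Lift a b := exists t, a = tcode t /\ b = tcode (tlift t)) in L.
  assert (H1 : sigma1_set (fun d => exists x, d = inst_code x)).
  { apply sigma1_iff with (P := fun e => exists k a, is_term a /\ e 0 = npair k a); [|sigma1_tac].
    intros e. split.
    - intros [[k t] ->]. exists k, (tcode t). split; [exists t|]; reflexivity.
    - intros [k [a [[t ->] ->]]]. exists (k, t). reflexivity. }
  assert (H2 : sigma1_rel (fun d d' => exists x, d = inst_code x /\ d' = inst_code (inst_up x))).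
  { apply sigma1_iff with (P := fun e => exists k a b, Lift a b /\ e 0 = npair k a /\
      e 1 = npair (S k) b); [|sigma1_tac].
    intros e. split.
    - intros [[k t] [-> ->]]. exists k, (tcode t), (tcode (tlift t)).
      split; [exists t|]; auto.
    - intros [k [a [b [[t [-> ->]] [-> ->]]]]]. exists (k, t). auto. }
  assert (H3 : sigma1_rel3 (fun d n m => exists x, d = inst_code x /\ m = tcode (inst_at x n))).
  { apply sigma1_iff with (P := fun e => exists k a, is_term a /\ e 0 = npair k a /\
      ((e 1 < k /\ e 2 = npair 0 (e 1)) \/ (e 1 = k /\ e 2 = a) \/
       exists n, e 1 = S n /\ k < e 1 /\ e 2 = npair 0 n)); [|sigma1_tac].
    intros e. unfold inst_at. split.
    - intros [[k t] [-> ->]]. exists k, (tcode t). split; [exists t; reflexivity|].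
      split; [reflexivity|]. simpl. destruct (Nat.ltb_spec (e 1) k); [auto|].
      destruct (Nat.eqb_spec (e 1) k); [auto|]. right; right. exists (e 1 - 1).
      split; [lia|]. split; [lia|reflexivity].
    - intros [k [a [[t ->] [-> H]]]]. exists (k, t). split; [reflexivity|]. simpl.
      destruct H as [[L1 ->]|[[E ->]|[n [E [L1 ->]]]]].
      + destruct (Nat.ltb_spec (e 1) k); [reflexivity|lia].
      + rewrite E, Nat.ltb_irrefl, Nat.eqb_refl. reflexivity.
      + destruct (Nat.ltb_spec (e 1) k); [lia|]. destruct (Nat.eqb_spec (e 1) k); [lia|].
        rewrite E. simpl. rewrite Nat.sub_0_r. reflexivity. }
  pose proof (@sigma1_is_subst _ inst_code inst_at inst_up inst_code_inj inst_at_up H1 H2 H3) as H.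
  eapply sigma1_iff; [|apply (@sigma1_app3 _ (fun e => npair 0 (e 0)) (fun e => e 1)
    (fun e => e 2) H); sigma1_tac].
  intros e. unfold inst. split.
  - intros [t [p [E1 [E2 E3]]]]. exists (0, t), p. rewrite inst_at_0, E1. auto.
  - intros [[k t] [p [E [E2 E3]]]]. apply npair_inj in E as [E1 E]. simpl in E1, E. subst k.
    rewrite inst_at_0 in E3. exists t, p. auto.
Qed.

Lemma sigma1_numeral : sigma1_rel (fun n a => a = tcode (numeral n)).
Proof.
  set (B w := w = npair 0 (npair 1 0)).
  set (R u (_ : nat) w := exists n a, u = npair n a /\ w = npair (S n) (npair 2 a)).
  assert (C : sigma1_set (closure B R)) by (apply sigma1_closure; unfold B, R; sigma1_tac).
  apply sigma1_iff with (P := fun e => closure B R (npair (e 0) (e 1))); [|sigma1_tac].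
  intros e. generalize (e 0) (e 1). intros n a. split.
  - intros ->. induction n as [|n IH]; simpl.
    + apply closure_base. reflexivity.
    + eapply closure_step; [exact IH|exact IH|]. do 2 eexists. eauto.
  - intros H. remember (npair n a) as w eqn:W. revert n a W.
    induction H as [w ->|u u' w _ IH _ _ [m [b [-> ->]]]]; intros n a W;
      apply npair_inj in W as [<- <-]; [reflexivity|].
    simpl. rewrite (IH _ _ eq_refl). reflexivity.
Qed.

Local Notation cImp a b := (npair 3 (npair a b)).
Local Notation cAnd a b := (npair 4 (npair a b)).
Local Notation cOr a b := (npair 5 (npair a b)).
Local Notation cAll a := (npair 6 a).
Local Notation cEx a := (npair 7 a).

Lemma sigma1_logical_axiom : sigma1_set (fun w => exists p, logical_axiom p /\ w = code p).
Proof.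
  pose proof sigma1_is_term as T. pose proof sigma1_is_form as F.
  pose proof sigma1_lift as L. pose proof sigma1_inst as I.
  set (Lift a b := exists p, a = code p /\ b = code (lift p)) in L.
  set (Inst a b c := exists t p, a = tcode t /\ b = code p /\ c = code (inst t p)) in I.
  apply sigma1_iff with (P := fun e => 
    (exists p q r, is_form p /\ is_form q /\ is_form r /\
      (e 0 = cImp p (cImp q p) \/
       e 0 = cImp (cImp p (cImp q r)) (cImp (cImp p q) (cImp p r)) \/
       e 0 = cImp (cImp (cImp p (npair 0 0)) (npair 0 0)) p \/
       e 0 = cImp p (cImp q (cAnd p q)) \/
       e 0 = cImp (cAnd p q) p \/
       e 0 = cImp (cAnd p q) q \/
       e 0 = cImp p (cOr p q) \/
       e 0 = cImp q (cOr p q) \/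
       e 0 = cImp (cImp p r) (cImp (cImp q r) (cImp (cOr p q) r)) \/
       e 0 = cImp (cAll (cImp p q)) (cImp (cAll p) (cAll q)))) \/
    (exists t p p', Inst t p p' /\ (e 0 = cImp (cAll p) p' \/ e 0 = cImp p' (cEx p))) \/
    (exists p q q', is_form p /\ Lift q q' /\
      (e 0 = cImp q (cAll q') \/ e 0 = cImp (cAll (cImp p q')) (cImp (cEx p) q))) \/
    (exists t, is_term t /\ e 0 = npair 1 (npair t t)) \/
    (exists p t u p' p'', Inst t p p' /\ Inst u p p'' /\
      e 0 = cImp (npair 1 (npair t u)) (cImp p' p''))); [|sigma1_tac].
  intros e. generalize (e 0). intros w. split.
  - intros [p [A ->]]. destruct A.
    1-9, 11: left; first [exists (code p), (code q), (code r)
      |exists (code p), (code q), (code p)|exists (code p), (code p), (code p)];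
      (split; [eexists; reflexivity|split; [eexists; reflexivity|split; [eexists; reflexivity|]]]);
      simpl; tauto.
    1, 3: right; left; exists (tcode t), (code p), (code (inst t p));
      (split; [exists t, p; auto|simpl; tauto]).
    1, 2: right; right; left.
    + exists (code p), (code p), (code (lift p)). split; [eexists; reflexivity|].
      split; [exists p; auto|simpl; tauto].
    + exists (code p), (code q), (code (lift q)). split; [eexists; reflexivity|].
      split; [exists q; auto|simpl; tauto].
    + right; right; right; left. exists (tcode t). split; [eexists; reflexivity|reflexivity].
    + right; right; right; right.
      exists (code p), (tcode t), (tcode u), (code (inst t p)), (code (inst u p)).
      split; [exists t, p; auto|]. split; [exists u, p; auto|reflexivity].
  - intros [[? [? [? [[p ->] [[q ->] [[r ->] H]]]]]]
      |[[? [? [? [[t [p [-> [-> ->]]]] H]]]]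
      |[[? [? [? [[p ->] [[q [-> ->]] H]]]]]
      |[[? [[t ->] ->]]
      |[? [? [? [? [? [[t [p [-> [-> ->]]]] [[u [p' [-> [E ->]]]] ->]]]]]]]]]]].
    + repeat match type of H with _ \/ _ => destruct H as [->|H] end; [..|subst w];
        eexists; (split; [constructor|reflexivity]).
    + destruct H as [->| ->]; eexists.
      * split; [apply ax_all_elim|reflexivity].
      * split; [apply ax_ex_intro|reflexivity].
    + destruct H as [->| ->]; eexists.
      * split; [apply ax_all_vacuous|reflexivity].
      * split; [apply ax_ex_elim|reflexivity].
    + eexists. split; [apply ax_eq_refl|reflexivity].
    + apply code_inj in E as <-. eexists. split; [apply ax_eq_subst|reflexivity].
Qed.

Theorem sigma1_provable T : re_theory T ->
  sigma1_set (fun w => exists p, w = code p /\ proves T p).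
Proof.
  intros R. apply sigma1_re in R.
  pose proof sigma1_logical_axiom as L.
  set (Ax w := exists p, T p /\ code p = w) in R.
  set (Lg w := exists p, logical_axiom p /\ w = code p) in L.
  set (B w := Ax w \/ Lg w).
  set (Rule u v w := u = cImp v w \/ w = cAll u \/ w = npair 8 u).
  apply sigma1_iff with (P := fun e => closure B Rule (e 0)).
  2: { apply sigma1_closure; unfold B, Rule; sigma1_tac. }
  intros e. generalize (e 0). intros w. split.
  - intros [p [-> H]]. induction H as [p H|p H|p q _ IH _ IH'|p _ IH|p _ IH].
    + apply closure_base. left. exists p; auto.
    + apply closure_base. right. exists p; auto.
    + eapply closure_step; [exact IH|exact IH'|]. left; reflexivity.
    + eapply closure_step; [exact IH|exact IH|]. right; left; reflexivity.
    + eapply closure_step; [exact IH|exact IH|]. right; right; reflexivity.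
  - induction 1 as [w [[p [H <-]]|[p [H ->]]]|u v w _ [p [-> H]] _ [q [-> H']] [E|[->| ->]]].
    + exists p. split; [reflexivity|apply pr_axiom, H].
    + exists p. split; [reflexivity|apply pr_logic, H].
    + destruct p; simpl in E; apply npair_inj in E as [E1 E]; try discriminate E1.
      apply npair_inj in E as [E <-]. apply code_inj in E as ->.
      eexists. split; [reflexivity|]. eapply pr_mp; eassumption.
    + exists (All p). split; [reflexivity|apply pr_gen, H].
    + exists (Box p). split; [reflexivity|apply pr_nec, H].
Qed.

(* The self-application predicate behind the fixed points. *)
Lemma sigma1_provable_instance T : re_theory T ->
  sigma1_rel (fun n c => exists p, c = code p /\ proves T (inst (numeral n) p)).
Proof.
  intros R. pose proof (sigma1_provable R) as P. pose proof sigma1_numeral as N.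
  pose proof sigma1_inst as I.
  set (Num n a := a = tcode (numeral n)) in N.
  set (Inst a b c := exists t p, a = tcode t /\ b = code p /\ c = code (inst t p)) in I.
  set (Pr w := exists p, w = code p /\ proves T p) in P.
  apply sigma1_iff with (P := fun e => exists a b, Num (e 0) a /\ Inst a (e 1) b /\ Pr b);
    [|sigma1_tac].
  intros e. generalize (e 0) (e 1). intros n c. split.
  - intros [p [-> H]]. exists (tcode (numeral n)), (code (inst (numeral n) p)).
    split; [reflexivity|]. split; [do 2 eexists; eauto|]. eexists; eauto.
  - intros [a [b [-> [[t [p [E [-> ->]]]] [q [E' H]]]]]].
    apply tcode_inj in E as <-. apply code_inj in E' as <-. eauto.
Qed.

(** * Instances at numerals and finite disjunctions *)

Lemma inst_closed c p : bounded 1 p -> inst (numeral c) p = numsubst (c .: fun _ => 0) p.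
Proof.
  intros B. eapply subst_agree; [exact B|]. intros [|n] L; [reflexivity|lia].
Qed.

Lemma sentence_inst_numeral c p : bounded 1 p -> sentence (inst (numeral c) p).
Proof.
  intros B. eapply bounded_subst; [exact B|]. intros [|n] L; [apply tbounded_numeral|lia].
Qed.

(** Extracts a syntactic [Delta0] matrix: the witness is variable 0, the argument variable 1, and
    leftover parameters are set to 0. *)
Lemma sigma1_set_formula A : sigma1_set A ->
  exists q, Delta0 q /\ bounded 2 q /\
    forall c, A c <-> exists y, @sat standard (y .: c .: fun _ => 0) q.
Proof.
  intros [W [[p [Dp Hp]] [_ H]]].
  exists (subst (scons (Var 0) (scons (Var 1) (fun _ => Zero))) p). split; [|split].
  - apply Delta0_subst, Dp.
  - destruct (bounded_exists p) as [k B]. eapply bounded_subst; [exact B|].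
    intros [|[|n]] _; simpl; auto.
  - intros c. rewrite (H (c .: fun _ => 0)). split; intros [y Y]; exists y.
    + rewrite (sat_subst (pa_box_subst standard_PA)), !teval_scons.
      apply (Hp (y .: c .: fun _ => 0)). exact Y.
    + rewrite (sat_subst (pa_box_subst standard_PA)), !teval_scons in Y.
      apply (Hp (y .: c .: fun _ => 0)) in Y. exact Y.
Qed.

Section Main.

Variable T : theory.
Hypothesis T_ext : extends T PA_K.

Fixpoint instances (p : form) (n : nat) : form :=
  match n with
  | 0 => Bot
  | S m => Or (instances p m) (inst (numeral m) p)
  end.

Lemma sat_instances M (HM : model T M) (e : nat -> M) p n :
  sat e (instances p n) <-> exists k, k < n /\ sat (num k .: e) p.
Proof.
  induction n as [|n IH]; simpl.
  - split; [tauto|intros [k []]; lia].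
  - rewrite IH, (sat_inst (model_box_subst HM)), teval_numeral. split.
    + intros [[k [L S]]|S]; [exists k|exists n]; auto.
    + intros [k [L S]]. destruct (Nat.eq_dec k n) as [->|]; [right; exact S|].
      left. exists k. split; [lia|exact S].
Qed.

(** A finite disjunction of boxes is Delta0(Box) without being a box; this is what the first
    disjunction property is for. *)
Lemma DP_instances p n : has_DP Delta0_Box T -> ClassB p -> bounded 1 p ->
  proves T (instances p n) -> exists k, proves T (inst (numeral k) p).
Proof.
  intros DP [q] B. induction n as [|n IH]; simpl; intros H.
  (* The empty disjunction is [Bot]: here [T] is inconsistent and proves every instance. *)
  - exists 0. revert H. apply (proves_entails T_ext). intros M HM e [].
  - apply DP in H as [H|H]; eauto.
    + clear. induction n as [|n IH]; simpl; [apply D0B_base, D0_bot|].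
      apply D0B_or; [exact IH|apply D0B_B; constructor].
    + clear - B. induction n; simpl; [exact I|]. split; [exact IHn|].
      apply sentence_inst_numeral, B.
    + apply D0B_B; constructor.
    + apply sentence_inst_numeral, B.
Qed.

(** ** From the disjunction properties to [B]-EP *)

Section Fixed_points.

Variable phi : form.
Hypothesis phi_bounded : bounded 1 phi.
Variables qA qB : form.
Hypotheses (qA_Delta0 : Delta0 qA) (qB_Delta0 : Delta0 qB).
Hypotheses (qA_bounded : bounded 2 qA) (qB_bounded : bounded 2 qB).

(** Places [q] inside the bounded quantifier: variable 0 is the inner bound one, and the outer
    witness at index 1 is skipped. *)
Let under (q : form) : form := subst (scons (Var 0) (fun n => Var (2 + n))) q.

(* With [qA x] and [qB x] for "x witnesses the provability of A (of B)":
   A says that [phi] or a proof of B occurs no later than all proofs of A, and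
   B that a proof of A occurs before all proofs of B. *)
Let psiA : form :=
  Ex (And (Or (Box phi) qB) (BAll (Var 0) (Neg (under qA)))).
Let psiB : form :=
  Ex (And qA (BAll (Succ (Var 0)) (Neg (under qB)))).

(** Simultaneous diagonalization: [psiA] and [psiB] share one free variable, [A] and [B] are their
    instances at [c], and [qA], [qB] say of [c] that the first or second formula it codes is
    provable at [c] itself. The self-reference is literal, with no equivalence to be proved in
    [T]. *)
Let c : nat := npair (code psiA) (code psiB).
Let v : nat -> nat := c .: fun _ => 0.

Let A : form := numsubst v psiA.
Let B : form := numsubst v psiB.

Hypothesis qA_spec : proves T A <-> exists y, @sat standard (y .: v) qA.
Hypothesis qB_spec : proves T B <-> exists y, @sat standard (y .: v) qB.

Lemma sat_under M (HM : model T M) (e : nat -> M) y x q :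
  sat (y .: x .: e) (under q) <-> sat (y .: e) q.
Proof.
  unfold under. rewrite (sat_subst (model_box_subst HM)), teval_scons. reflexivity.
Qed.

Lemma sat_psiA M (HM : model T M) (e : nat -> M) :
  sat e psiA <-> exists x, (box (x .: e) phi \/ sat (x .: e) qB) /\
    forall y, lt y x -> ~ sat (y .: e) qA.
Proof.
  unfold psiA, Neg. cbn [sat]. setoid_rewrite sat_BAll. cbn [sat].
  setoid_rewrite (sat_under HM). reflexivity.
Qed.

Lemma sat_psiB M (HM : model T M) (e : nat -> M) :
  sat e psiB <-> exists x, sat (x .: e) qA /\
    forall y, lt y (succ x) -> ~ sat (y .: e) qB.
Proof.
  unfold psiB, Neg. cbn [sat]. setoid_rewrite sat_BAll. cbn [sat].
  setoid_rewrite (sat_under HM). reflexivity.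
Qed.

Lemma sat_witness M (HM : model T M) q y : Delta0 q ->
  sat (num y .: (fun n => @num M (v n))) q <-> @sat standard (y .: v) q.
Proof.
  intros D. rewrite num_econs. apply (Delta0_absolute (model_PA T_ext HM) D (y .: v)).
Qed.

Lemma sentence_numsubst p : bounded 1 p -> sentence (numsubst v p).
Proof.
  intros Bp. unfold v. rewrite <- inst_closed by exact Bp. apply sentence_inst_numeral, Bp.
Qed.

Lemma under_bounded q : bounded 2 q -> bounded 3 (under q).
Proof.
  intros Bq. eapply bounded_subst; [exact Bq|]. intros [|[|n]] L; simpl; lia.
Qed.

Lemma psiA_bounded : bounded 1 psiA.
Proof.
  pose proof (under_bounded _ qA_bounded). simpl. repeat split; auto; try lia.
  eapply bounded_le; [|exact phi_bounded]. lia.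
Qed.

Lemma psiB_bounded : bounded 1 psiB.
Proof. pose proof (under_bounded _ qB_bounded). simpl. repeat split; auto; lia. Qed.

Lemma Sigma1_Box_A : Sigma1_Box A.
Proof.
  unfold A, numsubst. set (s := fun n => numeral (v n)).
  change (Sigma1_Box (Ex (And (Or (Box (subst (up s) phi)) (subst (up s) qB))
    (subst (up s) (BAll (Var 0) (Neg (under qA))))))).
  apply S1B_ex, S1B_and; [apply S1B_or; [apply S1B_B; constructor|]|];
    apply S1B_base, S1_base, Delta0_subst; [exact qB_Delta0|].
  apply D0_ball, D0_imp; [apply Delta0_subst, qA_Delta0|constructor].
Qed.

Lemma Sigma1_B : Sigma1 B.
Proof.
  unfold B, numsubst. set (s := fun n => numeral (v n)).
  change (Sigma1 (Ex (subst (up s) (And qA (BAll (Succ (Var 0)) (Neg (under qB))))))).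
  apply S1_ex, S1_base, Delta0_subst, D0_and; [exact qA_Delta0|].
  apply D0_ball, D0_imp; [apply Delta0_subst, qB_Delta0|constructor].
Qed.

(* If both A and B fail, then no number witnesses the provability of A, by induction. *)
Lemma proves_A_or_B : proves T (Ex (Box phi)) -> proves T (Or A B).
Proof.
  intros H. change (proves T (numsubst v (Or psiA psiB))).
  apply (proves_numsubst T_ext). intros M HM. pose proof (model_PA T_ext HM) as PA.
  set (e := fun n => @num M (v n)).
  apply NNPP; intros N.
  assert (NA : ~ sat e psiA) by (intros S; apply N; left; exact S).
  assert (NB : ~ sat e psiB) by (intros S; apply N; right; exact S).
  rewrite (sat_psiA HM) in NA. rewrite (sat_psiB HM) in NB.
  assert (I : forall z, sat (z .: e) (BAll (Var 0) (Neg (under qA)))).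
  { apply (pa_induction PA).
    - rewrite sat_BAll. intros y L. destruct (pa_lt_zero PA L).
    - intros z IH. rewrite sat_BAll in *. unfold Neg in *. cbn [sat] in *.
      intros y L. rewrite (sat_under HM). apply (pa_lt_succ_cases PA) in L as [L| ->].
      + specialize (IH y L). rewrite (sat_under HM) in IH. exact IH.
      + intros Q. apply NB. exists z. split; [exact Q|]. intros x L Qx.
        apply NA. exists x. split; [right; exact Qx|]. intros y Ly.
        specialize (IH y (pa_lt_le_trans PA Ly L)). rewrite (sat_under HM) in IH. exact IH. }
  destruct (model_sound HM H e) as [x X]. apply NA. exists x. split; [left; exact X|].
  intros y L. specialize (I x). rewrite sat_BAll in I. specialize (I y L).
  unfold Neg in I; cbn [sat] in I. rewrite (sat_under HM) in I. exact I.
Qed.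

(** Take an actual proof [j] of [B]. If a proof of [A] lies below it, there is nothing left to show;
    otherwise [A] is witnessed by [j], and this finite check is valid in all models. *)
Lemma proves_A_of_B : proves T B -> proves T A.
Proof.
  intros HB. apply qB_spec in HB as [j J].
  destruct (classic (exists y, y < j /\ @sat standard (y .: v) qA)) as [[y [_ Y]]|N].
  - apply qA_spec. eauto.
  - apply (proves_numsubst T_ext). intros M HM. rewrite (sat_psiA HM).
    exists (num j). split; [right; apply (sat_witness HM); assumption|].
    intros y L. apply (lt_num (model_PA T_ext HM)) in L as [i [L ->]].
    rewrite (sat_witness HM) by assumption. eauto.
Qed.

(** The least proof [k] of [A] bounds the witness [x] that [A] provides in any model, so [x] is a
    numeral. The alternative that [x] proves [B] must then be excluded, using [B] itself. *)
Lemma proves_instances_of_A : proves T A -> exists n, proves T (instances (Box phi) n).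
Proof.
  intros HA.
  assert (K : exists k, @sat standard (k .: v) qA /\
    forall i, i < k -> ~ @sat standard (i .: v) qA).
  { apply qA_spec in HA as [y Y].
    destruct (@pa_least standard standard_PA qA v y Y) as [k [K L]]. exists k. split; [exact K|].
    intros i Li. apply L, standard_lt, Li. }
  destruct K as [k [K Least]]. exists (S k). apply (completeness _ T_ext). intros M HM e'.
  pose proof (model_PA T_ext HM) as PA. set (e := fun n => @num M (v n)).
  rewrite (sat_instances HM).
  assert (SA : sat e psiA).
  { apply (sat_numsubst HM (fun _ => zero)), (model_sound HM), HA. }
  rewrite (sat_psiA HM) in SA. destruct SA as [x [SA L]].
  (* Were [x] above [k], the proof [k] of [A] would come before [x], which [psiA] forbids. *)
  assert (Lx : lt x (num (S k))).
  { destruct (pa_lt_succ_or PA x (num k)) as [Lx|Lx]; [exact Lx|].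
    destruct (L _ Lx). apply (sat_witness HM); assumption. }
  apply (lt_num PA) in Lx as [i [Li ->]]. exists i. split; [exact Li|].
  destruct SA as [SA|SA].
  - apply (sat_agree (model_box_subst HM)) with (k := 1) (p := Box phi) (e := num i .: e);
      [exact phi_bounded| |exact SA].
    intros [|n] Ln; [reflexivity|lia].
  - exfalso. apply (sat_witness HM) in SA; [|exact qB_Delta0].
    (* An actual proof [i] of [B] makes [B] true in [M], which puts a proof of [A] below [i <= k]
       and contradicts the minimality of [k]. *)
    assert (HB : proves T B) by (apply qB_spec; eauto).
    assert (SB : sat e psiB).
    { apply (sat_numsubst HM (fun _ => zero)), (model_sound HM), HB. }
    rewrite (sat_psiB HM) in SB. destruct SB as [y [Y Ly]].
    assert (L' : lt y (num i)).
    { destruct (pa_lt_succ_or PA (num i) y) as [L'|L']; [|exact L'].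
      destruct (Ly _ L'). apply (sat_witness HM); assumption. }
    apply (lt_num PA) in L' as [j [Lj ->]]. apply (sat_witness HM) in Y; [|exact qA_Delta0].
    apply (Least j); [lia|exact Y].
Qed.

Lemma EP_of_DP_witness : has_DP Delta0_Box T -> has_DP2 Sigma1_Box Sigma1 T ->
  proves T (Ex (Box phi)) -> exists n, proves T (inst (numeral n) (Box phi)).
Proof.
  intros DP DP2 H.
  assert (HA : proves T A).
  { destruct (DP2 A B) as [HA|HB].
    - exact Sigma1_Box_A.
    - exact (sentence_numsubst psiA psiA_bounded).
    - exact Sigma1_B.
    - exact (sentence_numsubst psiB psiB_bounded).
    - exact (proves_A_or_B H).
    - exact HA.
    - exact (proves_A_of_B HB). }
  apply proves_instances_of_A in HA as [n HA].
  exact (DP_instances n DP (B_box phi) phi_bounded HA).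
Qed.

End Fixed_points.

Theorem EP_ClassB_of_DP : re_theory T ->
  has_DP Delta0_Box T -> has_DP2 Sigma1_Box Sigma1 T -> has_EP ClassB T.
Proof.
  intros R DP DP2 p [phi] Bp H.
  pose proof (sigma1_provable_instance R) as P.
  set (Pr n c := exists p, c = code p /\ proves T (inst (numeral n) p)) in P.
  (* Both matrices take the pair code [c] as argument and apply one of its components to [c]
     itself. *)
  destruct (@sigma1_set_formula (fun c => exists a b, c = npair a b /\ Pr c a))
    as [qA [DA [BA SA]]]; [sigma1_tac|].
  destruct (@sigma1_set_formula (fun c => exists a b, c = npair a b /\ Pr c b))
    as [qB [DB [BB SB]]]; [sigma1_tac|].
  refine (@EP_of_DP_witness phi Bp qA qB DA DB BA BB _ _ DP DP2 H).
  - rewrite <- SA, <- inst_closed by (apply psiA_bounded; assumption). split.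
    + intros HA. do 2 eexists. split; [reflexivity|]. eexists. eauto.
    + intros [a [b [E [q [E' HA]]]]]. apply npair_inj in E as [E _].
      rewrite <- E in E'. apply code_inj in E' as <-. exact HA.
  - rewrite <- SB, <- inst_closed by (apply psiB_bounded; assumption). split.
    + intros HB. do 2 eexists. split; [reflexivity|]. eexists. eauto.
    + intros [a [b [E [q [E' HB]]]]]. apply npair_inj in E as [_ E].
      rewrite <- E in E'. apply code_inj in E' as <-. exact HB.
Qed.

(** * From existence back to disjunction *)

Theorem DP_of_EP_Sigma1_Box : has_EP Sigma1_Box T -> has_DP Sigma1_Box T.
Proof.
  intros EP p q Sp Bp Sq Bq H.
  (* The witness selects the disjunct: 0 for [p], anything else for [q]. Its numeral tells which one
     [T] proves. *)
  destruct (EP (Or (And (Eq (Var 0) Zero) p) (And (Neg (Eq (Var 0) Zero)) q))) as [n Hn].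
  - apply S1B_or; apply S1B_and; auto; repeat constructor.
  - simpl. repeat split; auto; eapply bounded_le; try eassumption; lia.
  - apply (completeness _ T_ext). intros M HM e. pose proof (model_PA T_ext HM) as PA.
    destruct (model_sound HM H e) as [S|S].
    + exists zero. left. split; [reflexivity|].
      apply (sat_agree (model_box_subst HM)) with (k := 0) (e := e); [exact Bp|lia|exact S].
    + exists (succ zero). right. split; [apply (pa_succ_zero PA)|].
      apply (sat_agree (model_box_subst HM)) with (k := 0) (e := e); [exact Bq|lia|exact S].
  - destruct n as [|n]; [left|right]; revert Hn; apply (proves_entails T_ext);
      intros M HM e S; pose proof (model_PA T_ext HM) as PA;
      rewrite (sat_inst (model_box_subst HM)), teval_numeral in S.
    + destruct S as [[_ S]|[N _]]; [|destruct N; reflexivity].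
      apply (sat_agree (model_box_subst HM)) with (k := 0) (e := num 0 .: e);
        [exact Bp|lia|exact S].
    + destruct S as [[E _]|[_ S]]; [destruct (pa_succ_zero PA _ E)|].
      apply (sat_agree (model_box_subst HM)) with (k := 0) (e := num (Datatypes.S n) .: e);
        [exact Bq|lia|exact S].
Qed.

End Main.

Lemma Delta0_Box_Sigma1_Box p : Delta0_Box p -> Sigma1_Box p.
Proof.
  induction 1.
  - apply S1B_base, S1_base; assumption.
  - apply S1B_B; assumption.
  - apply S1B_and; assumption.
  - apply S1B_or; assumption.
  - apply S1B_ball; assumption.
  (* [Sigma1_Box] has no rule for [BEx], which is unfolded into an unbounded quantifier over a
     conjunction. *)
  - apply S1B_ex, S1B_and; [repeat constructor|assumption].
Qed.

Theorem theorem5p10 (T : theory)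
    (T_re : re_theory T)
    (T_ext : extends T PA_K)
    (T_nbox : ~ proves T (Box Bot)) :
  ((has_DP Delta0_Box T /\ has_DP2 Sigma1_Box Sigma1 T) <-> has_EP ClassB T)
  /\ (has_EP ClassB T <-> has_EP Sigma1_Box T)
  /\ (has_EP Sigma1_Box T <-> has_DP Sigma1_Box T).
Proof.
  assert (H12 : has_DP Delta0_Box T /\ has_DP2 Sigma1_Box Sigma1 T -> has_EP ClassB T)
    by (intros []; apply EP_ClassB_of_DP; assumption).
  assert (H23 : has_EP ClassB T -> has_EP Sigma1_Box T)
    by (apply EP_ClassB_Sigma1_Box; assumption).
  assert (H34 : has_EP Sigma1_Box T -> has_DP Sigma1_Box T)
    by (apply DP_of_EP_Sigma1_Box; assumption).
  assert (H41 : has_DP Sigma1_Box T -> has_DP Delta0_Box T /\ has_DP2 Sigma1_Box Sigma1 T).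
  { intros DP. split; intros p q Cp Sp Cq Sq; apply DP;
      auto using Delta0_Box_Sigma1_Box, S1B_base. }
  tauto.
Qed.
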